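(* Let $\rho:\overline I\to(0,1)$ and $\gamma:\overline I\to(0,\infty)$ be functions (possibly constants). Let $\tilde E,\tilde E_t\in C^1_p(\overline I,H(\operatorname{curl},\Omega))$ be approximations of $E$ and $\partial_tE$, respectively, where $E$ is the exact electric field (see context). Put $e:=E-\tilde E$, $e_t:=\partial_tE-\tilde E_t$, and assume $e_t(t)\in H(\overset{\circ}{\operatorname{curl}},\Omega)$ for all $t\in I$. Let $Y\in C^1_p(\overline I,H(\operatorname{curl},\Omega))$. Define $\Gamma(t):=\int_0^t\gamma(s)\,ds$, $$\tilde K:=\mu^{-1}\operatorname{curl}\tilde E-Y,\qquad\check K:=\varepsilon\partial_t\tilde E_t+\operatorname{curl}Y-K,$$ $$\begin{aligned}g(t):={}&(1-\rho(t))^{-1}\|\tilde K(t)\|^2_{\mu,\Omega}+2\langle\tilde K,\operatorname{curl}(\tilde E_t-\partial_t\tilde E)\rangle_{\Omega_t}\\&+\int_0^t\gamma(s)^{-1}\|\check K(s)\|^2_{\varepsilon^{-1},\Omega}\,ds+\int_0^t(\gamma(s)\rho(s))^{-1}\|(\mu^{-1}\operatorname{curl}\tilde E_t-\partial_tY)(s)\|^2_{\mu,\Omega}\,ds,\end{aligned}$$ $$z:=\|e_t(0)\|^2_{\varepsilon,\Omega}+\|\operatorname{curl}e(0)\|^2_{\mu^{-1},\Omega}+2\langle\tilde K(0),\operatorname{curl}e(0)\rangle_\Omega,\qquad f(t):=g(t)+z,$$ $$b_{\tilde E,\tilde E_t,\rho;Y,\gamma}(t):=\exp(\Gamma(t))\int_0^t\exp(-\Gamma(s))\gamma(s)f(s)\,ds+f(t),\qquad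 t\in\overline I.$$ Then the following two statements are equivalent: (i) $\tilde E(0)=E_0$ and $\tilde E_t=\partial_t\tilde E$ and $b_{\tilde E,\tilde E_t,\rho;Y,\gamma}=0$ (as a function on $\overline I$). (ii) $\tilde E=E$ and $\tilde E_t=\partial_tE$ and $\mu Y=\operatorname{curl}E$. In words: let the approximations $\tilde E,\tilde E_t$ satisfy $\tilde E_t=\partial_t\tilde E$ and the first initial condition $\tilde E(0)=E_0$ exactly. Then the functional $b_{\tilde E,\tilde E_t,\rho;Y,\gamma}$ vanishes if and only if the approximation $\tilde E$ equals $E$ and $\mu Y$ equals $\operatorname{curl}E$.
   Context: Setting. $\Omega\subset\mathbb R^3$ is a domain (connected open set, bounded or unbounded) with Lipschitz boundary; $T>0$, $I:=(0,T)$, $\Omega_t:=(0,t)\times\Omega$. $\varepsilon,\mu$ are time-independent, real, symmetric, positive definite matrix-valued functions on $\Omega$ with measurable bounded coefficients, whose inverses have the same properties. All fields are real-valued. Norms: for $\Xi=\Omega$ or $\Xi=\Omega_t$, $\langle\cdot,\cdot\rangle_\Xi$ is the $L^2(\Xi,\mathbb R^3)$ scalar product, and for such a matrix $A$, $\|\Phi\|_{A,\Xi}:=\langle A\Phi,\Phi\rangle_\Xi^{1/2}$. Spaces: $H(\operatorname{curl},\Omega):=\{\Phi\in L^2(\Omega,\mathbb R^3):\operatorname{curl}\Phi\in L^2(\Omega,\mathbb R^3)\}$ with its natural norm; $H(\overset{\circ}{\operatorname{curl}},\Omega)$ is the closure in it of the smooth compactly supported vector fields on $\Omega$ (encoding zero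 tangential trace). $C^\ell_p$ denotes fields that are $C^{\ell-1}$ and piecewise $C^\ell$ in time. Exact solution. Let $D:=H(\overset{\circ}{\operatorname{curl}},\Omega)\times H(\operatorname{curl},\Omega)$, $\mathcal H:=L^2(\Omega,\mathbb R^3)\times L^2(\Omega,\mathbb R^3)$, and $D_2:=\{(\Phi,\Psi)\in D:(\varepsilon^{-1}\operatorname{curl}\Psi,\mu^{-1}\operatorname{curl}\Phi)\in D\}$ (with graph norm). The data satisfy $(F,G)\in L^1(I,D_2)\cap C^0(\overline I,D)\cap C^1(\overline I,\mathcal H)$, $(E_0,H_0)\in D_2$, and $(E,H)\in C^0(\overline I,D_2)\cap C^1(\overline I,D)\cap C^2(\overline I,\mathcal H)$ is the unique solution of $$\partial_tE-\varepsilon^{-1}\operatorname{curl}H=F,\quad \partial_tH+\mu^{-1}\operatorname{curl}E=G,\quad E(0)=E_0,\quad H(0)=H_0.$$ Consequently $E$ satisfies $\partial_t\varepsilon\partial_tE+\operatorname{curl}\mu^{-1}\operatorname{curl}E=K$ with $K:=\varepsilon\partial_tF+\operatorname{curl}G$, $E(t)\in H(\overset{\circ}{\operatorname{curl}},\Omega)$, $E(0)=E_0$, $\partial_tE(0)=E_0':=\varepsilon^{-1}\operatorname{curl}H_0+F(0)$. *)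

(* Defs.v *)
From HB Require Import structures.
From mathcomp Require Import all_boot all_order all_algebra.
From mathcomp Require Import all_classical all_reals all_analysis.

Set Implicit Arguments.
Unset Strict Implicit.
Unset Printing Implicit Defensive.

Import Order.TTheory GRing.Theory Num.Theory.
Import numFieldNormedType.Exports.

Local Open Scope classical_set_scope.
Local Open Scope ring_scope.

Notation leb := (@lebesgue_measure _).

(* Points of R^3 are triples, so that the product sigma-algebra, the product
   topology and the product of Lebesgue measures are available; values of
   vector fields are column vectors, so that matrices act on them by *m.
   [mspace3 R] is [space3 R] with the (convertible) Borel structure carried by
   [lebesgue_measure]. *)
Notation space3 R := (R * R * R)%type.
Notation mspace3 R :=
  (measurableTypeR R * measurableTypeR R * measurableTypeR R)%type.
Notation field3 R := ((R * R * R)%type -> 'cV[R]_3).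
Notation mfield3 R := ((R * R * R)%type -> 'M[R]_3).

Section Space.
Context {R : realType}.

Definition vol : {measure set (mspace3 R) -> \bar R} :=
  ((@lebesgue_measure R \x @lebesgue_measure R) \x @lebesgue_measure R)%E.

Definition coords (x : space3 R) : 'cV[R]_3 :=
  \col_(i < 3) nth 0 [:: x.1.1; x.1.2; x.2] i.

Definition unit_vec (i : 'I_3) : space3 R :=
  ((i == 0)%:R, (i == 1)%:R, (i == 2%:R)%:R).

(* Near each boundary point the set is, in suitable orthonormal coordinates
   centred at that point, the open region above the graph of a Lipschitz
   function. *)
Definition lipschitz_boundary (Om : set (space3 R)) : Prop :=
  forall x0, (closure Om `\` interior Om) x0 ->
  exists (U : set (space3 R)) (Q : 'M[R]_3) (phi : R * R -> R),
    [/\ nbhs x0 U, Q *m Q^T = 1%:M, lipschitz phi &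
      forall x, U x ->
        let y := Q *m (coords x - coords x0) in
        Om x <-> phi (y 0 0, y 1 0) < y 2%:R 0].

Definition lipschitz_domain (Om : set (space3 R)) : Prop :=
  [/\ open Om, connected Om & lipschitz_boundary Om].

Definition dot (v w : 'cV[R]_3) : R := \sum_i v i 0 * w i 0.

(* The index set 'I_3 is Z/3Z, so i + 1 and i + 2 are the cyclic successors. *)
Definition classical_curl (phi : field3 R) : field3 R := fun x =>
  \col_i ('D_(unit_vec (i + 1)) (fun y => phi y (i + 2%:R) 0) x
          - 'D_(unit_vec (i + 2%:R)) (fun y => phi y (i + 1) 0) x).

(* C^oo: all iterated partial derivatives are (Frechet) differentiable. *)
Definition smooth (f : space3 R -> R) : Prop :=
  forall (s : seq 'I_3) x,
    differentiable (foldr (fun i (h : space3 R -> R) => 'D_(unit_vec i) h) f s) x.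

Definition test_field (Om : set (space3 R)) (phi : field3 R) : Prop :=
  [/\ forall i, smooth (fun x => phi x i 0),
      compact (closure [set x | phi x != 0]) &
      closure [set x | phi x != 0] `<=` Om].

Definition L2 (Om : set (space3 R)) (Phi : field3 R) : Prop :=
  forall i, measurable_fun (Om : set (mspace3 R)) (fun x => Phi x i 0) /\
    vol.-integrable Om (EFin \o (fun x => Phi x i 0 ^+ 2)).

Definition inner (Om : set (space3 R)) (Phi Psi : field3 R) : R :=
  \int[vol]_(x in Om) dot (Phi x) (Psi x).

Definition mfapp (A : mfield3 R) (Phi : field3 R) : field3 R :=
  fun x => A x *m Phi x.

Definition mfinv (A : mfield3 R) : mfield3 R := fun x => invmx (A x).

Definition wnorm (A : mfield3 R) (Om : set (space3 R)) (Phi : field3 R) : R :=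
  Num.sqrt (inner Om (mfapp A Phi) Phi).

Definition spd_bounded (Om : set (space3 R)) (A : mfield3 R) : Prop :=
  [/\ forall x, Om x -> (A x)^T = A x,
      forall x v, Om x -> v != 0 -> 0 < dot (A x *m v) v,
      forall i j, measurable_fun (Om : set (mspace3 R)) (fun x => A x i j) &
      exists C : R, forall x i j, Om x -> `|A x i j| <= C].

Definition admissible (Om : set (space3 R)) (A : mfield3 R) : Prop :=
  spd_bounded Om A /\ spd_bounded Om (mfinv A).

(* Distributional curl; the boundary-free Green formula has a plus sign. *)
Definition is_curl (Om : set (space3 R)) (Phi Psi : field3 R) : Prop :=
  L2 Om Psi /\ forall phi, test_field Om phi ->
    inner Om Phi (classical_curl phi) = inner Om Psi phi.

(* A representative of the curl, which is determined only almost everywhere. *)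
Definition curl (Om : set (space3 R)) (Phi : field3 R) : field3 R :=
  xget (0 : field3 R) [set Psi | is_curl Om Phi Psi].

End Space.

(* Function spaces are presented by representatives: a set of functions and a
   seminorm, meaningful on that set. *)
Record nspace (R : realType) (V : lmodType R) :=
  NSpace { carrier : set V; snorm : V -> R }.

Section Spaces.
Context {R : realType}.
Implicit Types (Om : set (space3 R)).

Definition L2sp Om : nspace (field3 R) :=
  NSpace (L2 Om) (fun Phi => Num.sqrt (inner Om Phi Phi)).

Definition Hcurl Om : nspace (field3 R) :=
  NSpace [set Phi | L2 Om Phi /\ exists Psi, is_curl Om Phi Psi]
    (fun Phi => Num.sqrt (inner Om Phi Phi
                          + inner Om (curl Om Phi) (curl Om Phi))).

Definition Hcurl0 Om : nspace (field3 R) :=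
  NSpace [set Phi | carrier (Hcurl Om) Phi /\
            forall e : R, 0 < e -> exists2 phi, test_field Om phi &
              snorm (Hcurl Om) (Phi - phi) < e]
    (snorm (Hcurl Om)).

Definition prodsp (V W : lmodType R) (X : nspace V) (Y : nspace W) :
    nspace (V * W)%type :=
  NSpace [set u | carrier X u.1 /\ carrier Y u.2]
    (fun u => Num.sqrt (snorm X u.1 ^+ 2 + snorm Y u.2 ^+ 2)).

Definition Hsp Om := prodsp (L2sp Om) (L2sp Om).

Definition Dsp Om := prodsp (Hcurl0 Om) (Hcurl Om).

Definition maxwell_op Om (eps mu : mfield3 R) (u : field3 R * field3 R) :
    field3 R * field3 R :=
  (mfapp (mfinv eps) (curl Om u.2), mfapp (mfinv mu) (curl Om u.1)).

Definition D2sp Om (eps mu : mfield3 R) :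
    nspace (field3 R * field3 R)%type :=
  NSpace [set u | carrier (Dsp Om) u /\
                  carrier (Dsp Om) (maxwell_op Om eps mu u)]
    (fun u => Num.sqrt (snorm (Dsp Om) u ^+ 2
                        + snorm (Dsp Om) (maxwell_op Om eps mu u) ^+ 2)).

End Spaces.

Section TimeDependent.
Context {R : realType} {V : lmodType R}.
Implicit Types (X : nspace V) (u : R -> V).

Definition C0_on X (a b : R) u : Prop :=
  forall t, t \in `[a, b] -> carrier X (u t) /\
    snorm X (u s - u t) @[s --> within `[a, b] (nbhs t)] --> (0 : R).

(* One-sided at the end points of the interval. *)
Definition has_deriv X (a b : R) u (t : R) (v : V) : Prop :=
  carrier X v /\
  snorm X ((s - t)^-1 *: (u s - u t) - v)
    @[s --> within (`[a, b] `\ t) (nbhs t)] --> (0 : R).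

Fixpoint Ck_on X (k : nat) (a b : R) u : Prop :=
  C0_on X a b u /\
  if k is k'.+1 then
    exists u', (forall t, t \in `[a, b] -> has_deriv X a b u t (u' t)) /\
               Ck_on X k' a b u'
  else True.

Definition pwCk_on X (k : nat) (a b : R) u : Prop :=
  exists2 s : seq R, itv_partition a b s &
    forall i, (i < size s)%N -> Ck_on X k (nth b (a :: s) i) (nth b s i) u.

Definition Ckp_on X (k : nat) (a b : R) u : Prop :=
  Ck_on X k.-1 a b u /\ pwCk_on X k a b u.

(* Bochner integrability on ]0, T[: almost everywhere a limit of simple
   functions, with norm of finite integral. The norm agrees with a Borel
   function only almost everywhere; the library integral of a nonnegative
   function, a supremum over simple minorants, is insensitive to this. *)
Definition simple_on X (T : R) u : Prop :=
  [/\ finite_set (u @` `]0, T[), (forall t, t \in `]0, T[ -> carrier X (u t)) &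
      forall v, measurable (`]0, T[ `&` u @^-1` [set v] : set (measurableTypeR R))].

Definition L1_on X (T : R) u : Prop :=
  (exists2 us : nat -> R -> V, forall n, simple_on X T (us n) &
     {ae leb, forall t, t \in `]0, T[ -> carrier X (u t) /\
        snorm X (u t - us n t) @[n --> \oo] --> (0 : R)}) /\
  (\int[leb]_(t in `]0%R, T[) (snorm X (u t))%:E < +oo)%E.

End TimeDependent.

Section Majorant.
Context {R : realType}.
Context (Om : set (space3 R)) (T : R) (eps mu : mfield3 R).
Implicit Types (u v : R -> field3 R).

(* A representative of the L^2(Om)-derivative on [0, T]; the value at times
   where there is no derivative, such as the finitely many break points of a
   piecewise C^1 field, is irrelevant. *)
Definition dt u : R -> field3 R := fun t =>
  xget (0 : field3 R) [set w | has_deriv (L2sp Om) 0 T u t w].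

(* The L^2 product on ]0, t[ x Om, with L^2(]0, t[ x Om) identified with
   L^2(]0, t[, L^2(Om)). *)
Definition inner_t (t : R) u v : R :=
  \int[leb]_(s in `]0, t[) inner Om (u s) (v s).

(* (E, H) solves the Maxwell initial value problem. *)
Definition maxwell_solution (F G : R -> field3 R) (E0 H0 : field3 R)
    (E H : R -> field3 R) : Prop :=
  [/\ forall t, t \in `]0, T[ ->
        dt E t - mfapp (mfinv eps) (curl Om (H t)) = F t %[ae vol in Om],
      forall t, t \in `]0, T[ ->
        dt H t + mfapp (mfinv mu) (curl Om (E t)) = G t %[ae vol in Om],
      E 0 = E0 %[ae vol in Om] & H 0 = H0 %[ae vol in Om]].

Definition source (F G : R -> field3 R) : R -> field3 R := fun t =>
  mfapp eps (dt F t) + curl Om (G t).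

Definition Ktilde (tE Y : R -> field3 R) : R -> field3 R := fun t =>
  mfapp (mfinv mu) (curl Om (tE t)) - Y t.

Definition Kcheck (tEt Y K : R -> field3 R) : R -> field3 R := fun t =>
  mfapp eps (dt tEt t) + curl Om (Y t) - K t.

Definition curl_defect (tEt Y : R -> field3 R) : R -> field3 R := fun t =>
  mfapp (mfinv mu) (curl Om (tEt t)) - dt Y t.

Definition Gamma (gam : R -> R) (t : R) : R := \int[leb]_(s in `]0, t[) gam s.

Definition Kcheck_integrand (tEt Y K : R -> field3 R) (gam : R -> R) : R -> R :=
  fun s => (gam s)^-1 * wnorm (mfinv eps) Om (Kcheck tEt Y K s) ^+ 2.

Definition defect_integrand (tEt Y : R -> field3 R) (rho gam : R -> R) : R -> R :=
  fun s => (gam s * rho s)^-1 * wnorm mu Om (curl_defect tEt Y s) ^+ 2.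

Definition gfun (tE tEt Y K : R -> field3 R) (rho gam : R -> R) (t : R) : R :=
  (1 - rho t)^-1 * wnorm mu Om (Ktilde tE Y t) ^+ 2
  + 2%:R * inner_t t (Ktilde tE Y) (fun s => curl Om (tEt s - dt tE s))
  + \int[leb]_(s in `]0, t[) Kcheck_integrand tEt Y K gam s
  + \int[leb]_(s in `]0, t[) defect_integrand tEt Y rho gam s.

Definition zval (E tE tEt Y : R -> field3 R) : R :=
  wnorm eps Om (dt E 0 - tEt 0) ^+ 2
  + wnorm (mfinv mu) Om (curl Om (E 0 - tE 0)) ^+ 2
  + 2%:R * inner Om (Ktilde tE Y 0) (curl Om (E 0 - tE 0)).

Definition ffun_t (E tE tEt Y K : R -> field3 R) (rho gam : R -> R) (t : R) : R :=
  gfun tE tEt Y K rho gam t + zval E tE tEt Y.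

Definition b_integrand (E tE tEt Y K : R -> field3 R) (rho gam : R -> R) : R -> R :=
  fun s => expR (- Gamma gam s) * gam s * ffun_t E tE tEt Y K rho gam s.

Definition bfun (E tE tEt Y K : R -> field3 R) (rho gam : R -> R) (t : R) : R :=
  expR (Gamma gam t)
    * (\int[leb]_(s in `]0, t[) b_integrand E tE tEt Y K rho gam s)
  + ffun_t E tE tEt Y K rho gam t.

(* rho and gam are merely functions; this is what is needed for Gamma, g and b
   to be given by (finite) integrals. *)
Definition integrals_defined (E tE tEt Y K : R -> field3 R) (rho gam : R -> R) : Prop :=
  [/\ measurable_fun (`[0, T] : set (measurableTypeR R)) rho,
      leb.-integrable `]0, T[ (EFin \o gam),
      leb.-integrable `]0, T[ (EFin \o Kcheck_integrand tEt Y K gam),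
      leb.-integrable `]0, T[ (EFin \o defect_integrand tEt Y rho gam) &
      leb.-integrable `]0, T[ (EFin \o b_integrand E tE tEt Y K rho gam)].

End Majorant.

(* Main.v *)
Require Import Defs.
From HB Require Import structures.
From mathcomp Require Import all_boot all_order all_algebra.
From mathcomp Require Import all_classical all_reals all_analysis.
From mathcomp Require Import measurable_realfun.
From mathcomp Require Import ring lra.

Set Implicit Arguments.
Unset Strict Implicit.
Unset Printing Implicit Defensive.

Import Order.TTheory GRing.Theory Num.Theory.
Import numFieldNormedType.Exports.

Local Open Scope classical_set_scope.
Local Open Scope ring_scope.

(** If the majorant b vanishes while tE(0) = E_0 and tEt = d/dt tE, then f is a
    sum of nonnegative terms with f <= b = 0, so that mu Y = curl tE, the residual
    eps d/dt tEt + curl Y - K vanishes and e_t(0) = 0. The electric field satisfies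
    eps E'' + curl mu^-1 curl E = K; differentiating the energy
    ||e_t||_eps^2 + ||curl e||_(mu^-1)^2 in time and integrating by parts in space
    (e_t has zero tangential trace), all terms cancel, so the energy is constant,
    hence zero, and then ||e||^2 is constant, hence zero. Time derivatives exist
    only piecewise and the identities hold only almost everywhere in time, but the
    derivatives are continuous off finitely many times, where they therefore vanish.
    The curl being weak, its linearity rests on the fundamental lemma of the
    calculus of variations. *)

(** * Measurability of open sets in space *)

Section Boxes.
Context {R : realType}.
Implicit Types (x : space3 R) (U : set (space3 R)).

(** What shapes the proof is that [curl] and [dt] are representatives picked by [xget]: they are
    linear only up to null sets, and identities are carried by norms and scalar products, which do
    not see null sets. Fields equal almost everywhere have literally the same set of weak curls, and
    paths equal almost everywhere at each time the same derivatives, so there the picked values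
    coincide.

    Linearity of [curl] requires weak curls to be unique, which is tested with smooth bumps built
    from exp(-1/t). Green's formula requires the classical curl of a test field to be its weak curl,
    hence that compactly supported partial derivatives integrate to 0.

    The cancellation rests on Z := mu^-1 curl E - Y. Since mu Y = curl tE, it equals mu^-1 curl e,
    and it lies in H(curl) because [Y] does. The wave equation minus the vanishing residual reads
    eps d/dt e_t = - curl Z, so the two halves of the energy change at the rates -2 <curl Z, e_t>
    and 2 <Z, curl e_t>. *)

Definition box (a b : space3 R) : set (space3 R) :=
  [set x | [/\ x.1.1 \in `]a.1.1, b.1.1[, x.1.2 \in `]a.1.2, b.1.2[ &
               x.2 \in `]a.2, b.2[]].

Definition cbox (a b : space3 R) : set (space3 R) :=
  [set x | [/\ x.1.1 \in `[a.1.1, b.1.1], x.1.2 \in `[a.1.2, b.1.2] &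
               x.2 \in `[a.2, b.2]]].

Definition ratr3 (q : rat * rat * rat) : space3 R :=
  (ratr q.1.1, ratr q.1.2, ratr q.2).

Lemma boxE a b :
  box a b = (`]a.1.1, b.1.1[ `*` `]a.1.2, b.1.2[) `*` `]a.2, b.2[.
Proof. by apply/seteqP; split=> [x [? ? ?]|x [[? ?] ?]]; do ?split. Qed.

Lemma cboxE a b :
  cbox a b = (`[a.1.1, b.1.1] `*` `[a.1.2, b.1.2]) `*` `[a.2, b.2].
Proof. by apply/seteqP; split=> [x [? ? ?]|x [[? ?] ?]]; do ?split. Qed.

Lemma sub_box_cbox a b : box a b `<=` cbox a b.
Proof. by move=> x [/subset_itv_oo_cc ? /subset_itv_oo_cc ? /subset_itv_oo_cc ?]. Qed.

Lemma measurable_box a b : measurable (box a b : set (mspace3 R)).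
Proof. by rewrite boxE; apply: measurableX => //; apply: measurableX. Qed.

Lemma measurable_cbox a b : measurable (cbox a b : set (mspace3 R)).
Proof. by rewrite cboxE; apply: measurableX => //; apply: measurableX. Qed.

Lemma compact_cbox a b : compact (cbox a b).
Proof.
rewrite cboxE; apply: compact_setX; last exact: segment_compact.
by apply: compact_setX; exact: segment_compact.
Qed.

Lemma closed_cbox a b : closed (cbox a b).
Proof. by apply: compact_closed; [exact: norm_hausdorff|exact: compact_cbox]. Qed.

Lemma vol_cbox a b : (vol (cbox a b) < +oo)%E.
Proof.
have fin (c d : R) : ((@lebesgue_measure R) `[c, d]%classic \is a fin_num).
  by rewrite lebesgue_measure_itv/=; case: ifP.
rewrite cboxE.
have -> : vol ((`[a.1.1, b.1.1] `*` `[a.1.2, b.1.2]) `*` `[a.2, b.2]) =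
    ((lebesgue_measure \x lebesgue_measure)%E
       (`[a.1.1, b.1.1] `*` `[a.1.2, b.1.2]) *
     lebesgue_measure `[a.2, b.2]%classic)%E.
  by apply: product_measure1E => //; apply: measurableX.
rewrite product_measure1E//.
by rewrite -ge0_fin_numE ?fin_numM// ?fin// !mule_ge0.
Qed.

Lemma rat_segment_nbhs (y e : R) : 0 < e ->
  exists p q : rat, (y \in `]ratr p, ratr q[) /\
    forall z, z \in `[ratr p, ratr q] -> `|y - z| < e.
Proof.
move=> e0.
have [p] := @rat_in_itvoo R (y - e) y ltac:(lra).
have [q] := @rat_in_itvoo R y (y + e) ltac:(lra).
rewrite !in_itv/= => /andP[q1 q2] /andP[p1 p2]; exists p, q; split.
  by rewrite in_itv/=; apply/andP; split.
by move=> z; rewrite in_itv/= => /andP[z1 z2]; rewrite ltr_norml; lra.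
Qed.

(** Rational corners make the family countable; the closed box is kept inside [U] so that a bump
    supported in it is a test field for [U]. *)
Lemma open_rat_box U x : open U -> U x -> exists p q : rat * rat * rat,
  box (ratr3 p) (ratr3 q) x /\ cbox (ratr3 p) (ratr3 q) `<=` U.
Proof.
move=> oU Ux; have /nbhs_ballP[e /= e0 xeU] := open_nbhs_nbhs (conj oU Ux).
have [p1 [q1 [m1 h1]]] := rat_segment_nbhs x.1.1 e0.
have [p2 [q2 [m2 h2]]] := rat_segment_nbhs x.1.2 e0.
have [p3 [q3 [m3 h3]]] := rat_segment_nbhs x.2 e0.
exists (p1, p2, p3), (q1, q2, q3); split => // z [z1 z2 z3].
by apply: xeU; split; [split; [exact: h1|exact: h2]|exact: h3].
Qed.

Lemma open_bigcup_box U : open U ->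
  U = \bigcup_(pq in [set pq : (rat * rat * rat) * (rat * rat * rat) |
          cbox (ratr3 pq.1) (ratr3 pq.2) `<=` U])
        box (ratr3 pq.1) (ratr3 pq.2).
Proof.
move=> oU; apply/seteqP; split=> [x Ux|x [[p q] /= pqU]].
  by have [p [q [? ?]]] := open_rat_box oU Ux; exists (p, q).
by move=> /sub_box_cbox; exact: pqU.
Qed.

Lemma open_measurable3 U : open U -> measurable (U : set (mspace3 R)).
Proof.
move=> oU; rewrite (open_bigcup_box oU) bigcup_mkcond.
apply: countable_bigcupT_measurable => // pq.
by case: ifPn => // _; exact: measurable_box.
Qed.

Lemma continuous_measurable_fun3 (f : space3 R -> R) :
  continuous f -> measurable_fun (setT : set (mspace3 R)) f.
Proof.
move=> /continuousP cf; apply: (measurability _ (RGenOpens.measurableE R)).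
move=> _ [_ [a [b ->] <-]]; rewrite setTI; apply: open_measurable3.
exact/cf/interval_open.
Qed.

End Boxes.

(** * The Hilbert space of square-integrable fields *)

Section ScalarL2.
Context {R : realType} (Om : set (mspace3 R)) (mOm : measurable Om).
Implicit Types f g h : mspace3 R -> R.

(** The condition that [L2] puts on each component, so that [L2] facts unfold to scalar ones. *)
Definition sL2 f := measurable_fun Om f /\ vol.-integrable Om (EFin \o (fun x => f x ^+ 2)).

Lemma sL2_dominated f h : measurable_fun Om f ->
  vol.-integrable Om (EFin \o h) -> (forall x, Om x -> f x ^+ 2 <= h x) -> sL2 f.
Proof.
move=> mf ih fh; split => //; apply: le_integrable ih => //.
  by apply/measurable_EFinP; exact: measurable_funX.
by move=> x Ox /=; rewrite lee_fin ger0_norm ?sqr_ge0// (le_trans (fh x Ox))// ler_norm.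
Qed.

Lemma sL2_mul_integrable f g : sL2 f -> sL2 g ->
  vol.-integrable Om (EFin \o (fun x => f x * g x)).
Proof.
move=> [mf f2] [mg g2].
apply: (le_integrable mOm _ _ (integrableD mOm f2 g2)).
  by apply/measurable_EFinP; exact: measurable_funM.
move=> x Ox; rewrite /= lee_fin normrM [X in _ <= X]ger0_norm ?addr_ge0 ?sqr_ge0//.
rewrite -[f x ^+ 2]real_normK ?num_real// -[g x ^+ 2]real_normK ?num_real//.
have := normr_ge0 (f x); have := normr_ge0 (g x).
by move: `|f x| `|g x| => p q p0 q0; nra.
Qed.

Lemma sL2D f g : sL2 f -> sL2 g -> sL2 (fun x => f x + g x).
Proof.
move=> Lf Lg.
have [[mf f2] [mg g2]] := (Lf, Lg).
apply: (@sL2_dominated _ (fun x => 2 * f x ^+ 2 + 2 * g x ^+ 2)).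
- exact: measurable_funD.
- have := integrableD mOm (integrableZl mOm 2 f2) (integrableZl mOm 2 g2).
  by apply: eq_integrable => // x _.
- by move=> x _; have := sqr_ge0 (f x - g x); nra.
Qed.

Lemma sL2M_bounded f g C : measurable_fun Om g -> (forall x, Om x -> `|g x| <= C) ->
  sL2 f -> sL2 (fun x => g x * f x).
Proof.
move=> mg gC [mf f2].
apply: (@sL2_dominated _ (fun x => C ^+ 2 * f x ^+ 2)).
- exact: measurable_funM.
- have := integrableZl mOm (C ^+ 2) f2.
  by apply: eq_integrable => // x _.
- move=> x Ox; rewrite exprMn ler_wpM2r ?sqr_ge0// -[leLHS]real_normK ?num_real//.
  by rewrite lerXn2r ?nnegrE// ?gC// (le_trans _ (gC _ Ox)).
Qed.

Lemma sL2Z f k : sL2 f -> sL2 (fun x => k * f x).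
Proof. by move=> Lf; apply: (@sL2M_bounded f (cst k) `|k|). Qed.

Lemma sL20 : sL2 (cst 0).
Proof.
split; first exact: measurable_cst.
have := @integrable0 _ _ R vol Om.
by apply: eq_integrable => // x _; rewrite /= expr0n.
Qed.

End ScalarL2.

Lemma big_I3 (V : nmodType) (F : 'I_3 -> V) : \sum_(i < 3) F i = F 0 + F 1 + F 2%:R.
Proof.
rewrite !big_ord_recl big_ord0 addr0 addrA; congr (F _ + F _ + F _); exact: val_inj.
Qed.

Lemma ge0_Rintegral_eq0_ae d (T : measurableType d) (R : realType)
    (m : {measure set T -> \bar R}) (D : set T) (f : T -> R) : measurable D ->
  m.-integrable D (EFin \o f) -> (forall x, D x -> 0 <= f x) ->
  \int[m]_(x in D) f x = 0 -> {ae m, forall x, D x -> f x = 0}.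
Proof.
move=> mD fi f0 intf0.
have /(ae_eq_integral_abs m mD (measurable_int _ fi)) :
    (\int[m]_(x in D) `|(EFin \o f) x| = 0)%E.
  transitivity (\int[m]_(x in D) (f x)%:E)%E.
    by apply: eq_integral => x /set_mem Dx /=; rewrite ger0_norm// f0.
  by rewrite -[LHS]fineK ?integrable_fin_num//; congr EFin.
by apply: filterS => x /[apply] -[].
Qed.

Section AeVol.
Context {R : realType}.
Implicit Types P Q S : mspace3 R -> Prop.

Lemma vol_aeS P Q : (forall x, P x -> Q x) ->
  {ae vol, forall x, P x} -> {ae vol, forall x, Q x}.
Proof. by move=> PQ; apply: filterS. Qed.

Lemma vol_aeS2 P Q S : (forall x, P x -> Q x -> S x) ->
  {ae vol, forall x, P x} -> {ae vol, forall x, Q x} -> {ae vol, forall x, S x}.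
Proof. by move=> PQ; apply: filterS2. Qed.

End AeVol.

Section L2.
Context {R : realType} (Om : set (space3 R)).
Hypothesis mOm : measurable (Om : set (mspace3 R)).
Implicit Types (u v w : field3 R) (k : R) (A : mfield3 R).

Lemma L20 : L2 Om 0.
Proof.
move=> i; have [m0 i0] := sL20 mOm; split.
  by apply: eq_measurable_fun m0 => x _; rewrite /= mxE.
by apply: eq_integrable i0 => // x _; rewrite /= mxE.
Qed.

Lemma L2D u v : L2 Om u -> L2 Om v -> L2 Om (u + v).
Proof.
move=> Lu Lv i; have [m1 i1] := sL2D mOm (Lu i) (Lv i); split.
  by apply: eq_measurable_fun m1 => x _; rewrite /= mxE.
by apply: eq_integrable i1 => // x _; rewrite /= mxE.
Qed.

Lemma L2Z k u : L2 Om u -> L2 Om (k *: u).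
Proof.
move=> Lu i; have [m1 i1] := sL2Z mOm k (Lu i); split.
  by apply: eq_measurable_fun m1 => x _; rewrite /= mxE.
by apply: eq_integrable i1 => // x _; rewrite /= mxE.
Qed.

Lemma L2N u : L2 Om u -> L2 Om (- u).
Proof. by move=> Lu; rewrite -scaleN1r; exact: L2Z. Qed.

Lemma L2B u v : L2 Om u -> L2 Om v -> L2 Om (u - v).
Proof. by move=> Lu Lv; apply: L2D => //; exact: L2N. Qed.

Lemma dot_integrable u v : L2 Om u -> L2 Om v ->
  vol.-integrable Om (EFin \o (fun x => dot (u x) (v x))).
Proof.
move=> Lu Lv.
have := integrable_sum (mu := vol) mOm (index_enum 'I_3) (P := xpredT)
  (h := fun i x => (u x i 0 * v x i 0)%:E).
move=> /(_ (fun i _ => sL2_mul_integrable mOm (Lu i) (Lv i))).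
by apply: eq_integrable => // x _; rewrite /= /dot sumEFin.
Qed.

Lemma dotC (v w : 'cV[R]_3) : dot v w = dot w v.
Proof. by apply: eq_bigr => i _; rewrite mulrC. Qed.

Lemma dotDl (v v' w : 'cV[R]_3) : dot (v + v') w = dot v w + dot v' w.
Proof. by rewrite -big_split; apply: eq_bigr => i _; rewrite mxE mulrDl. Qed.

Lemma dotZl k (v w : 'cV[R]_3) : dot (k *: v) w = k * dot v w.
Proof. by rewrite mulr_sumr; apply: eq_bigr => i _; rewrite mxE mulrA. Qed.

Lemma dot0l (w : 'cV[R]_3) : dot 0 w = 0.
Proof. by rewrite -(scale0r 0) dotZl mul0r. Qed.

Lemma dot_ge0 (v : 'cV[R]_3) : 0 <= dot v v.
Proof. by apply: sumr_ge0 => i _; rewrite -expr2 sqr_ge0. Qed.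

Lemma dot_eq0 (v : 'cV[R]_3) : (dot v v == 0) = (v == 0).
Proof.
apply/eqP/eqP => [/eqP|->]; last by rewrite /dot big1// => i _; rewrite mxE mul0r.
rewrite psumr_eq0; last by move=> i _; rewrite -expr2 sqr_ge0.
move=> /allP v0; apply/colP => i; rewrite mxE.
by have /implyP/(_ isT) := v0 i (mem_index_enum _); rewrite -expr2 sqrf_eq0 => /eqP.
Qed.

Lemma innerC u v : inner Om u v = inner Om v u.
Proof. by apply: eq_Rintegral => x _; exact: dotC. Qed.

Lemma innerDl u v w : L2 Om u -> L2 Om v -> L2 Om w ->
  inner Om (u + v) w = inner Om u w + inner Om v w.
Proof.
move=> Lu Lv Lw; rewrite /inner -RintegralD//; try exact: dot_integrable.
by apply: eq_Rintegral => x _; exact: dotDl.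
Qed.

Lemma innerZl k u w : L2 Om u -> L2 Om w -> inner Om (k *: u) w = k * inner Om u w.
Proof.
move=> Lu Lw; rewrite /inner -RintegralZl//; try exact: dot_integrable.
by apply: eq_Rintegral => x _; exact: dotZl.
Qed.

Lemma innerNl u w : L2 Om u -> L2 Om w -> inner Om (- u) w = - inner Om u w.
Proof. by move=> Lu Lw; rewrite -scaleN1r innerZl// mulN1r. Qed.

Lemma innerBl u v w : L2 Om u -> L2 Om v -> L2 Om w ->
  inner Om (u - v) w = inner Om u w - inner Om v w.
Proof. by move=> Lu Lv Lw; rewrite innerDl ?innerNl//; exact: L2N. Qed.

Lemma innerDr u v w : L2 Om u -> L2 Om v -> L2 Om w ->
  inner Om w (u + v) = inner Om w u + inner Om w v.
Proof. by move=> Lu Lv Lw; rewrite innerC innerDl// !(innerC w). Qed.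

Lemma innerZr k u w : L2 Om u -> L2 Om w -> inner Om w (k *: u) = k * inner Om w u.
Proof. by move=> Lu Lw; rewrite innerC innerZl// innerC. Qed.

Lemma innerBr u v w : L2 Om u -> L2 Om v -> L2 Om w ->
  inner Om w (u - v) = inner Om w u - inner Om w v.
Proof. by move=> Lu Lv Lw; rewrite innerC innerBl// !(innerC w). Qed.

Lemma inner_ge0 u : 0 <= inner Om u u.
Proof. by apply: Rintegral_ge0 => x _; exact: dot_ge0. Qed.

Lemma Rintegral_ge0_eq0 (f : space3 R -> R) : vol.-integrable Om (EFin \o f) ->
  (forall x, Om x -> 0 <= f x) -> \int[vol]_(x in Om) f x = 0 ->
  f = 0 %[ae vol in Om].
Proof. by move=> fi f0 intf0; exact: (ge0_Rintegral_eq0_ae mOm fi f0 intf0). Qed.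

Lemma inner_eq0 u : L2 Om u -> inner Om u u = 0 -> u = 0 %[ae vol in Om].
Proof.
move=> Lu /Rintegral_ge0_eq0 -/(_ (dot_integrable Lu Lu)) -/(_ (fun _ _ => dot_ge0 _)).
by apply: vol_aeS => x /[apply] /eqP; rewrite dot_eq0 => /eqP.
Qed.

Lemma ae0_inner u : L2 Om u -> u = 0 %[ae vol in Om] -> inner Om u u = 0.
Proof.
move=> Lu u0; rewrite /inner/Rintegral (ae_eq_integral (cst 0%E))//.
- by rewrite integral0.
- exact: measurable_int (dot_integrable Lu Lu).
- apply: vol_aeS u0 => x /[apply] /= ->; congr EFin.
  by apply/eqP; rewrite dot_eq0.
Qed.

(** The square of s u + t v is nonnegative for all s and t. On representatives the form is only
    semidefinite, so a null [v] is a case of its own. *)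
Lemma Cauchy_Schwarz_sqr u v : L2 Om u -> L2 Om v ->
  inner Om u v ^+ 2 <= inner Om u u * inner Om v v.
Proof.
move=> Lu Lv; set a := inner Om u u; set b := inner Om u v; set c := inner Om v v.
have q s t : 0 <= s ^+ 2 * a + 2 * s * t * b + t ^+ 2 * c.
  have := inner_ge0 (s *: u + t *: v).
  have Lsu := L2Z s Lu; have Ltv := L2Z t Lv; have Luv := L2D Lsu Ltv.
  rewrite innerDl// !innerDr// !(innerZl, innerZr)// (innerC v u) -/a -/b -/c.
  by congr (_ <= _); ring.
have c0 : 0 <= c := inner_ge0 v.
have [c00|c00] := eqVneq c 0.
  suff -> : b = 0 by rewrite expr0n/= mulr_ge0// inner_ge0.
  apply/eqP/negPn/negP => b0.
  (* With [c = 0] the form is affine in t; this t gives it the value -1. *)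
  have := q 1 (- (a + 1) / (2 * b)); rewrite c00.
  suff -> : 1 ^+ 2 * a + 2 * 1 * (- (a + 1) / (2 * b)) * b +
    (- (a + 1) / (2 * b)) ^+ 2 * 0 = -1 by rewrite ler0N1.
  by field.
have cp : 0 < c by rewrite lt_def c00.
(* The minimiser t = - b / c at s = 1, scaled by [c] to avoid the division. *)
have := q c (- b).
have -> : c ^+ 2 * a + 2 * c * (- b) * b + (- b) ^+ 2 * c = c * (a * c - b ^+ 2) by ring.
by rewrite pmulr_rge0// subr_ge0.
Qed.

(** Convertible with [snorm (L2sp Om) u], which is how it enters the statements about limits in
    time. *)
Definition nrm2 u := Num.sqrt (inner Om u u).

Lemma nrm2_ge0 u : 0 <= nrm2 u. Proof. exact: sqrtr_ge0. Qed.

Lemma nrm2_sqr u : nrm2 u ^+ 2 = inner Om u u.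
Proof. by rewrite sqr_sqrtr// inner_ge0. Qed.

Lemma Cauchy_Schwarz u v : L2 Om u -> L2 Om v -> `|inner Om u v| <= nrm2 u * nrm2 v.
Proof.
move=> Lu Lv; rewrite -[leRHS]ger0_norm ?mulr_ge0 ?nrm2_ge0//.
by rewrite -ler_sqr ?nnegrE// ?real_normK ?num_real// exprMn !nrm2_sqr Cauchy_Schwarz_sqr.
Qed.

Lemma nrm2D u v : L2 Om u -> L2 Om v -> nrm2 (u + v) <= nrm2 u + nrm2 v.
Proof.
move=> Lu Lv; rewrite -ler_sqr ?nnegrE ?addr_ge0 ?nrm2_ge0// nrm2_sqr.
have Luv := L2D Lu Lv.
rewrite innerDl// !innerDr// (innerC v u) -!nrm2_sqr sqrrD.
have := le_trans (ler_norm _) (Cauchy_Schwarz Lu Lv); lra.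
Qed.

Lemma nrm2Z k u : L2 Om u -> nrm2 (k *: u) = `|k| * nrm2 u.
Proof.
move=> Lu; rewrite /nrm2 innerZl ?innerZr//; last exact: L2Z.
by rewrite mulrA -expr2 sqrtrM ?sqr_ge0// sqrtr_sqr.
Qed.

Lemma nrm2N u : L2 Om u -> nrm2 (- u) = nrm2 u.
Proof. by move=> Lu; rewrite -scaleN1r nrm2Z// normrN1 mul1r. Qed.

Lemma inner_ae0l u v : L2 Om u -> L2 Om v -> u = 0 %[ae vol in Om] -> inner Om u v = 0.
Proof.
move=> Lu Lv /(ae0_inner Lu) u0; apply/eqP; rewrite -normr_eq0 eq_le normr_ge0 andbT.
by rewrite (le_trans (Cauchy_Schwarz Lu Lv))// /nrm2 u0 sqrtr0 mul0r.
Qed.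

Lemma ae_sub0 u v : u = v %[ae vol in Om] <-> u - v = 0 %[ae vol in Om].
Proof.
split; apply: vol_aeS => x /[apply]; first by move=> uv; apply/eqP; rewrite subr_eq0 -uv.
by move=> /eqP; rewrite subr_eq0 => /eqP.
Qed.

Lemma ae_trans u v w : u = v %[ae vol in Om] -> v = w %[ae vol in Om] ->
  u = w %[ae vol in Om].
Proof. by apply: vol_aeS2 => x + + Ox => -> // ->. Qed.

Lemma ae_sym u v : u = v %[ae vol in Om] -> v = u %[ae vol in Om].
Proof. by apply: vol_aeS => x + Ox => ->. Qed.

Lemma aeD u v u' v' : u = u' %[ae vol in Om] -> v = v' %[ae vol in Om] ->
  u + v = u' + v' %[ae vol in Om].
Proof. by apply: vol_aeS2 => x + + Ox; rewrite !fctE => -> // ->. Qed.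

Lemma aeZ k u u' : u = u' %[ae vol in Om] -> k *: u = k *: u' %[ae vol in Om].
Proof. by apply: vol_aeS => x + Ox; rewrite !fctE => ->. Qed.

Lemma aeN u u' : u = u' %[ae vol in Om] -> - u = - u' %[ae vol in Om].
Proof. by apply: vol_aeS => x + Ox; rewrite !fctE => ->. Qed.

Lemma aeB u v u' v' : u = u' %[ae vol in Om] -> v = v' %[ae vol in Om] ->
  u - v = u' - v' %[ae vol in Om].
Proof. by move=> ? ?; apply: aeD => //; exact: aeN. Qed.

Lemma inner_ael u u' v : L2 Om u -> L2 Om u' -> L2 Om v ->
  u = u' %[ae vol in Om] -> inner Om u v = inner Om u' v.
Proof.
move=> Lu Lu' Lv /ae_sub0 uu; apply/eqP; rewrite -subr_eq0 -innerBl//.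
by rewrite inner_ae0l//; exact: L2B.
Qed.

Lemma inner_aer u u' v : L2 Om u -> L2 Om u' -> L2 Om v ->
  u = u' %[ae vol in Om] -> inner Om v u = inner Om v u'.
Proof. by move=> Lu Lu' Lv uu; rewrite !(innerC v); exact: inner_ael. Qed.

Lemma nrm2_ae u u' : L2 Om u -> L2 Om u' ->
  u = u' %[ae vol in Om] -> nrm2 u = nrm2 u'.
Proof.
move=> Lu Lu' uu; rewrite /nrm2; congr Num.sqrt.
by rewrite (inner_ael Lu Lu' Lu uu) (inner_aer Lu Lu' Lu' uu).
Qed.

Lemma nrm2_eq0 u : L2 Om u -> nrm2 u = 0 -> u = 0 %[ae vol in Om].
Proof.
move=> Lu u0; apply: inner_eq0 => //.
by rewrite -nrm2_sqr u0 expr0n.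
Qed.

End L2.

(** * Integrals of partial derivatives *)

(* The library's own sigma-finite structure on products is shadowed by the one
   for products of subprobabilities. *)
Section SigmaFiniteProduct.
Context d1 d2 (T1 : measurableType d1) (T2 : measurableType d2) (R : realType).
Variable m1 : {sigma_finite_measure set T1 -> \bar R}.
Variable m2 : {sigma_finite_measure set T2 -> \bar R}.

Lemma product_measure1_sigma_finite : sigma_finite setT (m1 \x m2)%E.
Proof.
have /sigma_finiteP[F [TF ndF Foo]] := sigma_finiteT m1.
have /sigma_finiteP[G [TG ndG Goo]] := sigma_finiteT m2.
exists (fun n => F n `*` G n).
  apply/seteqP; split=> // -[x y] _.
  have [n _ Fnx] : (\bigcup_i F i) x by rewrite -TF.
  have [k _ Gky] : (\bigcup_i G i) y by rewrite -TG.
  (* Both exhaustions are nondecreasing, so one index serves both coordinates. *)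
  exists (maxn n k) => //; split.
  - by move: x Fnx; exact/subsetPset/ndF/leq_maxl.
  - by move: y Gky; exact/subsetPset/ndG/leq_maxr.
move=> k; have [mF Fk] := Foo k; have [mG Gk] := Goo k.
split; first exact: measurableX.
by rewrite product_measure1E// -ge0_fin_numE ?mule_ge0// fin_numM// ge0_fin_numE.
Qed.

Definition sigma_finite_prod : {sigma_finite_measure set (T1 * T2)%type -> \bar R} :=
  HB.pack (m1 \x m2)%E
    (Measure_isSigmaFinite.Build _ _ _ (m1 \x m2)%E product_measure1_sigma_finite).

End SigmaFiniteProduct.

Section CompactSupport.
Context {R : realType}.
Implicit Types (f g h : space3 R -> R) (M : R).

(** Compact support by means of a radius. The norm is the maximum norm, so the ball is a cube, of
    finite volume. *)
Definition vanish M f := forall x, M <= `|x| -> f x = 0.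

Definition corner M : space3 R := (M, M, M).

Lemma norm_cbox M x : `|x| <= M -> cbox (corner (- M)) (corner M) x.
Proof.
rewrite prod_normE ge_max prod_normE ge_max => /andP[/andP[h1 h2] h3].
by split; rewrite in_itv/= -ler_norml.
Qed.

Lemma vanish_cbox M f x : vanish M f -> ~ cbox (corner (- M)) (corner M) x -> f x = 0.
Proof.
move=> fM Mx; apply: fM; rewrite leNgt; apply/negP => /ltW xM.
exact/Mx/norm_cbox.
Qed.

Lemma vanish_integrable M f : continuous f -> vanish M f ->
  vol.-integrable setT (EFin \o f).
Proof.
move=> cf fM; pose K := cbox (corner (- M)) (corner M).
have mK : measurable (K : set (mspace3 R)) := measurable_cbox _ _.
have : vol.-integrable K (EFin \o f).
  apply: measurable_bounded_integrable => //; first exact: vol_cbox.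
    exact: measurable_funS (continuous_measurable_fun3 cf).
  have /compact_bounded : compact (f @` K).
    apply: continuous_compact; last exact: compact_cbox.
    exact: continuous_subspaceT.
  by move=> [N [Nr Nb]]; exists N; split => // m /Nb h x Kx; apply: h; exists x.
move=> iK; have := (@integrable_mkcond _ (mspace3 R) R vol K (EFin \o f) mK).1 iK; apply: eq_integrable => // x _.
by rewrite patchE; case: ifPn => // /negP; rewrite inE => /(vanish_cbox fM)/= ->.
Qed.

Lemma vanish_sqr M f : vanish M f -> vanish M (fun x => f x ^+ 2).
Proof. by move=> fM x /fM ->; rewrite expr0n. Qed.

Lemma vanish_sL2 (D : set (mspace3 R)) M f : measurable D ->
  continuous f -> vanish M f -> sL2 D f.
Proof.
move=> mD cf fM; split.
  exact: measurable_funS (continuous_measurable_fun3 cf).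
apply: (integrableS measurableT) => //.
apply: (@vanish_integrable M); last exact: vanish_sqr.
by move=> x; apply: (cvgM (cf x) (cf x)).
Qed.

Lemma vanish_near M f x : vanish M f -> M < `|x| -> \near x, f x = 0.
Proof.
move=> fM Mx; near=> y; apply: fM; apply: ltW.
near: y; apply: (@open_nbhs_nbhs _ x [set y | M < `|y|]); split => //.
apply: (@open_comp _ _ (fun y : space3 R => `|y|) [set z | M < z]).
  by move=> y _; exact: norm_continuous.
exact: open_gt.
Unshelve. all: by end_near. Qed.

(** On the sphere of radius [M] itself, [f] need not vanish nearby; a larger radius leaves room for
    a neighbourhood on which it does. *)
Lemma vanish_derive M f v : vanish M f -> vanish (M + 1) ('D_v f).
Proof.
move=> fM x Mx; have xM : M < `|x| by lra.
have -> : 'D_v f x = 'D_v (cst 0) x.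
  by apply: near_eq_derive; exact: vanish_near fM xM.
exact: derive_cst.
Qed.

(** The two difference quotients are the same function of the increment. *)
Lemma line_derive f (e q : space3 R) (t : R) :
  'D_e f (t *: e + q) = 'D_1 (fun s : R => f (s *: e + q)) t.
Proof.
rewrite /derive; apply: (congr1 (fun g : R -> R => lim (g @ 0^'))).
apply/funext => s; rewrite /=.
by rewrite scalerDl addrA [s%:A]mulr1.
Qed.

Lemma line_derivable f (e q : space3 R) (t : R) :
  derivable f (t *: e + q) e -> derivable (fun s : R => f (s *: e + q)) t 1.
Proof.
have -> // : derivable f (t *: e + q) e = derivable (fun s : R => f (s *: e + q)) t 1.
rewrite /derivable; apply: (congr1 (fun g : R -> R => cvg (g @ 0^'))).
apply/funext => s; rewrite /=.
by rewrite scalerDl addrA [s%:A]mulr1.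
Qed.

Lemma integral_deriv_vanish (f : R -> R) (M : R) :
  (forall t, derivable f t 1) -> continuous (fun t => 'D_1 f t) ->
  (forall t, M <= `|t| -> f t = 0) ->
  (\int[leb]_t ('D_1 f t)%:E = 0)%E.
Proof.
(* [N] is positive, so that [-N, N] is not degenerate, and exceeds [M], so that [f] is 0 at both
   ends and its derivative is 0 outside. *)
move=> df cf fM; pose N := Num.max M 0 + 1.
have N0 : 0 < N by rewrite ltr_wpDl// le_max lexx orbT.
have MN : M < N by rewrite ltr_pwDr// le_max lexx.
have dfN t : N < `|t| -> 'D_1 f t = 0.
  move=> Nt; rewrite (@near_eq_derive _ _ _ _ (cst 0)) ?derive_cst//.
  near=> s; apply: fM; apply: (le_trans (ltW MN)); apply: ltW.
  near: s; apply: (@open_nbhs_nbhs _ t [set y | N < `|y|]); split => //.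
  apply: (@open_comp _ _ (fun y : R => `|y|) [set z | N < z]).
    by move=> y _; exact: norm_continuous.
  exact: open_gt.
have NN : - N < N by lra.
transitivity (\int[leb]_(t in `[(- N)%R, N]) ('D_1 f t)%:E)%E.
  rewrite [RHS]integral_mkcond; apply: eq_integral => t _.
  rewrite patchE; case: ifPn => // /negP.
  rewrite inE /= in_itv/= -ler_norml => /negP; rewrite -ltNge => /dfN ->//.
have fc t : {for t, continuous f}.
  by apply: differentiable_continuous; exact/derivable1_diffP.
rewrite (@continuous_FTC2 _ _ f)//.
- by rewrite !fM ?subee// ?normrN ger0_norm ?ltW.
- exact: continuous_subspaceT.
- split; first by move=> t _; exact: df.
  + exact/cvg_at_right_filter/fc.
  + exact/cvg_at_left_filter/fc.
- by move=> t _; rewrite derive1E.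
Unshelve. all: by end_near. Qed.

Lemma integral_line_derive f (e q : space3 R) M : `|e| = 1 ->
  (forall x, derivable f x e) -> continuous ('D_e f) -> vanish M f ->
  (\int[leb]_t ('D_e f (t *: e + q))%:E = 0)%E.
Proof.
move=> e1 df cf fM.
under eq_integral do rewrite line_derive.
(* As [e] is a unit vector, |t e + q| >= |t| - |q|: beyond this radius the line has left the
   support. *)
apply: (@integral_deriv_vanish _ (M + `|q|)).
- by move=> t; apply: line_derivable.
- move=> t.
  have -> : (fun s : R => 'D_1 (fun r : R => f (r *: e + q)) s) =
            'D_e f \o (fun s : R => s *: e + q).
    by apply/funext => s /=; rewrite line_derive.
  apply: continuous_comp; last exact: cf.
  by apply: cvgD; [apply: cvgZr_tmp; exact: cvg_id|exact: cvg_cst].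
- move=> t tM; apply: fM.
  have : `|t *: e| <= `|t *: e + q| + `|q| by rewrite -{1}(addrK q (t *: e)) ler_normB.
  by rewrite normrZ e1 mulr1; lra.
Qed.

Lemma norm_unit_vec (i : 'I_3) : `|unit_vec i : space3 R| = 1.
Proof.
rewrite !prod_normE/=.
by case: i => -[|[|[|//]]] ? /=; rewrite ?normr0 ?normr1/=;
  rewrite /Num.max ?ltxx ?ltr01 ?ltr10 //= ?ltxx ?ltr01 ?ltr10.
Qed.

(** Splits a point into its [i]-th coordinate times the unit vector and a base point free of that
    coordinate, so that a coordinate integral becomes an integral along a line. *)
Lemma line_pointE (i : 'I_3) (x y z : R) : (x, y, z) =
  (if i == 0 then x else if i == 1 then y else z) *: (unit_vec i : space3 R) +
  (if i == 0 then (0, y, z) else if i == 1 then (x, 0, z) else (x, y, 0)).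
Proof.
by case: i => -[|[|[|//]]] ilt /=; congr ((_, _), _) => /=;
  rewrite /GRing.scale/= ?mulr1 ?mulr0 ?addr0 ?add0r.
Qed.

(** Fubini with the [i]-th coordinate innermost, where the integral along a line is 0. As [vol] is
    the product of an area and a length, one exchange reaches coordinate 2; coordinates 0 and 1 need
    a second one, in the plane at height [z], for almost every [z], where the section is
    integrable. *)
Lemma integral_partial f (i : 'I_3) M :
  (forall x, derivable f x (unit_vec i)) -> continuous ('D_(unit_vec i) f) ->
  vanish M f -> (\int[vol]_x ('D_(unit_vec i) f x)%:E = 0)%E.
Proof.
move=> df cf fM; pose g : space3 R -> \bar R := fun x => ('D_(unit_vec i) f x)%:E.
have ig : vol.-integrable setT g.
  exact: (@vanish_integrable (M + 1) _ cf (vanish_derive _ fM)).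
have line q : (\int[leb]_t g (t *: (unit_vec i : space3 R) + q)%R = 0)%E.
  exact: (@integral_line_derive f (unit_vec i) q M (norm_unit_vec i) df cf fM).
pose area := sigma_finite_prod (@lebesgue_measure R) (@lebesgue_measure R).
have E12 := integral12_prod_meas1 (m1 := area) (m2 := @lebesgue_measure R) ig.
have E21 := integral21_prod_meas1 (m1 := area) (m2 := @lebesgue_measure R) ig.
have [i2|i2] := boolP ((i == 0) || (i == 1)); last first.
  apply: (etrans (esym E12)); apply: integral0_eq => -[x y] _.
  apply: etrans (line (x, y, 0)); apply: eq_integral => z _; rewrite (line_pointE i x y z).
  by move: i2; rewrite negb_or => /andP[/negbTE -> /negbTE ->].
apply: (etrans (esym E21)).
have mG := measurable_fubini_G (m1 := area) (m2 := @lebesgue_measure R) ig.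
rewrite [LHS](ae_eq_integral (cst 0%E)) ?integral0//.
apply: filterS (ae_integrable2 (m1 := area) (m2 := @lebesgue_measure R) ig) => z iz _.
have [i0|i0] := eqVneq i 0.
  apply: (etrans (esym (integral21_prod_meas1 iz))); apply: integral0_eq => y _.
  apply: etrans (line (0, y, z)); apply: eq_integral => x _.
  by rewrite (line_pointE i x y z) i0.
have i1 : i == 1 by move: i2; rewrite (negbTE i0).
apply: (etrans (esym (integral12_prod_meas1 iz))); apply: integral0_eq => x _.
apply: etrans (line (x, 0, z)); apply: eq_integral => y _.
by rewrite (line_pointE i x y z) (negbTE i0) i1.
Qed.

End CompactSupport.

(** * Test fields *)

Section TestFields.
Context {R : realType}.
Implicit Types (f g h : space3 R -> R) (M : R) (phi psi : field3 R).

Lemma smooth_differentiable f x : smooth f -> differentiable f x.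
Proof. by move=> sf; exact: sf [::] x. Qed.

Lemma smooth_continuous f : smooth f -> continuous f.
Proof. by move=> sf x; apply: differentiable_continuous; exact: smooth_differentiable. Qed.

Lemma smooth_derive f i : smooth f -> smooth ('D_(unit_vec i) f).
Proof. by move=> sf s x; have := sf (rcons s i) x; rewrite foldr_rcons. Qed.

Lemma smooth_derivable f x v : smooth f -> derivable f x v.
Proof. by move=> sf; apply: diff_derivable; exact: smooth_differentiable. Qed.

Definition parts_integrand i f g x : R :=
  f x * 'D_(unit_vec i) g x + g x * 'D_(unit_vec i) f x.

Lemma parts_integrandE i f g : smooth f -> smooth g ->
  'D_(unit_vec i) (f * g) = parts_integrand i f g.
Proof.
by move=> sf sg; apply/funext => x; rewrite deriveM//; exact: smooth_derivable.
Qed.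

Lemma continuous_parts i f g : smooth f -> smooth g -> continuous (parts_integrand i f g).
Proof.
move=> sf sg x; have cf := smooth_continuous sf; have cg := smooth_continuous sg.
have cdf := smooth_continuous (smooth_derive i sf).
have cdg := smooth_continuous (smooth_derive i sg).
exact: cvgD (cvgM (cf x) (cdg x)) (cvgM (cg x) (cdf x)).
Qed.

Lemma vanish_mul M f g : vanish M f -> vanish M (f * g).
Proof. by move=> fM x /fM; rewrite !fctE => ->; rewrite mul0r. Qed.

Lemma parts_integrable i M f g : smooth f -> smooth g -> vanish M f ->
  vol.-integrable setT (EFin \o parts_integrand i f g).
Proof.
move=> sf sg fM; apply: (@vanish_integrable _ (M + 1)); first exact: continuous_parts.
by rewrite -parts_integrandE//; apply: vanish_derive; exact: vanish_mul.
Qed.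

Lemma integral_parts i M f g : smooth f -> smooth g -> vanish M f ->
  \int[vol]_x parts_integrand i f g x = 0.
Proof.
move=> sf sg fM; have E := parts_integrandE i sf sg.
have -> : \int[vol]_x parts_integrand i f g x =
    fine (\int[vol]_x ('D_(unit_vec i) (f * g) x)%:E)%E.
  by congr fine; apply: eq_integral => x _; rewrite -E.
rewrite (@integral_partial _ (f * g) i M)//.
- by move=> x; apply: derivableM; exact: smooth_derivable.
- by rewrite E; exact: continuous_parts.
- exact: vanish_mul.
Qed.

Lemma test_field_vanish Om phi : test_field Om phi ->
  exists M, forall i, vanish M (fun x => phi x i 0).
Proof.
move=> [_ /compact_bounded[N [Nr Nb]] _].
(* Compactness bounds the support by every number above [N]; the bound [N + 1] contradicts a norm of
   at least [N + 2]. *)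
exists (N + 2) => i x xN; have [-> | /eqP p0] := eqVneq (phi x) 0; first by rewrite mxE.
have /= := Nb (N + 1) _ x; rewrite ltrDl ltr01 => /(_ isT) h.
have : `|x| <= N + 1 by apply: h; apply: subset_closure; exact/eqP.
by lra.
Qed.

Lemma test_field_out Om phi x : test_field Om phi -> ~ Om x -> phi x = 0.
Proof.
move=> [_ _ sOm] nOx; apply: contra_notP nOx => /eqP p0.
by apply: sOm; exact: subset_closure.
Qed.

Lemma L2_test (Om : set (space3 R)) phi : measurable (Om : set (mspace3 R)) ->
  test_field Om phi -> L2 Om phi.
Proof.
move=> mOm tphi; have [M pM] := test_field_vanish tphi; have [sphi _ _] := tphi.
by move=> i; apply: (vanish_sL2 mOm (smooth_continuous (sphi i)) (pM i)).
Qed.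

Lemma L2_classical_curl (Om : set (space3 R)) phi : measurable (Om : set (mspace3 R)) ->
  test_field Om phi -> L2 Om (classical_curl phi).
Proof.
move=> mOm tphi; have [M pM] := test_field_vanish tphi; have [sphi _ _] := tphi.
move=> i; suff : sL2 (Om : set (mspace3 R)) (fun x => classical_curl phi x i 0) by [].
have -> : (fun x => classical_curl phi x i 0) = fun x =>
    'D_(unit_vec (i + 1)) (fun y => phi y (i + 2%:R) 0) x
          - 'D_(unit_vec (i + 2%:R)) (fun y => phi y (i + 1) 0) x.
  by apply/funext => x; rewrite mxE.
apply: (@vanish_sL2 _ _ (M + 1)) => //.
  have c j k := smooth_continuous (smooth_derive j (sphi k)).
  by move=> x; exact: cvgB (c _ _ x) (c _ _ x).
by move=> x Mx; rewrite !(vanish_derive _ (pM _))// subr0.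
Qed.

Let I3_12 : 1 + 2%:R = 0 :> 'I_3. Proof. exact/val_inj. Qed.
Let I3_21 : 2%:R + 1 = 0 :> 'I_3. Proof. exact/val_inj. Qed.
Let I3_22 : 2%:R + 2%:R = 1 :> 'I_3. Proof. exact/val_inj. Qed.
Let I3_11 : 1 + 1 = 2%:R :> 'I_3. Proof. exact/val_inj. Qed.
Let I3E := (I3_12, I3_21, I3_22, I3_11).

(* div (psi x phi) = phi . curl psi - curl phi . psi *)
Lemma div_cross_identity (a b : 'I_3 -> R) (da db : 'I_3 -> 'I_3 -> R) :
  a 0 * (db 1 2%:R - db 2%:R 1) + a 1 * (db 2%:R 0 - db 0 2%:R)
    + a 2%:R * (db 0 1 - db 1 0)
  - ((da 1 2%:R - da 2%:R 1) * b 0 + (da 2%:R 0 - da 0 2%:R) * b 1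
    + (da 0 1 - da 1 0) * b 2%:R) =
  (a 2%:R * db 0 1 + b 1 * da 0 2%:R - (a 1 * db 0 2%:R + b 2%:R * da 0 1))
  + (a 0 * db 1 2%:R + b 2%:R * da 1 0 - (a 2%:R * db 1 0 + b 0 * da 1 2%:R))
  + (a 1 * db 2%:R 0 + b 0 * da 2%:R 1 - (a 0 * db 2%:R 1 + b 1 * da 2%:R 0)).
Proof.
move: (a 0) (a 1) (a 2%:R) (b 0) (b 1) (b 2%:R) => a0 a1 a2 b0 b1 b2.
move: (da 0 1) (da 0 2%:R) (da 1 0) (da 1 2%:R) (da 2%:R 0) (da 2%:R 1).
move: (db 0 1) (db 0 2%:R) (db 1 0) (db 1 2%:R) (db 2%:R 0) (db 2%:R 1).
by move=> *; ring.
Qed.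

(** The difference of the two integrands is the divergence of psi x phi. Each [B i j k] is the
    [i]-th derivative of a difference of products of components and integrates to 0 over the whole
    space, which may replace [Om] because test fields vanish outside it. *)
Lemma classical_curl_sym (Om : set (space3 R)) phi psi :
  measurable (Om : set (mspace3 R)) -> test_field Om phi -> test_field Om psi ->
  inner Om phi (classical_curl psi) = inner Om (classical_curl phi) psi.
Proof.
move=> mOm tphi tpsi; apply/eqP; rewrite -subr_eq0.
have [Lphi Lpsi] := (L2_test mOm tphi, L2_test mOm tpsi).
have [Lcphi Lcpsi] := (L2_classical_curl mOm tphi, L2_classical_curl mOm tpsi).
rewrite /inner -RintegralB//; try exact: dot_integrable.
have [M pM] := test_field_vanish tphi; have [sphi _ _] := tphi; have [spsi _ _] := tpsi.
pose A i j k := parts_integrand i (fun x => phi x j 0) (fun x => psi x k 0).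
have iA i j k : vol.-integrable setT (EFin \o A i j k).
  exact: parts_integrable (pM j).
have A0 i j k : \int[vol]_x A i j k x = 0 by exact: integral_parts (pM j).
pose B i j k x := A i j k x - A i k j x.
have iB i j k : vol.-integrable setT (EFin \o B i j k).
  have := integrableB measurableT (iA i j k) (iA i k j).
  exact: eq_integrable.
have B0 i j k : \int[vol]_x B i j k x = 0.
  by rewrite RintegralB// !A0 subrr.
have iBB i j k i' j' k' : vol.-integrable setT (EFin \o (fun x => B i j k x + B i' j' k' x)).
  have := integrableD measurableT (iB i j k) (iB i' j' k').
  exact: eq_integrable.
have dE x : dot (phi x) (classical_curl psi x) - dot (classical_curl phi x) (psi x) =
    B 0 2%:R 1 x + B 1 0 2%:R x + B 2%:R 1 0 x.
  rewrite /dot !big_I3 !mxE !add0r !I3E.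
  exact: (div_cross_identity (fun i => phi x i 0) (fun i => psi x i 0)
    (fun i j => 'D_(unit_vec i) (fun y => phi y j 0) x)
    (fun i j => 'D_(unit_vec i) (fun y => psi y j 0) x)).
rewrite Rintegral_mkcond; apply/eqP.
transitivity (\int[vol]_x (B 0 2%:R 1 x + B 1 0 2%:R x + B 2%:R 1 0 x)).
  apply: eq_Rintegral => x _; rewrite -dE patchE; case: ifPn => // /negP; rewrite inE => nOx.
  rewrite (test_field_out tphi nOx) (test_field_out tpsi nOx).
  by rewrite [X in _ - X]dotC !dot0l subrr.
by rewrite RintegralD// RintegralD// !B0 !addr0.
Qed.

Lemma is_curl_test (Om : set (space3 R)) phi : measurable (Om : set (mspace3 R)) ->
  test_field Om phi -> is_curl Om phi (classical_curl phi).
Proof.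
move=> mOm tphi; split; first exact: L2_classical_curl.
by move=> psi tpsi; exact: classical_curl_sym.
Qed.

End TestFields.

(** * Smooth bump functions *)

Section FlatExponential.
Context {R : realType}.
Implicit Types (t : R) (k n : nat).

(** For [k = 0] the classical exp(-1/t), flat at 0. The powers of 1/t are those that occur in its
    derivatives, so the span of the family is closed under differentiation. *)
Definition flat_exp k t : R := if 0 < t then t^-1 ^+ k * expR (- t^-1) else 0.

(** With y = 1/t, the exponential of y dominates the term y^(k+2)/(k+2)! of its series. The exponent
    is [k.+1] because the difference quotient of [flat_exp k] at 0 contributes one more factor
    1/t. *)
Lemma flat_exp_le k t : 0 < t -> t^-1 ^+ k.+1 * expR (- t^-1) <= k.+2`!%:R * t.
Proof.
move=> t0; set y := t^-1; have y0 : 0 < y by rewrite invr_gt0.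
have h : y ^+ k.+2 / k.+2`!%:R <= expR y.
  by apply: le_trans (expR_ge1Dxn k.+1 (ltW y0)); rewrite lerDr.
have f0 : 0 < k.+2`!%:R :> R by rewrite ltr0n fact_gt0.
rewrite expRN ler_pdivrMr ?expR_gt0//.
rewrite -[t]invrK -/y mulrAC ler_pdivlMr// -exprSr.
by move: h; rewrite ler_pdivrMr// mulrC.
Qed.

Lemma is_derive_flat_exp0 k : is_derive (0 : R) 1 (flat_exp k) 0.
Proof.
have c : h^-1 *: (flat_exp k (h *: 1 + 0) - flat_exp k 0) @[h --> (0:R)^'] --> (0 : R).
  apply/cvgr0Pnorm_lt => e e0; near=> h.
  rewrite /flat_exp ltxx subr0 addr0 [_ *: 1]mulr1.
  case: ifPn => [h0|_]; last by rewrite scaler0 normr0.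
  rewrite /GRing.scale/= mulrA -exprS ger0_norm; last first.
    by rewrite mulr_ge0 ?expR_ge0// exprn_ge0// invr_ge0 ltW.
  apply: le_lt_trans (flat_exp_le _ h0) _.
  have f0 : 0 < k.+2`!%:R :> R by rewrite ltr0n fact_gt0.
  rewrite -ltr_pdivlMl// mulrC -[h]ger0_norm; last exact: ltW.
  near: h; apply: dnbhs0_lt; rewrite divr_gt0//.
apply: DeriveDef; first by apply/cvg_ex; exists 0.
exact: cvg_lim.
Unshelve. all: by end_near. Qed.

Lemma is_derive_flat_exp k t :
  is_derive t 1 (flat_exp k) (flat_exp k.+2 t - k%:R * flat_exp k.+1 t).
Proof.
have [t0|t0|->] := ltgtP t 0.
- apply: (@near_eq_is_derive _ _ _ (cst 0)).
    by near=> s; rewrite /flat_exp ifN// -leNgt ltW//; near: s; exact: lt_nbhsl.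
  rewrite /flat_exp !ifN -?leNgt ?ltW// mulr0 subr0; exact: is_derive_cst.
- apply: (@near_eq_is_derive _ _ _ ((GRing.inv : R -> R) ^+ k * (expR \o (fun s => - s^-1)))).
    by near=> s; rewrite !fctE /flat_exp ifT//; near: s; exact: lt_nbhsr.
  have D1 : is_derive t 1 (GRing.inv : R -> R) (- t ^- 2).
    have := @is_deriveV _ id t 1 1 _ (is_derive_id _ _).
    by rewrite gt_eqF// => /(_ isT) /is_derive_eq; apply; rewrite [_ *: _]mulr1.
  have D2 : is_derive t 1 (fun s : R => - s^-1) (t ^- 2).
    by have := is_deriveN D1; rewrite opprK.
  have D3 := @is_derive1_comp _ expR (fun s : R => - s^-1) t _ _ (is_derive_expR _) D2.
  have := is_deriveM (is_deriveX k D1) D3; move/is_derive_eq; apply.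
  rewrite /flat_exp !t0 /= /GRing.scale/= !fctE -exprVn.
  by case: k => [|k]; rewrite ?mul0r ?mulr0 ?addr0 ?subr0 ?expr0 ?mul1r/= -?exprVn ?(exprS _ k.+2) ?(exprS _ k.+1) ?(exprS _ k); ring.
- apply: is_derive_eq (is_derive_flat_exp0 k) _.
  by rewrite /flat_exp ltxx mulr0 subr0.
Unshelve. all: by end_near. Qed.

Lemma flat_exp0_ge0 t : 0 <= flat_exp 0 t.
Proof. by rewrite /flat_exp; case: ifP => // _; rewrite expr0 mul1r expR_ge0. Qed.

Lemma flat_exp0_le1 t : flat_exp 0 t <= 1.
Proof.
rewrite /flat_exp; case: ifP => // t0; rewrite expr0 mul1r -expR0 ler_expR.
by rewrite oppr_le0 invr_ge0 ltW.
Qed.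

Lemma cvg_flat_exp0 t : 0 < t -> flat_exp 0 (n.+1%:R * t) @[n --> \oo] --> (1 : R).
Proof.
move=> t0.
suff : flat_exp 0 (n.+1%:R * t) @[n --> \oo] --> expR (- (t^-1 * 0)).
  by rewrite mulr0 oppr0 expR0.
have -> : (fun n => flat_exp 0 (n.+1%:R * t)) = fun n => expR (- (t^-1 * harmonic n)).
  apply/funext => n; have nt : 0 < n.+1%:R * t by rewrite mulr_gt0.
  by rewrite /flat_exp nt expr0 mul1r invfM mulrC.
apply: continuous_cvg; first exact: continuous_expR.
by apply: cvgN; apply: cvgMr; exact: cvg_harmonic.
Qed.

Variables (n : nat) (a b : R).

(* The span of these products is closed under differentiation, whence the
   smoothness of the bump [flat_exp 0 (n (t - a)) * flat_exp 0 (n (b - t))]. *)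
Inductive bump_span : (R -> R) -> Prop :=
| bump_base k l :
    bump_span (fun t => flat_exp k (n%:R * (t - a)) * flat_exp l (n%:R * (b - t)))
| bump_add f g : bump_span f -> bump_span g -> bump_span (f + g)
| bump_scale c f : bump_span f -> bump_span (c *: f).

Lemma bump_span_derive f : bump_span f ->
  exists2 f', bump_span f' & forall t, is_derive t 1 f (f' t).
Proof.
elim=> [k l|f1 f2 _ [d1 s1 D1] _ [d2 s2 D2]|c f1 _ [d1 s1 D1]]; last first.
- exists (c *: d1); first exact: bump_scale.
  by move=> t; exact: is_deriveZ (D1 t).
- exists (d1 + d2); first exact: bump_add.
  by move=> t; exact: is_deriveD (D1 t) (D2 t).
pose B i j (t : R) : R := flat_exp i (n%:R * (t - a)) * flat_exp j (n%:R * (b - t)).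
exists (n%:R *: (B k.+2 l + (- k%:R) *: B k.+1 l + ((-1) *: B k l.+2 + l%:R *: B k l.+1))).
  by do ![apply: bump_add | apply: bump_scale | exact: bump_base].
move=> t.
have L1 : is_derive t 1 (fun s : R => n%:R * (s - a)) n%:R.
  have := is_deriveZ n%:R (is_deriveB (is_derive_id t (1:R)) (is_derive_cst a t (1:R))).
  by move/is_derive_eq; apply; rewrite subr0 [_ *: _]mulr1.
have L2 : is_derive t 1 (fun s : R => n%:R * (b - s)) (- n%:R).
  have := is_deriveZ n%:R (is_deriveB (is_derive_cst b t (1:R)) (is_derive_id t (1:R))).
  by move/is_derive_eq; apply; rewrite sub0r [_ *: _]mulrN1.
have D1 := @is_derive1_comp _ (flat_exp k) (fun s : R => n%:R * (s - a)) t _ _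
  (is_derive_flat_exp k _) L1.
have D2 := @is_derive1_comp _ (flat_exp l) (fun s : R => n%:R * (b - s)) t _ _
  (is_derive_flat_exp l _) L2.
have := is_deriveM D1 D2.
move/is_derive_eq; apply.
rewrite /B !fctE /GRing.scale/=.
move: (flat_exp k.+2 _) (flat_exp k.+1 _) (flat_exp k _) (flat_exp l.+2 _) (flat_exp l.+1 _) (flat_exp l _).
by move=> *; ring.
Qed.

End FlatExponential.

(** * Bumps on boxes as products of one-variable bumps *)

Section TensorBump.
Context {R : realType}.
Implicit Types (f g h : R -> R) (P Q S : (R -> R) -> Prop).

Definition tensor f g h (x : space3 R) : R := f x.1.1 * g x.1.2 * h x.2.

(** Members of such a class can be differentiated again and again, so the class serves as smoothness
    in one variable. *)
Definition derive_closed P := forall f, P f ->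
  exists2 f', P f' & forall t : R, is_derive t (1 : R) f (f' t).

Lemma is_derive_differentiable f f' x : (forall t : R, is_derive t (1 : R) f (f' t)) ->
  differentiable f x.
Proof. by move=> df; apply/derivable1_diffP; have [] := df x. Qed.

Lemma differentiable_tensor f g h x : (forall t, differentiable f t) ->
  (forall t, differentiable g t) -> (forall t, differentiable h t) ->
  differentiable (tensor f g h) x.
Proof.
move=> df dg dh.
have d1 (y : R * R) : differentiable (fst : R * R -> R) y.
  by apply: linear_differentiable => z; exact: cvg_fst.
have d2 (y : R * R) : differentiable (snd : R * R -> R) y.
  by apply: linear_differentiable => z; exact: cvg_snd.
have D1 (y : space3 R) : differentiable (fst : space3 R -> R * R) y.
  by apply: linear_differentiable => z; exact: cvg_fst.
have D2 (y : space3 R) : differentiable (snd : space3 R -> R) y.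
  by apply: linear_differentiable => z; exact: cvg_snd.
have -> : tensor f g h = ((f \o (fst \o fst)) * (g \o (snd \o fst))) * (h \o snd) by [].
apply: differentiableM; last exact: differentiable_comp (D2 x) (dh _).
apply: differentiableM.
  exact: differentiable_comp (differentiable_comp (D1 x) (d1 _)) (df _).
exact: differentiable_comp (differentiable_comp (D1 x) (d2 _)) (dg _).
Qed.

Lemma derive_tensor0 f g h f' x : (forall t : R, is_derive t (1 : R) f (f' t)) ->
  'D_(unit_vec 0) (tensor f g h) x = tensor f' g h x.
Proof.
case: x => [[x y] z] df; rewrite (line_pointE 0 x y z) line_derive/=.
have -> : (fun s : R => tensor f g h (s *: unit_vec 0 + (0, y, z))) = (g y * h z) *: f.
  apply/funext => s; rewrite -(line_pointE 0 s y z) /tensor/= !fctE /GRing.scale/=.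
  by rewrite -mulrA mulrC.
rewrite deriveZ; last by have [] := df x.
have := df x; move=> /@derive_val ->; rewrite -(line_pointE 0 x y z) /tensor/=.
by rewrite /GRing.scale/= mulrC mulrA.
Qed.

Lemma derive_tensor1 f g h g' x : (forall t : R, is_derive t (1 : R) g (g' t)) ->
  'D_(unit_vec 1) (tensor f g h) x = tensor f g' h x.
Proof.
case: x => [[x y] z] df; rewrite (line_pointE 1 x y z) line_derive/=.
have -> : (fun s : R => tensor f g h (s *: unit_vec 1 + (x, 0, z))) = (f x * h z) *: g.
  apply/funext => s; rewrite -(line_pointE 1 x s z) /tensor/= !fctE /GRing.scale/=.
  by rewrite mulrAC.
rewrite deriveZ; last by have [] := df y.
have := df y; move=> /@derive_val ->; rewrite -(line_pointE 1 x y z) /tensor/=.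
by rewrite /GRing.scale/= mulrAC.
Qed.

Lemma derive_tensor2 f g h h' x : (forall t : R, is_derive t (1 : R) h (h' t)) ->
  'D_(unit_vec 2%:R) (tensor f g h) x = tensor f g h' x.
Proof.
case: x => [[x y] z] df; rewrite (line_pointE 2%:R x y z) line_derive/=.
have -> : (fun s : R => tensor f g h (s *: unit_vec 2%:R + (x, y, 0))) = (f x * g y) *: h.
  by apply/funext => s; rewrite -(line_pointE 2%:R x y s).
rewrite deriveZ; last by have [] := df z.
by have := df z; move=> /@derive_val ->; rewrite -(line_pointE 2%:R x y z).
Qed.

Lemma I3_cases (i : 'I_3) : [\/ i = 0, i = 1 | i = 2%:R].
Proof.
by case: i => -[|[|[|//]]] ilt; [constructor 1|constructor 2|constructor 3]; exact: val_inj.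
Qed.

(** A partial derivative acts on one factor, so every iterated one is again a [tensor] with factors
    in the three classes. *)
Lemma smooth_tensor P Q S f g h : derive_closed P -> derive_closed Q -> derive_closed S ->
  P f -> Q g -> S h -> smooth (tensor f g h).
Proof.
move=> cP cQ cS Pf Qg Sh s.
suff [f1 [g1 [h1 [-> Pf1 Qg1 Sh1]]]] : exists f1 g1 h1,
    [/\ foldr (fun i (u : space3 R -> R) => 'D_(unit_vec i) u) (tensor f g h) s =
        tensor f1 g1 h1, P f1, Q g1 & S h1].
  move=> x; have [f2 _ df] := cP _ Pf1; have [g2 _ dg] := cQ _ Qg1.
  have [h2 _ dh] := cS _ Sh1.
  by apply: differentiable_tensor => t; apply: is_derive_differentiable.
elim: s => [|i s [f1 [g1 [h1 [/= -> Pf1 Qg1 Sh1]]]]]; first by exists f, g, h.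
have [f2 Pf2 df] := cP _ Pf1; have [g2 Qg2 dg] := cQ _ Qg1.
have [h2 Sh2 dh] := cS _ Sh1.
have [->|->|->] := I3_cases i.
- by exists f2, g1, h1; split=> //; apply/funext => x; exact: derive_tensor0.
- by exists f1, g2, h1; split=> //; apply/funext => x; exact: derive_tensor1.
- by exists f1, g1, h2; split=> //; apply/funext => x; exact: derive_tensor2.
Qed.

(** As [n] grows the flanks steepen, and the bumps tend pointwise to the indicator of ]a, b[. The
    successor keeps the scaling positive. *)
Definition bump n (a b t : R) : R :=
  flat_exp 0 (n.+1%:R * (t - a)) * flat_exp 0 (n.+1%:R * (b - t)).

Lemma bump_out n a b t : t \notin `]a, b[ -> bump n a b t = 0.
Proof.
rewrite in_itv/= negb_and -!leNgt => /orP[ta|bt]; rewrite /bump.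
  by rewrite {1}/flat_exp ifN ?mul0r// -leNgt pmulr_rle0// subr_le0.
by rewrite {2}/flat_exp ifN ?mulr0// -leNgt pmulr_rle0// subr_le0.
Qed.

Lemma bump_ge0 n a b t : 0 <= bump n a b t.
Proof. by rewrite mulr_ge0// flat_exp0_ge0. Qed.

Lemma bump_le1 n a b t : bump n a b t <= 1.
Proof. by rewrite mulr_ile1// ?flat_exp0_ge0// flat_exp0_le1. Qed.

Lemma cvg_bump a b t : t \in `]a, b[ -> bump n a b t @[n --> \oo] --> (1 : R).
Proof.
rewrite in_itv/= => /andP[ta bt]; rewrite -[1 in X in _ --> X]mulr1.
by apply: cvgM; apply: cvg_flat_exp0; rewrite subr_gt0.
Qed.

Definition bump3 n (a b : space3 R) : space3 R -> R :=
  tensor (bump n a.1.1 b.1.1) (bump n a.1.2 b.1.2) (bump n a.2 b.2).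

Lemma smooth_bump3 n a b : smooth (bump3 n a b).
Proof.
apply: (@smooth_tensor (bump_span n.+1 a.1.1 b.1.1) (bump_span n.+1 a.1.2 b.1.2)
  (bump_span n.+1 a.2 b.2)); try exact: bump_span_derive; exact: bump_base.
Qed.

Lemma bump3_out n a b x : ~ box a b x -> bump3 n a b x = 0.
Proof.
move=> nb; rewrite /bump3 /tensor.
have [h1|h1] := boolP (x.1.1 \in `]a.1.1, b.1.1[); last by rewrite bump_out// !mul0r.
have [h2|h2] := boolP (x.1.2 \in `]a.1.2, b.1.2[); last by rewrite [X in _ * X * _]bump_out// mulr0 mul0r.
have [h3|h3] := boolP (x.2 \in `]a.2, b.2[); last by rewrite [X in _ * X]bump_out// mulr0.
by exfalso; apply: nb.
Qed.

Lemma bump3_norm_le1 n a b x : `|bump3 n a b x| <= 1.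
Proof.
have h c d t : `|bump n c d t| <= 1 by rewrite ger0_norm ?bump_ge0 ?bump_le1.
rewrite /bump3 /tensor normrM [`|bump _ _ _ _ * _|]normrM.
by apply: mulr_ile1 => //; exact: mulr_ile1.
Qed.

Lemma cvg_bump3 a b x : box a b x -> bump3 n a b x @[n --> \oo] --> (1 : R).
Proof.
move=> [h1 h2 h3]; have -> : (1 : R) = 1 * 1 * 1 by rewrite !mulr1.
by apply: cvgM; [apply: cvgM|]; exact: cvg_bump.
Qed.

Definition bump_field n a b (i : 'I_3) : field3 R :=
  fun x => bump3 n a b x *: delta_mx i 0.

Lemma test_bump_field (Om : set (space3 R)) n a b i : cbox a b `<=` Om ->
  test_field Om (bump_field n a b i).
Proof.
move=> abOm.
have supp : closure [set x | bump_field n a b i x != 0] `<=` cbox a b.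
  rewrite [X in _ `<=` X](iffLR (closure_id _) (@closed_cbox R a b)).
  apply: closure_subset => x /eqP px; apply: sub_box_cbox.
  by apply: contra_notP px => nb; rewrite /bump_field bump3_out// scale0r.
split.
- move=> j; rewrite /bump_field.
  have [ij|ij] := eqVneq j i.
    have -> : (fun x => (bump3 n a b x *: delta_mx i 0 : 'cV[R]_3) j 0) = bump3 n a b.
      by apply/funext => x; rewrite !mxE ij !eqxx mulr1.
    exact: smooth_bump3.
  have -> : (fun x => (bump3 n a b x *: delta_mx i 0 : 'cV[R]_3) j 0) = cst 0.
    by apply/funext => x; rewrite !mxE (negbTE ij) mulr0.
  move=> s x.
  suff -> : foldr (fun i (h : space3 R -> R) => 'D_(unit_vec i) h) (cst 0) s = cst 0.
    exact: differentiable_cst.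
  elim: s => //= k s ->; apply/funext => y; exact: derive_cst.
- apply: subclosed_compact supp; [exact: closed_closure|exact: compact_cbox].
- exact: subset_trans supp abOm.
Qed.

End TensorBump.

(** * The fundamental lemma of the calculus of variations *)

Section BoxesGenerate.
Context {R : realType}.

Definition boxes : set (set (space3 R)) := [set box ab.1 ab.2 | ab in setT].

Lemma boxI (a b c d : space3 R) : box a b `&` box c d =
  box (Num.max a.1.1 c.1.1, Num.max a.1.2 c.1.2, Num.max a.2 c.2)
      (Num.min b.1.1 d.1.1, Num.min b.1.2 d.1.2, Num.min b.2 d.2).
Proof.
apply/seteqP; split=> x.
  move=> [[/= +++] [/=]]; rewrite !in_itv/= => /andP[? ?] /andP[? ?] /andP[? ?].
  move=> /andP[? ?] /andP[? ?] /andP[? ?].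
  by split; rewrite /= in_itv/= gt_max lt_min; apply/andP; split; apply/andP.
move=> [/=]; rewrite !in_itv/= !gt_max !lt_min.
move=> /andP[/andP[? ?] /andP[? ?]] /andP[/andP[? ?] /andP[? ?]] /andP[/andP[? ?] /andP[? ?]].
by split; split; rewrite in_itv/=; apply/andP.
Qed.

Lemma boxes_setI : setI_closed boxes.
Proof.
move=> _ _ [[a b] _ <-] [[c d] _ <-] /=; rewrite boxI.
by eexists (_, _).
Qed.

(** The slab over an interval is a countable union of boxes whose other sides grow, so the
    coordinate projections are measurable for the generated sigma-algebra. Hence so is the identity,
    rebuilt from them, and a measurable set is its own preimage. *)
Lemma measurable_boxes : @measurable _ (mspace3 R) = <<s boxes >>.
Proof.
apply/seteqP; split; last first.
  apply: smallest_sub; first by split=> [|A mA|A mA]; [exact: measurable0|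
    rewrite setTD; exact: measurableC|exact: bigcupT_measurable].
  by move=> _ [[a b] _ <-]; exact: measurable_box.
pose T := g_sigma_algebraType boxes.
have mcoord (p : T -> measurableTypeR R) (lo hi : R -> nat -> space3 R) :
    (forall x y, p @^-1` `]x, y[ = \bigcup_n box (lo x n) (hi y n)) ->
    measurable_fun setT p.
  move=> pE; apply: (measurability _ (RGenOpens.measurableE R)).
  move=> _ [_ [a [b ->] <-]]; rewrite setTI pE.
  apply: bigcupT_measurable => n; apply: sub_sigma_algebra.
  by exists (lo a n, hi b n).
have itv_n (z : R) n : (Num.truncn `|z| < n)%N -> z \in `](- n%:R), n%:R[.
  by move=> zn; rewrite in_itv/= -ltr_norml (lt_le_trans (Num.Theory.truncnS_gt _))// ler_nat.
have m1 : measurable_fun setT (fun x : T => x.1.1 : measurableTypeR R).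
  apply: (mcoord _ (fun x n => (x, - n%:R, - n%:R)) (fun y n => (y, n%:R, n%:R))) => x y.
  apply/seteqP; split=> [u /= uxy|u [n _ [? ? ?]]//].
  by exists (maxn (Num.truncn `|u.1.2|).+1 (Num.truncn `|u.2|).+1) => //; split => //;
    apply: itv_n; rewrite ?leq_maxl ?leq_maxr.
have m2 : measurable_fun setT (fun x : T => x.1.2 : measurableTypeR R).
  apply: (mcoord _ (fun x n => (- n%:R, x, - n%:R)) (fun y n => (n%:R, y, n%:R))) => x y.
  apply/seteqP; split=> [u /= uxy|u [n _ [? ? ?]]//].
  by exists (maxn (Num.truncn `|u.1.1|).+1 (Num.truncn `|u.2|).+1) => //; split => //;
    apply: itv_n; rewrite ?leq_maxl ?leq_maxr.
have m3 : measurable_fun setT (fun x : T => x.2 : measurableTypeR R).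
  apply: (mcoord _ (fun x n => (- n%:R, - n%:R, x)) (fun y n => (n%:R, n%:R, y))) => x y.
  apply/seteqP; split=> [u /= uxy|u [n _ [? ? ?]]//].
  by exists (maxn (Num.truncn `|u.1.1|).+1 (Num.truncn `|u.1.2|).+1) => //; split => //;
    apply: itv_n; rewrite ?leq_maxl ?leq_maxr.
have mid : measurable_fun setT (fun x : T => ((x.1.1, x.1.2), x.2) : mspace3 R).
  exact: measurable_fun_pair (measurable_fun_pair m1 m2) m3.
move=> A mA; have := mid measurableT A mA; rewrite setTI.
by have -> : (fun x : T => ((x.1.1, x.1.2), x.2) : mspace3 R) @^-1` A = A
  by apply/seteqP; split=> -[[]].
Qed.

End BoxesGenerate.

Section FundamentalLemma.
Context {R : realType} (Om : set (space3 R)) (oOm : open Om).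
Variable w : mspace3 R -> R.
Hypothesis Lw : sL2 (Om : set (mspace3 R)) w.
Hypothesis w0 : forall n a b, cbox a b `<=` Om ->
  (\int[vol]_(x in Om) (w x * bump3 n a b x)%:E = 0)%E.

Let mOm : measurable (Om : set (mspace3 R)) := open_measurable3 oOm.

(** The box has finite volume, and |w| <= 1 + w^2. *)
Lemma sL2_box_integrable a b : cbox a b `<=` Om ->
  vol.-integrable (box a b) (EFin \o w).
Proof.
move=> abOm; have mb := measurable_box a b; have mc := measurable_cbox a b.
have bOm : box a b `<=` Om := subset_trans (@sub_box_cbox _ a b) abOm.
have [mw w2] := Lw.
have i1 : vol.-integrable (box a b) (EFin \o cst (1 : R)).
  apply: (integrableS mc mb (@sub_box_cbox _ a b)).
  apply: measurable_bounded_integrable => //; first exact: vol_cbox.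
  by exists 1; split => // M M1 x _ /=; rewrite normr1 ltW.
apply: (le_integrable mb _ _ (integrableD mb i1 (integrableS mOm mb bOm w2))).
  by apply/measurable_EFinP; exact: measurable_funS mw.
move=> x bx /=; rewrite lee_fin [leRHS]ger0_norm ?addr_ge0 ?sqr_ge0//.
by rewrite -[w x ^+ 2]real_normK ?num_real//; have := sqr_ge0 (`|w x| - 1); nra.
Qed.

(** Dominated convergence: the bumps tend to 1 on the box, and |w| dominates because they are
    bounded by 1. *)
Lemma integral_box0 a b : cbox a b `<=` Om -> (\int[vol]_(x in box a b) (w x)%:E = 0)%E.
Proof.
move=> abOm; have mb := measurable_box a b.
have bOm : box a b `<=` Om := subset_trans (@sub_box_cbox _ a b) abOm.
have iw := sL2_box_integrable abOm.
have [mw _] := Lw.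
have mf n : measurable_fun (box a b : set (mspace3 R)) (fun x => (w x * bump3 n a b x)%:E).
  apply/measurable_EFinP; apply: measurable_funM; first exact: measurable_funS mw.
  exact: measurable_funS (continuous_measurable_fun3 (smooth_continuous (smooth_bump3 n a b))).
have fcvg x : box a b x -> (w x * bump3 n a b x)%:E @[n --> \oo] --> (w x)%:E.
  move=> bx; apply: cvg_EFin; first exact: nearW.
  rewrite /comp/= -[X in _ --> X]mulr1.
  by apply: cvgM; [exact: cvg_cst|exact: cvg_bump3].
have fle x n : box a b x -> (`|(w x * bump3 n a b x)%:E| <= `|(w x)%:E|)%E.
  by move=> bx; rewrite /= lee_fin normrM ler_piMr ?bump3_norm_le1.
have [_ _ c] := dominated_convergence mb mf (measurable_int _ iw) (aeW vol fcvg)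
  (integrable_abse iw) (aeW vol fle).
have E n : (\int[vol]_(x in box a b) (w x * bump3 n a b x)%:E = 0)%E.
  rewrite -(w0 n abOm) [LHS]integral_mkcond [RHS]integral_mkcond.
  apply: eq_integral => x _; rewrite !patchE.
  case: ifPn => [|/negP]; rewrite inE => bx.
    by rewrite mem_set//; exact: bOm.
  by case: ifPn => // _; rewrite bump3_out// mulr0.
rewrite -(cvg_lim _ c)//; apply: cvg_lim => //.
by under eq_fun do rewrite E; exact: cvg_cst.
Qed.

(** Boxes form a generating family stable under intersection, and a box cut with [box a b] is again
    a box whose closed version lies in [Om]. By Dynkin's theorem the integral of [w] over every
    measurable part of [box a b] is 0. *)
Lemma ae0_box a b : cbox a b `<=` Om -> {ae vol, forall x, box a b x -> w x = 0}.
Proof.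
move=> abOm; have mb := measurable_box a b.
have iw := sL2_box_integrable abOm.
have dyn A : measurable (A : set (mspace3 R)) ->
    (\int[vol]_(x in A `&` box a b) (w x)%:E = 0)%E.
  rewrite measurable_boxes; move: A.
  apply: (@dynkin_induction _ (mspace3 R) boxes
    (fun A => (\int[vol]_(x in A `&` box a b) (w x)%:E = 0)%E)).
  - exact: measurable_boxes.
  - exact: boxes_setI.
  - by rewrite setTI; exact: integral_box0.
  - move=> _ [[c d] _ <-] /=; rewrite setIC boxI; apply: integral_box0.
    apply: subset_trans abOm => x [/=]; rewrite !in_itv/= !ge_max !le_min.
    move=> /andP[/andP[? ?] /andP[? ?]] /andP[/andP[? ?] /andP[? ?]] /andP[/andP[? ?] /andP[? ?]].
    by split; rewrite in_itv/=; apply/andP.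
  - move=> A mA A0.
    have := integral_box0 abOm.
    have bE : box a b = (A `&` box a b) `|` (~` A `&` box a b).
      by rewrite -setIUl setUv setTI.
    rewrite {1}bE integral_setU_EFin.
    + by rewrite A0 add0e.
    + exact: measurableI.
    + by apply: measurableI => //; exact: measurableC.
    + by rewrite -bE; apply/measurable_EFinP; exact: (measurable_int _ iw).
    + by apply/disj_setPS => x [[? _] []].
  - move=> F mF tF F0; rewrite setI_bigcupl integral_bigcup//.
    + by rewrite eseries0.
    + apply/trivIsetP => i j _ _ ij; rewrite setIACA setIid.
      by move/trivIsetP : tF => /(_ i j Logic.I Logic.I ij) ->; rewrite set0I.
    + by move=> k; exact: measurableI.
    + apply: (integrableS mb) => //.
        by apply: bigcup_measurable => k _; exact: measurableI.
      by apply: bigcup_sub => k _ x [].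
have := @integral_ae_eq _ (mspace3 R) R vol (box a b) mb (cst 0%E) (EFin \o w) iw.
case=> //.
  move=> A Ab mA; rewrite integral0 -[RHS](dyn A mA); congr (integral _ _ _).
  by apply/seteqP; split=> [x Ax|x []//]; split => //; exact: Ab.
by move=> N [? ? NS]; exists N; split => // x /= nx; apply: NS => /= wx; apply: nx => bx; have [] := wx bx.
Qed.

(** Countably many rational boxes cover [Om], so their null sets add up to a null set. [P n] speaks
    of the box with code [n] and is [True] when [n] is no code. *)
Lemma ae0_of_orthogonal_bumps : {ae vol, forall x, Om x -> w x = 0}.
Proof.
pose P (n : nat) (x : mspace3 R) := if unpickle n is
    Some (p, q) then (fun p q : rat * rat * rat =>
      cbox (ratr3 p : space3 R) (ratr3 q) `<=` Om -> box (ratr3 p) (ratr3 q) x -> w x = 0) p q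
  else True.
have : {ae vol, forall x, forall n, P n x}.
  apply: ae_foralln => n; rewrite /P; case: unpickle => [[p q]|]; last exact: aeW.
  have [pq|pq] := pselect (cbox (ratr3 p : space3 R) (ratr3 q) `<=` Om).
    by apply: vol_aeS (ae0_box pq) => x h _; exact: h.
  by apply: aeW => x /pq.
apply: vol_aeS => x Px Ox; have [p [q [bx cO]]] := open_rat_box oOm Ox.
by have := Px (pickle (p, q)); rewrite /P pickleK => /(_ cO bx).
Qed.

End FundamentalLemma.

(** * Weights and the weak curl *)

Section Weights.
Context {R : realType} (Om : set (space3 R)).
Hypothesis mOm : measurable (Om : set (mspace3 R)).
Implicit Types (u v : field3 R) (A : mfield3 R).

Lemma mfappD A u v : mfapp A (u + v) = mfapp A u + mfapp A v.
Proof. by apply/funext => x; rewrite /mfapp !fctE mulmxDr. Qed.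

Lemma mfappZ A k u : mfapp A (k *: u) = k *: mfapp A u.
Proof. by apply/funext => x; rewrite /mfapp !fctE scalemxAr. Qed.

Lemma mfappN A u : mfapp A (- u) = - mfapp A u.
Proof. by apply/funext => x; rewrite /mfapp !fctE mulmxN. Qed.

Lemma mfappB A u v : mfapp A (u - v) = mfapp A u - mfapp A v.
Proof. by rewrite mfappD mfappN. Qed.

Lemma mfappE A u x i : mfapp A u x i 0 = \sum_j A x i j * u x j 0.
Proof. by rewrite mxE. Qed.

Variables (A : mfield3 R) (hA : spd_bounded Om A).

Lemma L2_mfapp u : L2 Om u -> L2 Om (mfapp A u).
Proof.
move=> Lu; have [_ _ mA [C AC]] := hA.
move=> i; suff : sL2 (Om : set (mspace3 R)) (fun x => mfapp A u x i 0) by [].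
have -> : (fun x => mfapp A u x i 0) = fun x =>
    A x i 0 * u x 0 0 + A x i 1 * u x 1 0 + A x i 2%:R * u x 2%:R 0.
  by apply/funext => x; rewrite mfappE big_I3.
have h j : sL2 (Om : set (mspace3 R)) (fun x => A x i j * u x j 0).
  by apply: (@sL2M_bounded _ _ mOm _ _ C) => // x; exact: AC.
exact: sL2D (sL2D mOm (h 0) (h 1)) (h 2%:R).
Qed.

Lemma dot_trmx (B : 'M[R]_3) (v w : 'cV[R]_3) : dot (B *m v) w = dot v (B^T *m w).
Proof.
have E (a b : 'cV[R]_3) : dot a b = (a^T *m b) 0 0.
  by rewrite mxE; apply: eq_bigr => i _; rewrite mxE.
by rewrite !E trmx_mul mulmxA.
Qed.

Lemma inner_mfapp_sym u v : inner Om (mfapp A u) v = inner Om u (mfapp A v).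
Proof.
have [sA _ _ _] := hA; apply: eq_Rintegral => x /set_mem Ox.
by rewrite /mfapp dot_trmx sA.
Qed.

Lemma dot_mfapp_ge0 x (v : 'cV[R]_3) : Om x -> 0 <= dot (A x *m v) v.
Proof.
move=> Ox; have [_ pA _ _] := hA.
have [->|v0] := eqVneq v 0; first by rewrite mulmx0 dot_ge0.
exact/ltW/pA.
Qed.

Lemma inner_mfapp_ge0 u : 0 <= inner Om (mfapp A u) u.
Proof. by apply: Rintegral_ge0 => x Ox; exact: dot_mfapp_ge0. Qed.

Lemma wnorm_sqr u : wnorm A Om u ^+ 2 = inner Om (mfapp A u) u.
Proof. by rewrite sqr_sqrtr// inner_mfapp_ge0. Qed.

Lemma inner_mfapp_eq0 u : L2 Om u -> inner Om (mfapp A u) u = 0 ->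
  u = 0 %[ae vol in Om].
Proof.
move=> Lu /(Rintegral_ge0_eq0 mOm (dot_integrable mOm (L2_mfapp Lu) Lu)).
move=> /(_ (fun x Ox => dot_mfapp_ge0 _ Ox)); have [_ pA _ _] := hA.
apply: vol_aeS => x h Ox; apply/eqP/negPn/negP => ux.
by have := pA x (u x) Ox ux; have /= := h Ox; rewrite /mfapp => ->; rewrite ltxx.
Qed.

Lemma wnorm_eq0 u : L2 Om u -> wnorm A Om u ^+ 2 = 0 -> u = 0 %[ae vol in Om].
Proof. by move=> Lu; rewrite wnorm_sqr; exact: inner_mfapp_eq0. Qed.

Lemma ae0_wnorm u : L2 Om u -> u = 0 %[ae vol in Om] -> wnorm A Om u ^+ 2 = 0.
Proof. by move=> Lu u0; rewrite wnorm_sqr innerC (inner_ae0l mOm)//; exact: L2_mfapp. Qed.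

Lemma nrm2_mfapp : exists2 C, 0 <= C & forall u, L2 Om u ->
  nrm2 Om (mfapp A u) <= C * nrm2 Om u.
Proof.
(* Each component of A u has square at most 3 C^2 |u|^2, and there are three components. The
   absolute value covers an empty [Om], where [C] may be negative. *)
have [_ _ _ [C AC]] := hA; exists (3%:R * `|C|); first by rewrite mulr_ge0.
move=> u Lu; rewrite -ler_sqr ?nnegrE ?mulr_ge0 ?nrm2_ge0//.
rewrite exprMn !nrm2_sqr /inner -RintegralZl//; last exact: dot_integrable.
apply: le_Rintegral => //.
- by apply: dot_integrable => //; exact: L2_mfapp.
- have := integrableZl mOm ((3%:R * `|C|) ^+ 2) (dot_integrable mOm Lu Lu).
  exact: eq_integrable.
move=> x Ox; rewrite exprMn.
have AC' i j : `|A x i j| <= `|C| by apply: le_trans (ler_norm C); exact: AC.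
have CS (i : 'I_3) : mfapp A u x i 0 * mfapp A u x i 0 <=
    3%:R * `|C| ^+ 2 * dot (u x) (u x).
  rewrite mfappE big_I3 /dot big_I3.
  have sq j : (A x i j * u x j 0) ^+ 2 <= `|C| ^+ 2 * (u x j 0 * u x j 0).
    rewrite exprMn expr2 -(expr2 (u x j 0)) -expr2 ler_wpM2r ?sqr_ge0//.
    by rewrite -[leLHS]real_normK ?num_real// lerXn2r ?nnegrE.
  move: (sq 0) (sq 1) (sq 2%:R).
  move: (A x i 0 * _) (A x i 1 * _) (A x i 2%:R * _) => p q r hp hq hr.
  apply: (@le_trans _ _ (3%:R * (p ^+ 2 + q ^+ 2 + r ^+ 2))).
    have := sqr_ge0 (p - q); have := sqr_ge0 (q - r); have := sqr_ge0 (p - r); nra.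
  by rewrite -mulrA ler_wpM2l// !mulrDr lerD// lerD.
rewrite [leLHS]big_I3; have := CS 0; have := CS 1; have := CS 2%:R.
by move: (mfapp A u x 0 0) (mfapp A u x 1 0) (mfapp A u x 2%:R 0) => p q r; lra.
Qed.

Lemma spd_unitmx x : Om x -> A x \in unitmx.
Proof.
move=> Ox; have [sA pA _ _] := hA.
rewrite unitmxE unitfE; apply/negP => /det0P[v v0 vA].
have vT0 : v^T != 0 by rewrite trmx_eq0.
have := pA x v^T Ox vT0.
by rewrite -(sA x Ox) -trmx_mul vA trmx0 dot0l ltxx.
Qed.

Lemma mfappK u x : Om x -> mfapp (mfinv A) (mfapp A u) x = u x.
Proof. by move=> Ox; rewrite /mfapp /mfinv mulKmx// spd_unitmx. Qed.

Lemma mfappVK u x : Om x -> mfapp A (mfapp (mfinv A) u) x = u x.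
Proof. by move=> Ox; rewrite /mfapp /mfinv mulKVmx// spd_unitmx. Qed.

End Weights.

(** * The weak curl: uniqueness, linearity, Green's formula *)

Section Curl.
Context {R : realType} (Om : set (space3 R)) (oOm : open Om).
Implicit Types (u v : field3 R) (Phi Psi : field3 R).

Let mOm : measurable (Om : set (mspace3 R)) := open_measurable3 oOm.

(** Bumps pointing in one coordinate direction isolate one component, to which the scalar lemma
    applies. *)
Lemma L2_orthogonal_tests Psi : L2 Om Psi ->
  (forall phi, test_field Om phi -> inner Om Psi phi = 0) -> Psi = 0 %[ae vol in Om].
Proof.
move=> LP P0.
have P0i i : {ae vol, forall x, Om x -> Psi x i 0 = 0}.
  apply: (ae0_of_orthogonal_bumps oOm (LP i)) => n a b abOm.
  have tb := test_bump_field n i abOm.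
  have Lb := L2_test mOm tb.
  have E x : dot (Psi x) (bump_field n a b i x) = Psi x i 0 * bump3 n a b x.
    rewrite /dot (bigD1 i)//= big1 ?addr0 /bump_field ?mxE ?eqxx ?mulr1//.
    by move=> j ji; rewrite !mxE (negbTE ji) !mulr0.
  have fin := integrable_fin_num mOm (dot_integrable mOm LP Lb).
  transitivity (\int[vol]_(x in Om) (dot (Psi x) (bump_field n a b i x))%:E)%E.
    by apply: eq_integral => x _; rewrite E.
  by rewrite -[LHS](fineK fin); congr EFin; exact: P0 tb.
have := vol_aeS2 _ (P0i 0) (vol_aeS2 _ (P0i 1) (P0i 2%:R)).
apply; last by move=> x h1 h2; exact: (conj h1 h2).
move=> x h0 [h1 h2] Ox; apply/colP => i; rewrite mxE.
by have [->|->|->] := I3_cases i; [exact: h0|exact: h1|exact: h2].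
Qed.

Lemma is_curl_unique Phi Psi Psi' : is_curl Om Phi Psi -> is_curl Om Phi Psi' ->
  Psi = Psi' %[ae vol in Om].
Proof.
move=> [LP cP] [LP' cP']; apply/ae_sub0; apply: L2_orthogonal_tests; first exact: L2B.
move=> phi tphi; have Lp := L2_test mOm tphi.
by rewrite innerBl// -cP// -cP'// subrr.
Qed.

Definition in_Hcurl Phi := carrier (Hcurl Om) Phi.

Lemma Hcurl_L2 Phi : in_Hcurl Phi -> L2 Om Phi. Proof. by case. Qed.

Lemma curlP Phi : in_Hcurl Phi -> is_curl Om Phi (curl Om Phi).
Proof. by move=> [_ cP]; exact: xgetPex cP. Qed.

Lemma L2_curl Phi : in_Hcurl Phi -> L2 Om (curl Om Phi).
Proof. by move=> /curlP[]. Qed.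

Lemma curl_eq Phi Psi : in_Hcurl Phi -> is_curl Om Phi Psi -> curl Om Phi = Psi %[ae vol in Om].
Proof. by move=> /curlP; exact: is_curl_unique. Qed.

Lemma is_curlD Phi Psi Phi' Psi' : L2 Om Phi -> L2 Om Phi' ->
  is_curl Om Phi Psi -> is_curl Om Phi' Psi' -> is_curl Om (Phi + Phi') (Psi + Psi').
Proof.
move=> L L' [LP cP] [LP' cP']; split; first exact: L2D.
move=> phi tphi; have Lp := L2_test mOm tphi; have Lc := L2_classical_curl mOm tphi.
by rewrite !innerDl// cP// cP'.
Qed.

Lemma is_curlZ k Phi Psi : L2 Om Phi -> is_curl Om Phi Psi -> is_curl Om (k *: Phi) (k *: Psi).
Proof.
move=> L [LP cP]; split; first exact: L2Z.
move=> phi tphi; have Lp := L2_test mOm tphi; have Lc := L2_classical_curl mOm tphi.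
by rewrite !innerZl// cP.
Qed.

Lemma HcurlD u v : in_Hcurl u -> in_Hcurl v -> in_Hcurl (u + v).
Proof.
move=> hu hv; split; first exact: L2D (Hcurl_L2 hu) (Hcurl_L2 hv).
exists (curl Om u + curl Om v).
exact: is_curlD (Hcurl_L2 hu) (Hcurl_L2 hv) (curlP hu) (curlP hv).
Qed.

Lemma HcurlZ k u : in_Hcurl u -> in_Hcurl (k *: u).
Proof.
move=> hu; split; first exact: L2Z (Hcurl_L2 hu).
by exists (k *: curl Om u); exact: is_curlZ (Hcurl_L2 hu) (curlP hu).
Qed.

Lemma HcurlN u : in_Hcurl u -> in_Hcurl (- u).
Proof. by rewrite -scaleN1r; exact: HcurlZ. Qed.

Lemma HcurlB u v : in_Hcurl u -> in_Hcurl v -> in_Hcurl (u - v).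
Proof. by move=> hu /HcurlN; exact: HcurlD. Qed.

Lemma curlD u v : in_Hcurl u -> in_Hcurl v ->
  curl Om (u + v) = curl Om u + curl Om v %[ae vol in Om].
Proof.
move=> hu hv; apply: curl_eq; first exact: HcurlD.
exact: is_curlD (Hcurl_L2 hu) (Hcurl_L2 hv) (curlP hu) (curlP hv).
Qed.

Lemma curlZ k u : in_Hcurl u -> curl Om (k *: u) = k *: curl Om u %[ae vol in Om].
Proof.
move=> hu; apply: curl_eq; first exact: HcurlZ.
exact: is_curlZ (Hcurl_L2 hu) (curlP hu).
Qed.

Lemma curlN u : in_Hcurl u -> curl Om (- u) = - curl Om u %[ae vol in Om].
Proof. by rewrite -(scaleN1r u) -(scaleN1r (curl Om u)); exact: curlZ. Qed.

Lemma curlB u v : in_Hcurl u -> in_Hcurl v ->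
  curl Om (u - v) = curl Om u - curl Om v %[ae vol in Om].
Proof.
move=> hu hv; apply: ae_trans (curlD hu (HcurlN hv)) _.
by apply: aeD; [exact: aeW|exact: curlN].
Qed.

Lemma is_curl_ae u v Psi : L2 Om u -> L2 Om v -> u = v %[ae vol in Om] ->
  is_curl Om u Psi -> is_curl Om v Psi.
Proof.
move=> Lu Lv uv [LP cP]; split=> // phi tphi.
by rewrite -cP// -(inner_ael mOm Lu Lv _ uv)//; exact: L2_classical_curl.
Qed.

(** Both fields have the same set of weak curls, so [xget] chooses the same element: the equality is
    not merely almost everywhere. *)
Lemma curl_ae u v : L2 Om u -> L2 Om v -> u = v %[ae vol in Om] -> curl Om u = curl Om v.
Proof.
move=> Lu Lv uv; rewrite /curl; congr xget; apply/seteqP.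
by split => Psi; apply: is_curl_ae => //; exact: ae_sym.
Qed.

Lemma ae0_curl u : L2 Om u -> u = 0 %[ae vol in Om] -> curl Om u = 0 %[ae vol in Om].
Proof.
move=> Lu u0; have L0 := L20 mOm.
have c0 : is_curl Om 0 0.
  split=> // phi tphi.
  by rewrite !(inner_ae0l mOm)//; try exact: aeW;
    [exact: L2_test|exact: L2_classical_curl].
rewrite (curl_ae Lu L0 u0); apply: curl_eq => //.
by split => //; exists 0.
Qed.

Lemma nrm2_le_Hcurl u : nrm2 Om u <= snorm (Hcurl Om) u.
Proof. by rewrite /= ler_wsqrtr// lerDl inner_ge0. Qed.

Lemma nrm2_curl_le_Hcurl u : nrm2 Om (curl Om u) <= snorm (Hcurl Om) u.
Proof. by rewrite /= ler_wsqrtr// lerDr inner_ge0. Qed.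

(* By density: the identity is the definition of the weak curl when [v] is a test field. *)
Lemma Green u v : in_Hcurl u -> carrier (Hcurl0 Om) v ->
  inner Om u (curl Om v) = inner Om (curl Om u) v.
Proof.
move=> hu [hv v0]; apply/eqP; rewrite -subr_eq0 -normr_le0.
apply/ler_addgt0Pl => e e0; rewrite addr0.
have [Lu Lcu] := (Hcurl_L2 hu, L2_curl hu).
have [Lv Lcv] := (Hcurl_L2 hv, L2_curl hv).
pose N := nrm2 Om u + nrm2 Om (curl Om u) + 1.
have N0 : 0 < N by rewrite ltr_wpDl// addr_ge0// nrm2_ge0.
have [phi tphi vphi] := v0 (e / N) (divr_gt0 e0 N0).
have [Lp Lcp] := (L2_test mOm tphi, L2_classical_curl mOm tphi).
have cp := is_curl_test mOm tphi.
have hp : in_Hcurl phi by split => //; exists (classical_curl phi).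
have hvp := HcurlB hv hp.
(* The identity holds for the test field [phi], so the defect at [v] is the defect at v - phi, which
   Cauchy-Schwarz makes small. *)
have E : inner Om u (curl Om (v - phi)) - inner Om (curl Om u) (v - phi) =
    inner Om u (curl Om v) - inner Om (curl Om u) v.
  rewrite (inner_aer mOm (L2_curl hvp) (L2B mOm Lcv Lcp) Lu); last first.
    apply: ae_trans (curlB hv hp) _; apply: aeB; first exact: aeW.
    exact: curl_eq.
  rewrite !innerBr//; have [_ ->//] := curlP hu; ring.
rewrite -E; apply: (le_trans (ler_normB _ _)).
apply: (le_trans (lerD (Cauchy_Schwarz mOm Lu (L2_curl hvp))
                       (Cauchy_Schwarz mOm Lcu (Hcurl_L2 hvp)))).
have h1 := nrm2_le_Hcurl (v - phi); have h2 := nrm2_curl_le_Hcurl (v - phi).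
set s := snorm (Hcurl Om) (v - phi) in vphi h1 h2.
apply: (@le_trans _ _ (N * s)); last by rewrite mulrC -ler_pdivlMr// ltW.
have n1 := nrm2_ge0 Om u; have n2 := nrm2_ge0 Om (curl Om u).
have s0 : 0 <= s := le_trans (nrm2_ge0 _ _) h1.
rewrite /N mulrDl mulrDl mul1r.
apply: (@le_trans _ _ (nrm2 Om u * s + nrm2 Om (curl Om u) * s)); last by rewrite lerDl.
by apply: lerD; exact: ler_wpM2l.
Qed.

End Curl.

(** * Calculus on an interval *)

Section RealCalculus.
Context {R : realType}.
Implicit Types (f N M : R -> R) (A B : set R) (a b t : R).

Lemma tends0_le A t N M : (forall s, A s -> 0 <= N s <= M s) ->
  M s @[s --> within A (nbhs t)] --> (0 : R) ->
  N s @[s --> within A (nbhs t)] --> (0 : R).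
Proof.
move=> NM M0; apply: (squeeze_cvgr _ (cvg_cst 0) M0).
by rewrite near_withinE; apply: nearW => s; exact: NM.
Qed.

Lemma tends0_norm A t f : `|f s| @[s --> within A (nbhs t)] --> (0 : R) ->
  f s @[s --> within A (nbhs t)] --> (0 : R).
Proof. by move=> /norm_cvg0P. Qed.

Lemma tends0S A B t N : A `<=` B ->
  N s @[s --> within B (nbhs t)] --> (0 : R) ->
  N s @[s --> within A (nbhs t)] --> (0 : R).
Proof. by move=> AB; apply: cvg_trans; apply: cvg_app; exact: within_subset. Qed.

Lemma tends0D A t N M : N s @[s --> within A (nbhs t)] --> (0 : R) ->
  M s @[s --> within A (nbhs t)] --> (0 : R) ->
  N s + M s @[s --> within A (nbhs t)] --> (0 : R).
Proof. by move=> h1 h2; rewrite -[0]addr0; exact: cvgD. Qed.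

Lemma tends0Zl A t N c : N s @[s --> within A (nbhs t)] --> (0 : R) ->
  c * N s @[s --> within A (nbhs t)] --> (0 : R).
Proof. by move=> h; rewrite -(mulr0 c); apply: cvgM => //; exact: cvg_cst. Qed.

Lemma tends0M A t N M : N s @[s --> within A (nbhs t)] --> (0 : R) ->
  M s @[s --> within A (nbhs t)] --> (0 : R) ->
  N s * M s @[s --> within A (nbhs t)] --> (0 : R).
Proof. by move=> h1 h2; rewrite -[0](mulr0 0); exact: cvgM. Qed.

Lemma tends0_near A t N e : N s @[s --> within A (nbhs t)] --> (0 : R) -> 0 < e ->
  \forall s \near t, A s -> `|N s| < e.
Proof. by move=> /cvgr0Pnorm_lt h e0; have := h e e0; rewrite near_withinE. Qed.

(** Shows that the punctured one-sided filters in [has_deriv] are proper, end points included, so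
    that limits along them are unique. *)
Lemma itv_limit_point a b t (U : set R) : a < b -> t \in `[a, b] -> nbhs t U ->
  exists s, [/\ s \in `[a, b], s <> t & U s].
Proof.
move=> ab; rewrite in_itv/= => /andP[at_ tb] /nbhs_ballP[e /= e0 eU].
have [tb'|tb'] := ltP t b.
  exists (Num.min b (t + e / 2)); split.
  - by rewrite in_itv/= le_min ge_min lexx/= andbT (ltW ab)/=; lra.
  - by rewrite /Num.min; case: ifP; lra.
  - apply: eU; rewrite /ball/= ltr_norml /Num.min; case: ifP; lra.
exists (Num.max a (t - e / 2)); split.
- by rewrite in_itv/= le_max ge_max lexx/= (ltW ab)/=; lra.
- by rewrite /Num.max; case: ifP; lra.
- apply: eU; rewrite /ball/= ltr_norml /Num.max; case: ifP; lra.
Qed.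

Lemma tends0_const a b t N c : a < b -> t \in `[a, b] ->
  N s @[s --> within (`[a, b] `\ t) (nbhs t)] --> (0 : R) ->
  (forall s, s \in `[a, b] -> s <> t -> c <= N s) -> c <= 0.
Proof.
move=> ab tab N0 cN; apply/ler_addgt0Pl => e e0; rewrite addr0.
have he := tends0_near N0 e0.
have [s [sab st /(_ (conj sab st)) Ne]] := itv_limit_point ab tab he.
apply: (le_trans (cN s sab st)).
exact: le_trans (ler_norm _) (ltW Ne).
Qed.

Lemma is_derive_within a b t f D : t \in `]a, b[ ->
  (s - t)^-1 * (f s - f t) - D @[s --> within (`[a, b] `\ t) (nbhs t)] --> (0 : R) ->
  is_derive t 1 f D.
Proof.
move=> tab h0.
have c : h^-1 *: (f (h *: 1 + t) - f t) @[h --> (0:R)^'] --> D.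
  apply/cvgrPdist_lt => e e0.
  have he := tends0_near h0 e0.
  have nab : nbhs t [set` `[a, b]].
    apply: filterS (near_in_itvoo tab) => x; exact: subset_itv_oo_cc.
  have : \forall s \near t, s \in `[a, b] /\ ((`[a, b] `\ t) s ->
      `|(s - t)^-1 * (f s - f t) - D| < e) by exact: filterI nab he.
  move=> /nbhs_ballP[d /= d0 dU].
  near=> h.
  have hd : `|h| < d by near: h; exact: dnbhs0_lt.
  have hn : h != 0 by near: h; exact: nbhs_dnbhs_neq.
  have [sab] : h + t \in `[a, b] /\
      ((`[a, b] `\ t) (h + t) -> `|(h + t - t)^-1 * (f (h + t) - f t) - D| < e).
    by apply: dU; rewrite /ball/= opprD addrCA subrr addr0 normrN.
  have ht : h + t <> t by move=> /eqP; rewrite -subr_eq0 addrK (negbTE hn).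
  move=> /(_ (conj sab ht)); rewrite addrK [h *: 1]mulr1 distrC.
  by [].
apply: DeriveDef; first by apply/cvg_ex; exists D.
exact: cvg_lim.
Unshelve. all: by end_near. Qed.

Lemma const_of_derive0 a b f : a <= b ->
  (forall t, t \in `[a, b] -> f s - f t @[s --> within `[a, b] (nbhs t)] --> (0 : R)) ->
  (forall t, t \in `]a, b[ -> is_derive t 1 f 0) -> f b = f a.
Proof.
move=> ab cf df.
have cf' : {within `[a, b], continuous f}.
  apply/subspace_continuousP => t tab.
  have E : (fun s => f t + (f s - f t)) = f by apply/funext => s; rewrite addrC subrK.
  suff : f t + (f s - f t) @[s --> within `[a, b] (nbhs t)] --> f t + 0.
    by rewrite addr0 E.
  exact: cvgD (cvg_cst _) (cf t tab).
have [c _ /eqP] := MVT_segment ab df cf'.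
by rewrite mul0r subr_eq0 => /eqP.
Qed.

(** Induction on the number of exceptional points. One that lies inside splits the interval and
    becomes an end point of both halves, where continuity is enough for the mean value theorem. *)
Lemma const_of_derive0_finite (S : seq R) a b f :
  (forall t, t \in `[a, b] -> f s - f t @[s --> within `[a, b] (nbhs t)] --> (0 : R)) ->
  (forall t, t \in `]a, b[ -> t \notin S -> is_derive t 1 f 0) ->
  forall t, t \in `[a, b] -> f t = f a.
Proof.
move=> cf df t; rewrite in_itv/= => /andP[at_ tb].
have cft u : u \in `[a, t] -> f s - f u @[s --> within `[a, t] (nbhs u)] --> (0 : R).
  rewrite in_itv/= => /andP[au ut]; have tbb := le_trans ut tb.
  apply: (@tends0S _ `[a, b]); last by apply: cf; rewrite in_itv/= au.
  by move=> s /=; rewrite !in_itv/= => /andP[-> st]; exact: le_trans tb.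
have {df} dft u : u \in `]a, t[ -> u \notin S -> is_derive u 1 f 0.
  by rewrite in_itv/= => /andP[au ut]; apply: df; rewrite in_itv/= au (lt_le_trans ut).
move: {cf} cft dft at_; move: a t {tb}.
have [n] := ubnP (size S); elim: n S => // n IH S Sn a t cf df at_.
have [[c cS cat]|noS] := pselect (exists2 c, c \in S & c \in `]a, t[); last first.
  apply: const_of_derive0 => // u uat; apply: df => //.
  by apply/negP => uS; apply: noS; exists u.
move: (cat); rewrite in_itv/= => /andP[ac ct].
have sz : (size [seq x <- S | x != c] < n)%N.
  rewrite -ltnS; apply: leq_trans Sn; rewrite ltnS size_filter ltn_neqAle count_size andbT -all_count.
  by apply/allPn; exists c => //=; rewrite negbK.
have c1 u : u \in `[c, t] -> f s - f u @[s --> within `[c, t] (nbhs u)] --> (0 : R).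
  rewrite in_itv/= => /andP[cu ut].
  apply: (@tends0S _ `[a, t]); last by apply: cf; rewrite in_itv/= ut andbT (le_trans (ltW ac)).
  by move=> s /=; rewrite !in_itv/= => /andP[sc ->]; rewrite andbT (le_trans (ltW ac)).
have d1 u : u \in `]c, t[ -> u \notin [seq x <- S | x != c] -> is_derive u 1 f 0.
  rewrite in_itv/= => /andP[cu ut] uS; apply: df; first by rewrite in_itv/= ut andbT (lt_trans ac).
  by move: uS; rewrite mem_filter/= gt_eqF.
have c2 u : u \in `[a, c] -> f s - f u @[s --> within `[a, c] (nbhs u)] --> (0 : R).
  rewrite in_itv/= => /andP[au uc].
  apply: (@tends0S _ `[a, t]); last by apply: cf; rewrite in_itv/= au (le_trans uc)// ltW.
  by move=> s /=; rewrite !in_itv/= => /andP[-> st]; rewrite (le_trans st)// ltW.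
have d2 u : u \in `]a, c[ -> u \notin [seq x <- S | x != c] -> is_derive u 1 f 0.
  rewrite in_itv/= => /andP[au uc] uS; apply: df; first by rewrite in_itv/= au (lt_trans uc).
  by move: uS; rewrite mem_filter/= lt_eqF.
by rewrite (IH _ sz c t c1 d1 (ltW ct)) (IH _ sz a c c2 d2 (ltW ac)).
Qed.

Lemma ae_itv_exists a b (P : R -> Prop) : a < b ->
  {ae (@lebesgue_measure R), forall t, P t} ->
  exists2 t, t \in `]a, b[ & P t.
Proof.
move=> ab [N [mN N0 NP]]; apply: contrapT => nE.
have nP t : t \in `]a, b[ -> ~ P t by move=> tab Pt; apply: nE; exists t.
have : (lebesgue_measure `]a, b[%classic <= lebesgue_measure N)%E.
  apply: le_measure; rewrite ?inE//= => t tab; apply: NP => /= Pt.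
  exact: nP tab Pt.
by rewrite N0 lebesgue_measure_itv/= lte_fin ab -EFinD lee_fin subr_le0 leNgt ab.
Qed.

(** A set of full measure is dense, so every neighbourhood of [t] contains a zero of [D]. *)
Lemma ae0_continuous a b t D : t \in `]a, b[ ->
  D s - D t @[s --> within `[a, b] (nbhs t)] --> (0 : R) ->
  {ae (@lebesgue_measure R), forall s, s \in `]a, b[ -> D s = 0} -> D t = 0.
Proof.
move=> tab D0 aeD; apply/eqP; rewrite -normr_le0; apply/ler_addgt0Pl => e e0; rewrite addr0.
have he := tends0_near D0 e0.
have : \forall s \near t, (s \in `]a, b[) /\ (`[a, b]%classic s -> `|D s - D t| < e).
  exact: filterI (near_in_itvoo tab) he.
move=> /nbhs_ballP[d /= d0 dU].
have [|s] := ae_itv_exists _ aeD (a := t - d) (b := t + d); first lra.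
rewrite in_itv/= => /andP[s1 s2] Ds.
have [/= sab] : (s \in `]a, b[) /\ (`[a, b]%classic s -> `|D s - D t| < e).
  by apply: dU; rewrite /ball/= ltr_norml; lra.
move=> /(_ (subset_itv_oo_cc sab)); rewrite Ds// sub0r normrN; exact: ltW.
Qed.

Lemma itv_partition_cell a b (s : seq R) t : itv_partition a b s -> t \in `]a, b[ ->
  t \notin s -> exists2 i, (i < size s)%N &
    [/\ t \in `]nth b (a :: s) i, nth b s i[, a <= nth b (a :: s) i & nth b s i <= b].
Proof.
elim: s a => [|c s IH] a; first by move=> /itv_partition_nil ->; rewrite in_itv/= lt_asym.
move=> [/=/andP[ac cs] /eqP lb]; rewrite in_itv/= inE negb_or => /andP[at_ tb] /andP[tc ts].
have ps : itv_partition c b s by split => //; exact/eqP.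
have cb : c <= b := itv_partition_le ps.
have [tc'|tc'] := ltP t c.
  by exists 0%N => //=; split => //; rewrite in_itv/= at_.
have [|i is_ [h1 h2 h3]] := IH _ ps _ ts; first by rewrite in_itv/= tb andbT lt_neqAle eq_sym tc.
by exists i.+1 => //; split => //; exact: le_trans (ltW ac) h2.
Qed.

End RealCalculus.

(** * Time-dependent fields *)

Lemma tends0_local (R : realType) (A B : set R) (t : R) (N : R -> R) :
  (\forall s \near t, A s -> B s) ->
  N s @[s --> within B (nbhs t)] --> (0 : R) ->
  N s @[s --> within A (nbhs t)] --> (0 : R).
Proof.
move=> AB N0; apply/cvgr0Pnorm_lt => e e0; rewrite near_withinE.
have h := tends0_near N0 e0.
near=> s => As.
have Bs : B s by move: As; near: s.
by move: Bs; near: s.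
Unshelve. all: by end_near. Qed.

Section TimeSpaces.
Context {R : realType} {V : lmodType R}.
Implicit Types (X : nspace V) (u : R -> V).

(** Near an interior point of [c, d] the other interval adds no new times. This turns a derivative
    on one piece into a derivative on [0, T], the one to which [dt] refers. *)
Lemma has_deriv_local X a b c d u t v : t \in `]c, d[ ->
  has_deriv X c d u t v -> has_deriv X a b u t v.
Proof.
move=> tcd [cv h]; split => //; apply: tends0_local h.
near=> s => -[_ st]; split => //; apply: subset_itv_oo_cc.
by near: s; exact: near_in_itvoo.
Unshelve. all: by end_near. Qed.

Lemma has_derivS X a b c d u t v : `[c, d] `<=` `[a, b] ->
  has_deriv X a b u t v -> has_deriv X c d u t v.
Proof.
by move=> cdab [cv h]; split => //; apply: tends0S h => s [/cdab scd st].
Qed.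

Lemma C0_onS X a b c d u : `[c, d] `<=` `[a, b] -> C0_on X a b u -> C0_on X c d u.
Proof.
move=> cdab cu t tcd; have [ut h] := cu t (cdab _ tcd); split => //.
by apply: tends0S h => s; exact: cdab.
Qed.

Lemma C1_onS X a b c d u : `[c, d] `<=` `[a, b] -> Ck_on X 1 a b u -> Ck_on X 1 c d u.
Proof.
move=> cdab [cu [u' [du [cu' _]]]]; split; first exact: C0_onS cu.
exists u'; split; last by split => //; exact: C0_onS cu'.
by move=> t tcd; apply: has_derivS (du t (cdab _ tcd)).
Qed.

Lemma pwC1_local X T u : pwCk_on X 1 0 T u -> exists S : seq R,
  forall t, t \in `]0, T[ -> t \notin S ->
  exists a b, [/\ t \in `]a, b[, `[a, b] `<=` `[0, T] & Ck_on X 1 a b u].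
Proof.
move=> [s ps cs]; exists s => t t0T ts.
have [i si [tab a0 bT]] := itv_partition_cell ps t0T ts.
exists (nth T (0 :: s) i), (nth T s i); split => //; last exact: cs.
by apply: subset_itvScc; rewrite bnd_simp.
Qed.

End TimeSpaces.

(* A common neighbourhood replaces a common refinement of the two partitions. *)
Lemma pwC1_local2 (R : realType) (V W : lmodType R) (X : nspace V) (Y : nspace W) T u w :
  pwCk_on X 1 0 T u -> pwCk_on Y 1 0 T w -> exists S : seq R,
  forall t, t \in `]0, T[ -> t \notin S ->
  exists a b, [/\ t \in `]a, b[, `[a, b] `<=` `[0, T], Ck_on X 1 a b u & Ck_on Y 1 a b w].
Proof.
move=> /pwC1_local[S hS].
move=> [s ps cs].
exists (S ++ s) => t t0T; rewrite mem_cat negb_or => /andP[tS ts].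
have [a [b [tab ab0T cu]]] := hS t t0T tS.
have [i si [tcd c0 dT]] := itv_partition_cell ps t0T ts.
have cw := cs i si.
set c := nth T (0 :: s) i in tcd c0 cw *; set d := nth T s i in tcd dT cw *.
exists (Num.max a c), (Num.min b d).
have sab : `[Num.max a c, Num.min b d] `<=` `[a, b].
  by apply: subset_itvScc; rewrite bnd_simp ?le_max ?ge_min lexx ?orbT.
have scd : `[Num.max a c, Num.min b d] `<=` `[c, d].
  by apply: subset_itvScc; rewrite bnd_simp ?le_max ?ge_min lexx ?orbT.
split.
- move: tab tcd; rewrite !in_itv/= gt_max lt_min => /andP[-> ->] /andP[-> ->].
  by [].
- exact: subset_trans sab ab0T.
- exact: C1_onS cu.
- exact: C1_onS cw.
Qed.

(** * Components of paths in a product space *)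

Section ProductSpaces.
Context {R : realType} {V W : lmodType R} (X : nspace V) (Y : nspace W).
Hypotheses (X0 : forall u, 0 <= snorm X u) (Y0 : forall u, 0 <= snorm Y u).
Implicit Types (u : R -> V) (w : R -> W).

Lemma snorm_prod1 z : snorm X z.1 <= snorm (prodsp X Y) z.
Proof.
rewrite /= -[leLHS]ger0_norm// -sqrtr_sqr ler_wsqrtr// lerDl sqr_ge0//.
Qed.

Lemma snorm_prod2 z : snorm Y z.2 <= snorm (prodsp X Y) z.
Proof.
rewrite /= -[leLHS]ger0_norm// -sqrtr_sqr ler_wsqrtr// lerDr sqr_ge0//.
Qed.

Lemma C0_prod a b (z : R -> V * W) : C0_on (prodsp X Y) a b z ->
  C0_on X a b (fun t => (z t).1) /\ C0_on Y a b (fun t => (z t).2).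
Proof.
move=> cz; split=> t tab; have [[c1 c2] h] := cz t tab; split => //.
  by apply: tends0_le h => s _; rewrite X0; exact: (snorm_prod1 (z s - z t)).
by apply: tends0_le h => s _; rewrite Y0; exact: (snorm_prod2 (z s - z t)).
Qed.

Lemma has_deriv_prod a b (z : R -> V * W) t z' : has_deriv (prodsp X Y) a b z t z' ->
  has_deriv X a b (fun t => (z t).1) t z'.1 /\ has_deriv Y a b (fun t => (z t).2) t z'.2.
Proof.
move=> [[c1 c2] h]; split; split => //.
  apply: tends0_le h => s _; rewrite X0.
  exact: (snorm_prod1 ((s - t)^-1 *: (z s - z t) - z')).
apply: tends0_le h => s _; rewrite Y0.
exact: (snorm_prod2 ((s - t)^-1 *: (z s - z t) - z')).
Qed.

Lemma C1_prod a b (z : R -> V * W) : Ck_on (prodsp X Y) 1 a b z ->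
  Ck_on X 1 a b (fun t => (z t).1) /\ Ck_on Y 1 a b (fun t => (z t).2).
Proof.
move=> [/C0_prod[c1 c2] [z' [dz [/C0_prod[c1' c2'] _]]]].
split; split => //.
  by exists (fun t => (z' t).1); split => // t /dz/has_deriv_prod[].
by exists (fun t => (z' t).2); split => // t /dz/has_deriv_prod[].
Qed.

End ProductSpaces.

(** * Continuity and derivatives of paths in L^2 *)

Section TimeL2.
Context {R : realType} (Om : set (space3 R)) (oOm : open Om).
Implicit Types (u w : R -> field3 R) (v : field3 R) (a b t : R).

Let mOm : measurable (Om : set (mspace3 R)) := open_measurable3 oOm.
Local Notation n2 := (nrm2 Om).
Local Notation L := (L2sp Om).

Lemma C0_L2 a b u t : C0_on L a b u -> t \in `[a, b] -> L2 Om (u t).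
Proof. by move=> cu /cu[]. Qed.

Lemma has_deriv_L2 a b u t v : has_deriv L a b u t v -> L2 Om v.
Proof. by case. Qed.

Lemma L2_quotient (q : R) (x y z : field3 R) : L2 Om x -> L2 Om y -> L2 Om z ->
  L2 Om (q *: (x - y) - z).
Proof. by move=> Lx Ly Lz; apply: L2B => //; apply: L2Z => //; exact: L2B. Qed.

Lemma C0_Hcurl a b u : C0_on (Hcurl Om) a b u -> C0_on L a b u.
Proof.
move=> cu t tab; have [cut h] := cu t tab; split; first by case: cut.
by apply: tends0_le h => s _; rewrite nrm2_ge0 nrm2_le_Hcurl.
Qed.

(** The curl is bounded from the graph norm to the L^2 norm; its failure to be linear on a null set
    does not change the norm. *)
Lemma C0_curl a b u : C0_on (Hcurl Om) a b u -> C0_on L a b (fun t => curl Om (u t)).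
Proof.
move=> cu t tab; have [cut h] := cu t tab; split; first exact: L2_curl cut.
apply: tends0_le h => s sab; have [cus _] := cu s sab.
have Ls := L2_curl cus; have Lt := L2_curl cut.
apply/andP; split; first exact: nrm2_ge0.
have E := nrm2_ae mOm (L2_curl (HcurlB oOm cus cut)) (L2B mOm Ls Lt) (curlB oOm cus cut).
rewrite -[leLHS]/(n2 (curl Om (u s) - curl Om (u t))) -E; exact: nrm2_curl_le_Hcurl.
Qed.

Lemma has_deriv_Hcurl a b u t v : has_deriv (Hcurl Om) a b u t v -> has_deriv L a b u t v.
Proof.
move=> [cv h]; split; first by case: cv.
by apply: tends0_le h => s _; rewrite nrm2_ge0 nrm2_le_Hcurl.
Qed.

Lemma has_deriv_curl a b u t v : (forall s, s \in `[a, b] -> in_Hcurl Om (u s)) ->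
  t \in `[a, b] -> has_deriv (Hcurl Om) a b u t v ->
  has_deriv L a b (fun s => curl Om (u s)) t (curl Om v).
Proof.
move=> cu tab [cv h]; split; first exact: L2_curl cv.
apply: tends0_le h => s [sab _]; have cus := cu s sab; have cut := cu t tab.
have Ls := L2_curl cus; have Lt := L2_curl cut; have Lv := L2_curl cv.
have cB := HcurlB oOm cus cut; have cZ := HcurlZ oOm (s - t)^-1 cB.
have cQ := HcurlB oOm cZ cv.
apply/andP; split; first exact: nrm2_ge0.
have E : curl Om ((s - t)^-1 *: (u s - u t) - v) =
    (s - t)^-1 *: (curl Om (u s) - curl Om (u t)) - curl Om v %[ae vol in Om].
  apply: ae_trans (curlB oOm cZ cv) _; apply: aeB; last exact: aeW.
  apply: ae_trans (curlZ oOm _ cB) _; apply: aeZ; exact: curlB.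
have {}E := nrm2_ae mOm (L2_curl cQ) (L2_quotient _ Ls Lt Lv) E.
rewrite -[leLHS]/(n2 ((s - t)^-1 *: (curl Om (u s) - curl Om (u t)) - curl Om v)) -E.
exact: nrm2_curl_le_Hcurl.
Qed.

Lemma C0_mfapp A a b u : spd_bounded Om A -> C0_on L a b u ->
  C0_on L a b (fun t => mfapp A (u t)).
Proof.
move=> hA cu t tab; have [Lt h] := cu t tab; split; first exact: L2_mfapp.
have [C C0 AC] := nrm2_mfapp mOm hA.
apply: tends0_le (tends0Zl C h) => s sab; apply/andP; split; first exact: nrm2_ge0.
rewrite /= -mfappB.
by apply: AC; apply: L2B => //; exact: C0_L2 cu sab.
Qed.

Lemma has_deriv_mfapp A a b u t v : spd_bounded Om A ->
  (forall s, s \in `[a, b] -> L2 Om (u s)) -> t \in `[a, b] ->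
  has_deriv L a b u t v -> has_deriv L a b (fun s => mfapp A (u s)) t (mfapp A v).
Proof.
move=> hA Lu tab [Lv h]; split; first exact: L2_mfapp.
have [C C0 AC] := nrm2_mfapp mOm hA.
apply: tends0_le (tends0Zl C h) => s [sab _].
apply/andP; split; first exact: nrm2_ge0.
rewrite /= -mfappB -mfappZ -mfappB.
by apply: AC; apply: L2_quotient => //; exact: Lu.
Qed.

Lemma C0_sub a b u w : C0_on L a b u -> C0_on L a b w ->
  C0_on L a b (fun t => u t - w t).
Proof.
move=> cu cw t tab; have [Lu hu] := cu t tab; have [Lw hw] := cw t tab.
split; first exact: L2B.
apply: tends0_le (tends0D hu hw) => s sab; apply/andP; split; first exact: nrm2_ge0.
have Lus := C0_L2 cu sab; have Lws := C0_L2 cw sab.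
have -> : u s - w s - (u t - w t) = (u s - u t) - (w s - w t).
  by rewrite !opprD !opprK addrACA.
rewrite /= -[X in _ <= _ + X](nrm2N mOm (L2B mOm Lws Lw)); apply: nrm2D => //; first exact: L2B.
by apply: L2N => //; exact: L2B.
Qed.

Lemma has_deriv_sub a b u w t (u' w' : field3 R) :
  (forall s, s \in `[a, b] -> L2 Om (u s)) -> (forall s, s \in `[a, b] -> L2 Om (w s)) ->
  t \in `[a, b] -> has_deriv L a b u t u' -> has_deriv L a b w t w' ->
  has_deriv L a b (fun s => u s - w s) t (u' - w').
Proof.
move=> Lu Lw tab [Lu' hu] [Lw' hw]; split; first exact: L2B.
apply: tends0_le (tends0D hu hw) => s [sab _]; apply/andP; split; first exact: nrm2_ge0.
have -> : (s - t)^-1 *: (u s - w s - (u t - w t)) - (u' - w') =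
  ((s - t)^-1 *: (u s - u t) - u') - ((s - t)^-1 *: (w s - w t) - w').
  have -> : u s - w s - (u t - w t) = (u s - u t) - (w s - w t).
    by rewrite !opprD !opprK addrACA.
  by rewrite scalerBr !opprD !opprK addrACA.
have Lq := L2_quotient (s - t)^-1 (Lw s sab) (Lw t tab) Lw'.
rewrite /= -[X in _ <= _ + X](nrm2N mOm Lq); apply: nrm2D => //; last by apply: L2N.
by apply: L2_quotient => //; exact: Lu.
Qed.

Lemma has_deriv_unique a b u t v v' : a < b -> t \in `[a, b] ->
  (forall s, s \in `[a, b] -> L2 Om (u s)) ->
  has_deriv L a b u t v -> has_deriv L a b u t v' -> v = v' %[ae vol in Om].
Proof.
move=> ab tab Lu [Lv h] [Lv' h']; apply/ae_sub0; apply: nrm2_eq0 => //; first exact: L2B.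
apply/eqP; rewrite eq_le nrm2_ge0 andbT.
apply: (tends0_const ab tab (tends0D h' h)) => s sab _.
set q := _^-1 *: _.
have -> : v - v' = (q - v') - (q - v) by rewrite opprD opprK addrACA subrr add0r addrC.
have Lq : L2 Om q by apply: L2Z => //; apply: L2B => //; exact: Lu.
rewrite /= -[X in _ <= _ + X](nrm2N mOm (L2B mOm Lq Lv)); apply: nrm2D => //; first exact: L2B.
by apply: L2N => //; exact: L2B.
Qed.

Lemma has_deriv_ae a b u u' t v v' : t \in `[a, b] ->
  (forall s, s \in `[a, b] -> L2 Om (u s)) -> (forall s, s \in `[a, b] -> L2 Om (u' s)) ->
  (forall s, s \in `[a, b] -> u s = u' s %[ae vol in Om]) ->
  L2 Om v' -> v = v' %[ae vol in Om] ->
  has_deriv L a b u t v -> has_deriv L a b u' t v'.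
Proof.
move=> tab Lu Lu' uu' Lv' vv' [Lv h]; split => //.
apply: tends0_le h => s [sab _]; apply/andP; split; first exact: nrm2_ge0.
have E : (s - t)^-1 *: (u s - u t) - v = (s - t)^-1 *: (u' s - u' t) - v' %[ae vol in Om].
  by apply: aeB => //; apply: aeZ; apply: aeB; exact: uu'.
have {}E := nrm2_ae mOm (L2_quotient _ (Lu s sab) (Lu t tab) Lv)
  (L2_quotient _ (Lu' s sab) (Lu' t tab) Lv') E.
by rewrite -[leRHS]/(n2 ((s - t)^-1 *: (u s - u t) - v)) E.
Qed.

Lemma has_deriv_tends0 a b u t v : (forall s, s \in `[a, b] -> L2 Om (u s)) ->
  t \in `[a, b] -> has_deriv L a b u t v ->
  n2 (u s - u t) @[s --> within (`[a, b] `\ t) (nbhs t)] --> (0 : R).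
Proof.
move=> Lu tab [Lv h].
have st0 : `|s - t| @[s --> within (`[a, b] `\ t) (nbhs t)] --> (0 : R).
  apply/cvgr0Pnorm_lt => e e0; rewrite near_withinE.
  apply/nbhs_ballP; exists e => //= s; rewrite /ball/= distrC => se _.
  by rewrite normr_id.
have := tends0D (tends0M st0 h) (tends0Zl (n2 v) st0).
apply: tends0_le => s [sab st]; rewrite nrm2_ge0/=.
set q := _ *: _.
have Lq : L2 Om q by apply: L2Z => //; apply: L2B => //; exact: Lu.
have st' : s - t != 0 by rewrite subr_eq0; exact/eqP.
have -> : u s - u t = (s - t) *: ((q - v) + v).
  by rewrite subrK /q scalerA mulfV// scale1r.
have LqvL := L2B mOm Lq Lv.
rewrite (nrm2Z mOm _ (L2D mOm LqvL Lv)) [n2 v * _]mulrC -mulrDr ler_wpM2l//.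
exact: nrm2D.
Qed.

Lemma C0_inner a b u w t : C0_on L a b u -> C0_on L a b w -> t \in `[a, b] ->
  inner Om (u s) (w s) - inner Om (u t) (w t) @[s --> within `[a, b] (nbhs t)] --> (0 : R).
Proof.
move=> cu cw tab; have [Lut hu] := cu t tab; have [Lwt hw] := cw t tab.
apply: tends0_norm.
have := tends0D (tends0M hu hw) (tends0D (tends0Zl (n2 (w t)) hu) (tends0Zl (n2 (u t)) hw)).
apply: tends0_le => s sab; rewrite normr_ge0/=.
have Lus := C0_L2 cu sab; have Lws := C0_L2 cw sab.
have Lu := L2B mOm Lus Lut; have Lw := L2B mOm Lws Lwt.
have -> : inner Om (u s) (w s) - inner Om (u t) (w t) =
    inner Om (u s - u t) (w s - w t) +
    (inner Om (u s - u t) (w t) + inner Om (u t) (w s - w t)).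
  by rewrite !innerBr// !innerBl//; ring.
apply: (le_trans (ler_normD _ _)); apply: lerD; first exact: Cauchy_Schwarz.
apply: (le_trans (ler_normD _ _)); apply: lerD; last exact: Cauchy_Schwarz.
by rewrite mulrC; exact: Cauchy_Schwarz.
Qed.

(** Product rule. Splitting w s into w t and the increment writes the error as four scalar products,
    each with a factor that tends to 0; the four bounds fed to [tends0_le] are theirs by
    Cauchy-Schwarz. *)
Lemma has_deriv_inner a b u w t (u' w' : field3 R) :
  (forall s, s \in `[a, b] -> L2 Om (u s)) -> (forall s, s \in `[a, b] -> L2 Om (w s)) ->
  t \in `[a, b] -> has_deriv L a b u t u' -> has_deriv L a b w t w' ->
  (s - t)^-1 * (inner Om (u s) (w s) - inner Om (u t) (w t)) -
    (inner Om u' (w t) + inner Om (u t) w')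
    @[s --> within (`[a, b] `\ t) (nbhs t)] --> (0 : R).
Proof.
move=> Lu Lw tab du dw; have [Lu' hu] := du; have [Lw' hw] := dw.
have cw := has_deriv_tends0 Lw tab dw.
have Lut := Lu t tab; have Lwt := Lw t tab.
apply: tends0_norm.
have := tends0D (tends0D (tends0Zl (n2 (w t)) hu) (tends0M hu cw))
  (tends0D (tends0Zl (n2 u') cw) (tends0Zl (n2 (u t)) hw)).
apply: tends0_le => s [sab _]; rewrite normr_ge0/=.
have Lus := Lu s sab; have Lws := Lw s sab.
set q := (s - t)^-1.
have LDu := L2B mOm Lus Lut; have LDw := L2B mOm Lws Lwt.
have Lqu := L2_quotient q Lus Lut Lu'; have Lqw := L2_quotient q Lws Lwt Lw'.
have LZu := L2Z mOm q LDu; have LZw := L2Z mOm q LDw.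
have -> : q * (inner Om (u s) (w s) - inner Om (u t) (w t)) -
    (inner Om u' (w t) + inner Om (u t) w') =
  inner Om (q *: (u s - u t) - u') (w t) + inner Om (q *: (u s - u t) - u') (w s - w t)
  + (inner Om u' (w s - w t) + inner Om (u t) (q *: (w s - w t) - w')).
  rewrite -(innerDr mOm Lwt LDw Lqu) [w t + _]addrC subrK.
  rewrite (innerBl mOm LZu Lu' Lws) (innerZl mOm _ LDu Lws) (innerBl mOm Lus Lut Lws).
  rewrite (innerBr mOm LZw Lw' Lut) (innerZr mOm _ LDw Lut) !(innerBr mOm Lws Lwt)//.
  ring.
apply: (le_trans (ler_normD _ _)); apply: lerD; apply: (le_trans (ler_normD _ _)); apply: lerD.
- by rewrite mulrC; exact: Cauchy_Schwarz.
- exact: Cauchy_Schwarz.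
- exact: Cauchy_Schwarz.
- exact: Cauchy_Schwarz.
Qed.

Lemma dtP T u t v : has_deriv L 0 T u t v -> has_deriv L 0 T u t (dt Om T u t).
Proof. by move=> du; apply: (@xgetPex _ 0 [set w | has_deriv L 0 T u t w]); exists v. Qed.

Lemma dt_ae T u t v : 0 < T -> t \in `[0, T] ->
  (forall s, s \in `[0, T] -> L2 Om (u s)) ->
  has_deriv L 0 T u t v -> dt Om T u t = v %[ae vol in Om].
Proof. by move=> T0 t0 Lu du; apply: has_deriv_unique T0 t0 Lu (dtP du) du. Qed.

End TimeL2.

(** * The wave equation for the electric field *)

(* The library's lemmas on almost everywhere equal integrands ask for
   measurability, which a function vanishing almost everywhere may lack, Borel
   sets not being complete. *)
Section NullIntegral.
Context d (T : measurableType d) (R : realType) (mu : {measure set T -> \bar R}).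

Import HBNNSimple.

(** The integral is a supremum over simple functions below [f]; these are measurable and vanish
    almost everywhere. *)
Lemma ge0_ae0_integral (f : T -> \bar R) : (forall x, (0 <= f x)%E) ->
  {ae mu, forall x, f x = 0%E} -> (\int[mu]_x f x = 0)%E.
Proof.
move=> f0 fae; apply/eqP; rewrite eq_le integral_ge0 ?andbT//.
rewrite ge0_integralTE//; apply: ge_ereal_sup => /= _ [h hf <-].
rewrite -integralT_nnsfun.
have mh : measurable_fun setT (EFin \o h) by exact/measurable_EFinP.
rewrite (ae_eq_integral (cst 0%E))//; first by rewrite integral0.
apply: filterS fae => x fx _; apply/eqP; rewrite eq_le /= -{1}fx hf lee_fin.
exact: fun_ge0.
Qed.

Lemma ae0_Rintegral (D : set T) (f : T -> R) :
  {ae mu, forall x, D x -> f x = 0} -> \int[mu]_(x in D) f x = 0.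
Proof.
move=> fae; rewrite /Rintegral integral_mkcond integralE.
have g0 : {ae mu, forall x, ((fun x => (f x)%:E) \_ D) x = 0%E}.
  apply: filterS fae => x fx; rewrite patchE; case: ifPn => // /set_mem Dx.
  by rewrite fx.
rewrite !ge0_ae0_integral ?sube0//.
  by apply: filterS g0 => x; rewrite funenegE => ->; rewrite oppe0 maxxx.
by apply: filterS g0 => x; rewrite funeposE => ->; rewrite maxxx.
Qed.

End NullIntegral.

Lemma sub_eq_sub_add (V : zmodType) (a b g c : V) : a - b = g - c -> b + g = a + c.
Proof. by move=> /eqP; rewrite subr_eq => /eqP ->; rewrite addrAC subrK addrC. Qed.

Section Estimator.
Context {R : realType} (Om : set (space3 R)) (oOm : open Om) (T : R) (T0 : 0 < T).
Context (eps mu : mfield3 R).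
Hypotheses (heps : admissible Om eps) (hmu : admissible Om mu).
Implicit Types (u v w : R -> field3 R).

Let mOm : measurable (Om : set (mspace3 R)) := open_measurable3 oOm.

(** Without a weak curl the chosen value is the default 0, which is square-integrable as well. *)
Lemma L2_curl_any (u : field3 R) : L2 Om (curl Om u).
Proof.
rewrite /curl; case: xgetP => [Psi _ []//|_]; exact: L20.
Qed.

Lemma L2_dt u t : L2 Om (dt Om T u t).
Proof. by rewrite /dt; case: xgetP => [v _ []//|_]; exact: L20. Qed.

(** Both paths have the same set of derivatives at [t], so the same one is chosen. *)
Lemma dt_congr u w t : t \in `[0, T] ->
  (forall s, s \in `[0, T] -> L2 Om (u s)) -> (forall s, s \in `[0, T] -> L2 Om (w s)) ->
  (forall s, s \in `[0, T] -> u s = w s %[ae vol in Om]) ->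
  dt Om T u t = dt Om T w t.
Proof.
move=> t0T Lu Lw uw.
have sub (x y : R -> field3 R) (v : field3 R) : (forall s, s \in `[0, T] -> L2 Om (x s)) ->
    (forall s, s \in `[0, T] -> L2 Om (y s)) ->
    (forall s, s \in `[0, T] -> x s = y s %[ae vol in Om]) ->
    has_deriv (L2sp Om) 0 T x t v -> has_deriv (L2sp Om) 0 T y t v.
  move=> Lx Ly xy h; have Lv := has_deriv_L2 h.
  have vv : v = v %[ae vol in Om] by exact: aeW.
  exact: (has_deriv_ae oOm t0T Lx Ly xy Lv vv h).
apply: (congr1 (xget (0 : field3 R))); apply/seteqP; split => v h.
  exact: sub Lu Lw uw h.
exact: (sub _ _ _ Lw Lu (fun s s0T => ae_sym (uw s s0T)) h).
Qed.

Lemma C1_Hcurl0 u : Ck_on (Hcurl0 Om) 1 0 T u -> Ck_on (Hcurl Om) 1 0 T u.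
Proof.
have c0 v : C0_on (Hcurl0 Om) 0 T v -> C0_on (Hcurl Om) 0 T v.
  by move=> cv t /cv[[? _] ?].
move=> [cu [u' [du [cu' _]]]]; split; first exact: c0.
exists u'; split; first by move=> t /du[[? _] ?].
by split; [exact: c0|exact: Logic.I].
Qed.

(* [E1] and [E2] stand for the first two time derivatives of [E]. *)
Definition wave_field (E E1 E2 K : R -> field3 R) : Prop :=
  [/\ C0_on (Hcurl Om) 0 T E,
      forall t : R, t \in `[0, T] -> in_Hcurl Om (mfapp (mfinv mu) (curl Om (E t))),
      forall t : R, t \in `[0, T] -> has_deriv (Hcurl Om) 0 T E t (E1 t) &
      C0_on (Hcurl Om) 0 T E1] /\
  [/\ forall t : R, t \in `[0, T] -> has_deriv (L2sp Om) 0 T E1 t (E2 t),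
      C0_on (L2sp Om) 0 T E2,
      forall t : R, t \in `[0, T] -> L2 Om (K t) &
      forall t : R, t \in `]0, T[ ->
        K t = mfapp eps (E2 t) + curl Om (mfapp (mfinv mu) (curl Om (E t)))
          %[ae vol in Om]].

(** The first equation, eps (E' - F) = curl H, holds throughout an interval around [t] and is
    differentiated there: eps (E'' - F') = curl H'. The curl of the second equation, H' = G - mu^-1
    curl E, then eliminates [H]. *)
Lemma maxwell_wave (F G E H : R -> field3 R) (E0 H0 : field3 R) :
  Ck_on (Dsp Om) 0 0 T (fun t => (F t, G t)) ->
  Ck_on (Hsp Om) 1 0 T (fun t => (F t, G t)) ->
  Ck_on (D2sp Om eps mu) 0 0 T (fun t => (E t, H t)) ->
  Ck_on (Dsp Om) 1 0 T (fun t => (E t, H t)) ->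
  Ck_on (Hsp Om) 2 0 T (fun t => (E t, H t)) ->
  maxwell_solution Om T eps mu F G E0 H0 E H ->
  exists E1 E2, wave_field E E1 E2 (source Om T eps F G).
Proof.
move=> hFG0 hFG1 hEH0 hEH1 [_ [z1 [dz1 [cz1 [z2 [dz2 [cz2 _]]]]]]] [maxE maxH _ _].
have n0 (x : field3 R) : 0 <= snorm (L2sp Om) x by exact: nrm2_ge0.
have nc (x : field3 R) : 0 <= snorm (Hcurl Om) x by exact: sqrtr_ge0.
have nc0 (x : field3 R) : 0 <= snorm (Hcurl0 Om) x by exact: sqrtr_ge0.
have [/C1_Hcurl0 /= [cE [E1 [dE [cE1 _]]]] /= [cH [H1 [dH [cH1 _]]]]] := C1_prod nc0 nc hEH1.
have [/= [cF [F1 [dF _]]] _] := C1_prod n0 n0 hFG1.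
have [_ /= cG] := C0_prod nc0 nc hFG0.1.
pose E2 t := (z2 t).1.
have LE t : t \in `[0, T] -> L2 Om (E t) := C0_L2 (C0_Hcurl cE).
have LE1 t : t \in `[0, T] -> L2 Om (E1 t) := C0_L2 (C0_Hcurl cE1).
have LF t : t \in `[0, T] -> L2 Om (F t) := C0_L2 cF.
have Lz1 t : t \in `[0, T] -> L2 Om (z1 t).1 by move=> /cz1[[]].
(* The C^2 hypothesis in L^2 and the C^1 hypothesis in H(curl) each bring a derivative of [E]; they
   agree almost everywhere, which carries the second derivative over to [E1]. *)
have z1E1 t : t \in `[0, T] -> (z1 t).1 = E1 t %[ae vol in Om].
  move=> t0T; have [d1 _] := has_deriv_prod n0 n0 (dz1 t t0T).
  exact: (has_deriv_unique oOm T0 t0T LE d1 (has_deriv_Hcurl (dE t t0T))).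
have dE1 t : t \in `[0, T] -> has_deriv (L2sp Om) 0 T E1 t (E2 t).
  move=> t0T; have [d1 _] := has_deriv_prod n0 n0 (dz2 t t0T).
  have ee : E2 t = E2 t %[ae vol in Om] by exact: aeW.
  exact: (has_deriv_ae oOm t0T Lz1 LE1 z1E1 (has_deriv_L2 d1) ee d1).
have cE2 : C0_on (L2sp Om) 0 T E2 := (C0_prod n0 n0 cz2).1.
have hmuE t : t \in `[0, T] -> in_Hcurl Om (mfapp (mfinv mu) (curl Om (E t))).
  by move=> t0T; have [[_ [_ ?]] _] := hEH0.1 t t0T.
exists E1, E2; split; split;
  [exact: cE|exact: hmuE|exact: dE|exact: cE1|exact: dE1|exact: cE2| |].
  move=> t _; apply: L2D => //; last exact: L2_curl_any.
  by apply: L2_mfapp => //; [exact: heps.1|exact: L2_dt].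
move=> t t0T.
(* The Maxwell equations are available at interior times, whereas differentiating needs an identity
   on a whole closed interval; this one has [t] inside. *)
have cd0T : `[t / 2, (t + T) / 2] `<=` `]0, T[.
  move=> s; move: t0T; rewrite /= !in_itv/= => /andP[? ?] /andP[? ?].
  by apply/andP; split; lra.
have cd0T' : `[t / 2, (t + T) / 2] `<=` `[0, T] := subset_trans cd0T (@subset_itv_oo_cc _ _ _ _).
have tcd : t \in `[t / 2, (t + T) / 2].
  by move: t0T; rewrite !in_itv/= => /andP[? ?]; apply/andP; split; lra.
have cd : t / 2 < (t + T) / 2.
  by move: t0T; rewrite in_itv/= => /andP[? ?]; lra.
have t0T' := subset_itv_oo_cc t0T.
have epsE1 s : s \in `[t / 2, (t + T) / 2] ->
    mfapp eps (E1 s - F s) = curl Om (H s) %[ae vol in Om].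
  move=> scd; have s0T := cd0T _ scd; have s0T' := cd0T' _ scd.
  have := dt_ae oOm T0 s0T' LE (has_deriv_Hcurl (dE s s0T')).
  apply: vol_aeS2 _ (maxE s s0T) => x h1 h2 Ox.
  rewrite -[RHS](mfappVK heps.1 _ Ox) /mfapp; congr (_ *m _).
  by rewrite !fctE -h1// -h2// !fctE opprB addrC subrK.
have dL : has_deriv (L2sp Om) (t / 2) ((t + T) / 2)
    (fun s => mfapp eps (E1 s - F s)) t (mfapp eps (E2 t - F1 t)).
  apply: (has_deriv_mfapp oOm heps.1 _ tcd).
  - by move=> s /cd0T' s0T; apply: L2B => //; [exact: LE1|exact: LF].
  apply: (has_deriv_sub oOm _ _ tcd).
  - by move=> s /cd0T'; exact: LE1.
  - by move=> s /cd0T'; exact: LF.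
  - exact: has_derivS cd0T' (dE1 t t0T').
  - exact: has_derivS cd0T' (dF t t0T').
have hH s : s \in `[t / 2, (t + T) / 2] -> in_Hcurl Om (H s).
  by move=> /cd0T' /cH[].
have dR : has_deriv (L2sp Om) (t / 2) ((t + T) / 2)
    (fun s => curl Om (H s)) t (curl Om (H1 t)).
  exact: (has_deriv_curl oOm hH tcd (has_derivS cd0T' (dH t t0T'))).
have eq1 : mfapp eps (E2 t - F1 t) = curl Om (H1 t) %[ae vol in Om].
  have LeE s : s \in `[t / 2, (t + T) / 2] -> L2 Om (mfapp eps (E1 s - F s)).
    move=> /cd0T' s0T; apply: L2_mfapp => //; first exact: heps.1.
    by apply: L2B => //; [exact: LE1|exact: LF].
  have LcH s : s \in `[t / 2, (t + T) / 2] -> L2 Om (curl Om (H s)).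
    by move=> /hH; exact: L2_curl.
  have ee : mfapp eps (E2 t - F1 t) = mfapp eps (E2 t - F1 t) %[ae vol in Om] by exact: aeW.
  have dL' := has_deriv_ae oOm tcd LeE LcH epsE1 (has_deriv_L2 dL) ee dL.
  exact: (has_deriv_unique oOm cd tcd LcH dL' dR).
have hH1 : in_Hcurl Om (H1 t) by have [] := dH t t0T'.
have hGt : in_Hcurl Om (G t) by have [] := cG t t0T'.
have LHs s : s \in `[0, T] -> L2 Om (H s) := C0_L2 (C0_Hcurl cH).
have H1E : H1 t = G t - mfapp (mfinv mu) (curl Om (E t)) %[ae vol in Om].
  have := dt_ae oOm T0 t0T' LHs (has_deriv_Hcurl (dH t t0T')).
  apply: vol_aeS2 _ (maxH t t0T) => x h1 h2 Ox.
  by rewrite -h2// !fctE -h1// addrK.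
have hmt := hmuE t t0T'.
have eq2 : curl Om (H1 t) = curl Om (G t) - curl Om (mfapp (mfinv mu) (curl Om (E t)))
    %[ae vol in Om].
  rewrite (curl_ae oOm (Hcurl_L2 hH1) (Hcurl_L2 (HcurlB oOm hGt hmt)) H1E).
  exact: curlB.
have dtF := dt_ae oOm T0 t0T' LF (dF t t0T').
apply: vol_aeS2 _ dtF (ae_trans eq1 eq2) => x h1 h2 Ox.
have h3 := h2 Ox; rewrite mfappB !fctE in h3.
have -> : source Om T eps F G t x = mfapp eps (F1 t) x + curl Om (G t) x.
  by rewrite /source !fctE /mfapp h1.
rewrite !fctE; exact: sub_eq_sub_add.
Qed.

End Estimator.

(** * The error majorant *)

Lemma ae_subr0 (R : realType) (Om : set (space3 R)) (u v : field3 R) :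
  u = v %[ae vol in Om] -> u - v = 0 %[ae vol in Om].
Proof. by move=> /ae_sub0. Qed.

(** [i] stands for the integral term of the majorant; [a], [b], [c], [d] for the summands of f:
    [Ktilde], [Kcheck], the curl defect and the initial error. *)
Lemma ge0_sum_eq0 (R : realFieldType) (i a b c d : R) : 0 <= i -> 0 <= a -> 0 <= b ->
  0 <= c -> 0 <= d -> i + (a + b + c + d) = 0 -> [/\ a = 0, b = 0 & d = 0].
Proof. by move=> *; split; lra. Qed.

(** Read [q] as eps d/dt tEt, [y] as curl Y, [e] as eps E'' and [c] as curl mu^-1 curl E. *)
Lemma residual_eq0_sub (V : zmodType) (q y e c : V) : q + y - (e + c) = 0 ->
  e - q = - (c - y).
Proof.
move=> /eqP; rewrite subr_eq0 => /eqP h.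
by rewrite opprB -(addrK c e) -h addrAC [q + y]addrC addrK.
Qed.

Lemma sum_quotientE (R : comPzRingType) (k a b c d p q : R) :
  (k * (a - b) - p) + (k * (c - d) - q) = k * ((a + c) - (b + d)) - (p + q).
Proof. ring. Qed.

Lemma sum_incrementE (R : comPzRingType) (a a' b b' c c' d d' : R) :
  (a - a') + (b - b') + ((c - c') + (d - d')) = (a + b + (c + d)) - (a' + b' + (c' + d')).
Proof. ring. Qed.

Lemma leb_aeS (R : realType) (P Q : measurableTypeR R -> Prop) :
  (forall x, P x -> Q x) -> {ae (@lebesgue_measure R), forall x, P x} ->
  {ae (@lebesgue_measure R), forall x, Q x}.
Proof. by move=> PQ; apply: filterS. Qed.

Lemma leb_aeS2 (R : realType) (P Q S : measurableTypeR R -> Prop) :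
  (forall x, P x -> Q x -> S x) -> {ae (@lebesgue_measure R), forall x, P x} ->
  {ae (@lebesgue_measure R), forall x, Q x} ->
  {ae (@lebesgue_measure R), forall x, S x}.
Proof. by move=> PQ; apply: filterS2. Qed.

Section Equivalence.
Context {R : realType} (Om : set (space3 R)) (oOm : open Om) (T : R) (T0 : 0 < T).
Context (eps mu : mfield3 R).
Hypotheses (heps : admissible Om eps) (hmu : admissible Om mu).
Context (E E1 E2 K : R -> field3 R) (hE : wave_field Om T eps mu E E1 E2 K).
Context (rho gam : R -> R) (tE tEt Y : R -> field3 R).
Hypotheses (ctE : C0_on (Hcurl Om) 0 T tE) (ctEt : C0_on (Hcurl Om) 0 T tEt)
  (cY : C0_on (Hcurl Om) 0 T Y).

Let mOm : measurable (Om : set (mspace3 R)) := open_measurable3 oOm.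
Let sub0T (t : R) : t \in `]0, T[ -> t \in `[0, T] := @subset_itv_oo_cc _ _ _ _ t.
Let mem0 : 0 \in `[0, T]. Proof. by rewrite in_itv/= lexx ltW. Qed.
Let cE : C0_on (Hcurl Om) 0 T E. Proof. by have [[]] := hE. Qed.
Let cE1 : C0_on (Hcurl Om) 0 T E1. Proof. by have [[]] := hE. Qed.
Let cE2 : C0_on (L2sp Om) 0 T E2. Proof. by have [_ []] := hE. Qed.
Let dE (t : R) : t \in `[0, T] -> has_deriv (Hcurl Om) 0 T E t (E1 t).
Proof. by have [[_ _ h _] _] := hE; exact: h. Qed.
Let dE1 (t : R) : t \in `[0, T] -> has_deriv (L2sp Om) 0 T E1 t (E2 t).
Proof. by have [_ [h _ _ _]] := hE; exact: h. Qed.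
Let hmE (t : R) : t \in `[0, T] -> in_Hcurl Om (mfapp (mfinv mu) (curl Om (E t))).
Proof. by have [[_ h _ _] _] := hE; exact: h. Qed.
Let LK (t : R) : t \in `[0, T] -> L2 Om (K t).
Proof. by have [_ [_ _ h _]] := hE; exact: h. Qed.
Let hwave (t : R) : t \in `]0, T[ ->
  K t = mfapp eps (E2 t) + curl Om (mfapp (mfinv mu) (curl Om (E t))) %[ae vol in Om].
Proof. by have [_ [_ _ _ h]] := hE; exact: h. Qed.

Let HE (t : R) : t \in `[0, T] -> in_Hcurl Om (E t). Proof. by move=> /cE[]. Qed.
Let HE1 (t : R) : t \in `[0, T] -> in_Hcurl Om (E1 t). Proof. by move=> /cE1[]. Qed.
Let HtE (t : R) : t \in `[0, T] -> in_Hcurl Om (tE t). Proof. by move=> /ctE[]. Qed.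
Let HtEt (t : R) : t \in `[0, T] -> in_Hcurl Om (tEt t). Proof. by move=> /ctEt[]. Qed.
Let HY (t : R) : t \in `[0, T] -> in_Hcurl Om (Y t). Proof. by move=> /cY[]. Qed.
Let LE (t : R) : t \in `[0, T] -> L2 Om (E t). Proof. by move=> /HE/Hcurl_L2. Qed.
Let LE1 (t : R) : t \in `[0, T] -> L2 Om (E1 t). Proof. by move=> /HE1/Hcurl_L2. Qed.
Let LE2 (t : R) : t \in `[0, T] -> L2 Om (E2 t). Proof. by move=> /cE2[]. Qed.
Let LtE (t : R) : t \in `[0, T] -> L2 Om (tE t). Proof. by move=> /HtE/Hcurl_L2. Qed.
Let LtEt (t : R) : t \in `[0, T] -> L2 Om (tEt t). Proof. by move=> /HtEt/Hcurl_L2. Qed.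
Let LY (t : R) : t \in `[0, T] -> L2 Om (Y t). Proof. by move=> /HY/Hcurl_L2. Qed.
Let dtE (t : R) : t \in `[0, T] -> dt Om T E t = E1 t %[ae vol in Om].
Proof. by move=> t0T; exact: (dt_ae oOm T0 t0T LE (has_deriv_Hcurl (dE t0T))). Qed.

Let LKtilde (t : R) : t \in `[0, T] -> L2 Om (Ktilde Om mu tE Y t).
Proof.
move=> t0T; apply: (L2B mOm _ (LY t0T)).
exact: (L2_mfapp mOm hmu.2 (L2_curl_any oOm _)).
Qed.

Let LKcheck (t : R) : t \in `[0, T] -> L2 Om (Kcheck Om T eps tEt Y K t).
Proof.
move=> t0T; apply: (L2B mOm _ (LK t0T)).
exact: (L2D mOm (L2_mfapp mOm heps.1 (L2_dt oOm T _ _)) (L2_curl_any oOm _)).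
Qed.

Let Ldefect (t : R) : L2 Om (curl_defect Om T mu tEt Y t).
Proof.
exact: (L2B mOm (L2_mfapp mOm hmu.2 (L2_curl_any oOm _)) (L2_dt oOm T _ _)).
Qed.

(** * Exact approximations make the majorant vanish *)

Section ExactApproximation.
Hypotheses (tE_E : forall t : R, t \in `[0, T] -> tE t = E t %[ae vol in Om])
  (tEt_E : forall t : R, t \in `[0, T] -> tEt t = dt Om T E t %[ae vol in Om])
  (muY : forall t : R, t \in `[0, T] -> mfapp mu (Y t) = curl Om (E t) %[ae vol in Om]).

Let tEt_E1 (t : R) : t \in `[0, T] -> tEt t = E1 t %[ae vol in Om].
Proof. by move=> t0T; apply: ae_trans (tEt_E t0T) (dtE t0T). Qed.

Let curl_tE (t : R) : t \in `[0, T] -> curl Om (tE t) = curl Om (E t).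
Proof. by move=> t0T; exact: (curl_ae oOm (LtE t0T) (LE t0T) (tE_E t0T)). Qed.

Let Y_E (t : R) : t \in `[0, T] -> Y t = mfapp (mfinv mu) (curl Om (E t)) %[ae vol in Om].
Proof.
move=> t0T; apply: vol_aeS (muY t0T) => x h Ox.
by rewrite -(mfappK hmu.1 (Y t) Ox) {1}/mfapp h.
Qed.

Lemma exact_time_derivative (t : R) : t \in `[0, T] ->
  tEt t = dt Om T tE t %[ae vol in Om].
Proof. by move=> t0T; rewrite (dt_congr oOm t0T LtE LE tE_E); exact: tEt_E. Qed.

Let Ktilde0 (t : R) : t \in `[0, T] -> Ktilde Om mu tE Y t = 0 %[ae vol in Om].
Proof.
move=> t0T; rewrite /Ktilde (curl_tE t0T).
by apply: vol_aeS (Y_E t0T) => x h Ox; rewrite !fctE h// subrr.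
Qed.

(** [tEt] agrees with [E1] at all times, so its derivative is [E2], and the residual becomes the
    wave equation. *)
Let Kcheck0 (t : R) : t \in `]0, T[ -> Kcheck Om T eps tEt Y K t = 0 %[ae vol in Om].
Proof.
move=> t0T'; have t0T := sub0T t0T'.
have E2E2 : E2 t = E2 t %[ae vol in Om] by exact: aeW.
have E1_tEt (s : R) : s \in `[0, T] -> E1 s = tEt s %[ae vol in Om].
  by move=> s0T; exact: (ae_sym (tEt_E1 s0T)).
have d := has_deriv_ae oOm t0T LE1 LtEt E1_tEt (LE2 t0T) E2E2 (dE1 t0T).
have dtt := dt_ae oOm T0 t0T LtEt d.
rewrite /Kcheck (curl_ae oOm (LY t0T) (Hcurl_L2 (hmE t0T)) (Y_E t0T)).
apply: vol_aeS2 _ dtt (hwave t0T') => x h1 h2 Ox.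
by rewrite !fctE (h2 Ox) !fctE /mfapp (h1 Ox) subrr.
Qed.

(** Both mu^-1 and the curl commute with the time derivative, so that of [Y] is mu^-1 curl E'. *)
Let defect0 (t : R) : t \in `[0, T] -> curl_defect Om T mu tEt Y t = 0 %[ae vol in Om].
Proof.
move=> t0T.
have dcE := has_deriv_curl oOm HE t0T (dE t0T).
have LcE (s : R) : s \in `[0, T] -> L2 Om (curl Om (E s)) by move=> /HE/L2_curl.
have dmE := has_deriv_mfapp oOm hmu.2 LcE t0T dcE.
have LmE (s : R) : s \in `[0, T] -> L2 Om (mfapp (mfinv mu) (curl Om (E s))).
  by move=> /hmE/Hcurl_L2.
have E_Y (s : R) : s \in `[0, T] -> mfapp (mfinv mu) (curl Om (E s)) = Y s %[ae vol in Om].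
  by move=> s0T; exact: (ae_sym (Y_E s0T)).
have ee : mfapp (mfinv mu) (curl Om (E1 t)) = mfapp (mfinv mu) (curl Om (E1 t))
  %[ae vol in Om] by exact: aeW.
have dY := has_deriv_ae oOm t0T LmE LY E_Y (has_deriv_L2 dmE) ee dmE.
rewrite /curl_defect (curl_ae oOm (LtEt t0T) (LE1 t0T) (tEt_E1 t0T)).
apply: vol_aeS (dt_ae oOm T0 t0T LY dY) => x h Ox.
by rewrite !fctE (h Ox) subrr.
Qed.

Lemma exact_majorant_eq0 (t : R) : t \in `[0, T] ->
  bfun Om T eps mu E tE tEt Y K rho gam t = 0.
Proof.
have z0 : zval Om T eps mu E tE tEt Y = 0.
  have h1 : dt Om T E 0 - tEt 0 = 0 %[ae vol in Om].
    exact: (ae_subr0 (ae_sym (tEt_E mem0))).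
  have h2 : E 0 - tE 0 = 0 %[ae vol in Om].
    exact: (ae_subr0 (ae_sym (tE_E mem0))).
  have h3 := ae0_curl oOm (L2B mOm (LE mem0) (LtE mem0)) h2.
  rewrite /zval (ae0_wnorm mOm heps.1 (L2B mOm (L2_dt oOm T E 0) (LtEt mem0)) h1).
  rewrite (ae0_wnorm mOm hmu.2 (L2_curl_any oOm _) h3).
  rewrite innerC (inner_ae0l mOm (L2_curl_any oOm _) (LKtilde mem0) h3).
  by rewrite mulr0 !addr0.
have f0 (s : R) : s \in `[0, T] -> ffun_t Om T eps mu E tE tEt Y K rho gam s = 0.
  move=> s0T; have oT (r : R) : r \in `]0, s[ -> r \in `]0, T[.
    move: s0T; rewrite !in_itv/= => /andP[_ sT] /andP[-> rs].
    exact: lt_le_trans sT.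
  rewrite /ffun_t z0 addr0 /gfun.
  rewrite (ae0_wnorm mOm hmu.1 (LKtilde s0T) (Ktilde0 s0T)) mulr0 add0r.
  rewrite /inner_t !ae0_Rintegral ?mulr0 ?addr0//; apply: aeW => r /oT r0T.
  - have r0T' := sub0T r0T.
    rewrite /defect_integrand (ae0_wnorm mOm hmu.1 (Ldefect r) (defect0 r0T')).
    by rewrite mulr0.
  - rewrite /Kcheck_integrand.
    rewrite (ae0_wnorm mOm heps.2 (LKcheck (sub0T r0T)) (Kcheck0 r0T)).
    by rewrite mulr0.
  - have r0T' := sub0T r0T.
    exact: (inner_ae0l mOm (LKtilde r0T') (L2_curl_any oOm _) (Ktilde0 r0T')).
move=> t0T; rewrite /bfun f0// addr0 ae0_Rintegral ?mulr0//.
apply: aeW => s; rewrite /= in_itv/= => /andP[s0 st].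
rewrite /b_integrand f0 ?mulr0// in_itv/= (ltW s0)/=.
by move: t0T; rewrite in_itv/= => /andP[_]; exact: le_trans (ltW st).
Qed.

End ExactApproximation.

(** * A vanishing majorant forces exact approximations *)

Section VanishingMajorant.
Hypotheses (hrho : forall t : R, t \in `[0, T] -> 0 < rho t < 1)
  (hgam : forall t : R, t \in `[0, T] -> 0 < gam t)
  (tE0 : tE 0 = E 0 %[ae vol in Om])
  (tEt_dt : {ae (@lebesgue_measure R), forall t, t \in `]0, T[ ->
     tEt t = dt Om T tE t %[ae vol in Om]})
  (iK : (@lebesgue_measure R).-integrable `]0, T[
     (EFin \o Kcheck_integrand Om T eps tEt Y K gam))
  (b0 : forall t : R, t \in `[0, T] -> bfun Om T eps mu E tE tEt Y K rho gam t = 0).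

(** The terms without a sign are the mixed products in g and z. They contain curl (tEt - d/dt tE)
    and curl e(0), which vanish by hypothesis, so f >= 0. As gamma > 0, the integral term of the
    majorant is then nonnegative too, and a zero sum makes each summand zero. *)
Lemma majorant_eq0_terms (t : R) : t \in `[0, T] ->
  [/\ wnorm mu Om (Ktilde Om mu tE Y t) ^+ 2 = 0,
      \int[leb]_(s in `]0, t[) Kcheck_integrand Om T eps tEt Y K gam s = 0 &
      wnorm eps Om (dt Om T E 0 - tEt 0) ^+ 2 = 0].
Proof.
have oT (s r : R) : s \in `[0, T] -> r \in `]0, s[ -> r \in `[0, T].
  rewrite !in_itv/= => /andP[_ sT] /andP[r0 rs].
  by rewrite (ltW r0)/= (le_trans (ltW rs)).
have h2 : E 0 - tE 0 = 0 %[ae vol in Om] := ae_subr0 (ae_sym tE0).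
have h3 := ae0_curl oOm (L2B mOm (LE mem0) (LtE mem0)) h2.
have zE : zval Om T eps mu E tE tEt Y = wnorm eps Om (dt Om T E 0 - tEt 0) ^+ 2.
  rewrite /zval (ae0_wnorm mOm hmu.2 (L2_curl_any oOm _) h3).
  rewrite (innerC _ (Ktilde _ _ _ _ _)).
  rewrite (inner_ae0l mOm (L2_curl_any oOm _) (LKtilde mem0) h3).
  by rewrite mulr0 !addr0.
have int0 (s : R) : s \in `[0, T] ->
    inner_t Om s (Ktilde Om mu tE Y) (fun r => curl Om (tEt r - dt Om T tE r)) = 0.
  move=> s0T; apply: ae0_Rintegral; apply: leb_aeS tEt_dt => r h rs.
  have r0T := oT s r s0T rs.
  have r0T' : r \in `]0, T[.
    move: s0T rs; rewrite /= !in_itv/= => /andP[_ sT] /andP[-> rs].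
    exact: lt_le_trans sT.
  have d0 := ae_subr0 (h r0T').
  have c0 := ae0_curl oOm (L2B mOm (LtEt r0T) (L2_dt oOm T _ _)) d0.
  by rewrite innerC (inner_ae0l mOm (L2_curl_any oOm _) (LKtilde r0T) c0).
have KI (s r : R) : s \in `[0, T] -> r \in `]0, s[ ->
    0 <= Kcheck_integrand Om T eps tEt Y K gam r.
  move=> s0T rs; rewrite /Kcheck_integrand mulr_ge0 ?sqr_ge0// invr_ge0 ltW//.
  exact: hgam (oT s r s0T rs).
have DI (s r : R) : s \in `[0, T] -> r \in `]0, s[ ->
    0 <= defect_integrand Om T mu tEt Y rho gam r.
  move=> s0T rs; rewrite /defect_integrand mulr_ge0 ?sqr_ge0// invr_ge0.
  have r0T := oT s r s0T rs; have /andP[r0 _] := hrho r0T.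
  by rewrite mulr_ge0// ltW// hgam.
have terms (s : R) : s \in `[0, T] ->
    [/\ 0 <= (1 - rho s)^-1 * wnorm mu Om (Ktilde Om mu tE Y s) ^+ 2,
     0 <= \int[leb]_(r in `]0, s[) Kcheck_integrand Om T eps tEt Y K gam r,
     0 <= \int[leb]_(r in `]0, s[) defect_integrand Om T mu tEt Y rho gam r &
     0 <= wnorm eps Om (dt Om T E 0 - tEt 0) ^+ 2].
  move=> s0T; split.
  - rewrite mulr_ge0 ?sqr_ge0// invr_ge0 subr_ge0 ltW//.
    by have /andP[] := hrho s0T.
  - by apply: Rintegral_ge0 => r; exact: KI.
  - by apply: Rintegral_ge0 => r; exact: DI.
  - exact: sqr_ge0.
have fE (s : R) : s \in `[0, T] -> ffun_t Om T eps mu E tE tEt Y K rho gam s =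
    (1 - rho s)^-1 * wnorm mu Om (Ktilde Om mu tE Y s) ^+ 2
    + \int[leb]_(r in `]0, s[) Kcheck_integrand Om T eps tEt Y K gam r
    + \int[leb]_(r in `]0, s[) defect_integrand Om T mu tEt Y rho gam r
    + wnorm eps Om (dt Om T E 0 - tEt 0) ^+ 2.
  by move=> s0T; rewrite /ffun_t /gfun zE (int0 s s0T) mulr0 addr0.
have f_ge0 (s : R) : s \in `[0, T] -> 0 <= ffun_t Om T eps mu E tE tEt Y K rho gam s.
  move=> s0T; rewrite (fE s s0T); have [q1 q2 q3 q4] := terms s s0T.
  exact: (addr_ge0 (addr_ge0 (addr_ge0 q1 q2) q3) q4).
move=> t0T; have [p1 p2 p3 p4] := terms t t0T.
have i0 : 0 <= expR (Gamma gam t) *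
    \int[leb]_(s in `]0, t[) b_integrand Om T eps mu E tE tEt Y K rho gam s.
  apply: mulr_ge0 (expR_ge0 _) _; apply: Rintegral_ge0 => s st.
  have s0T := oT t s t0T st.
  exact: mulr_ge0 (mulr_ge0 (expR_ge0 _) (ltW (hgam s0T))) (f_ge0 s s0T).
have := b0 t0T; rewrite /bfun (fE t t0T) => sum0.
have [A0 B0 D0] := ge0_sum_eq0 i0 p1 p2 p3 p4 sum0.
split; [|exact: B0|exact: D0].
have r1 : 1 - rho t != 0.
  by rewrite subr_eq0 eq_sym lt_eqF//; have /andP[] := hrho t0T.
move/eqP: A0; rewrite mulf_eq0 invr_eq0 (negbTE r1)/= => /eqP A0; exact: A0.
Qed.

Hypotheses (pwE : pwCk_on (Hcurl Om) 1 0 T tE) (pwEt : pwCk_on (Hcurl Om) 1 0 T tEt)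
  (het : forall t : R, t \in `]0, T[ -> carrier (Hcurl0 Om) (dt Om T E t - tEt t)).

Let memT : T \in `[0, T]. Proof. by rewrite in_itv/= lexx ltW. Qed.

Let Y_tE (t : R) : t \in `[0, T] -> Y t = mfapp (mfinv mu) (curl Om (tE t)) %[ae vol in Om].
Proof.
move=> t0T; have [w0 _ _] := majorant_eq0_terms t0T.
apply: vol_aeS (wnorm_eq0 mOm hmu.1 (LKtilde t0T) w0) => x h Ox.
by have /eqP := h Ox; rewrite /Ktilde !fctE subr_eq0 => /eqP ->.
Qed.

(** The integral over all of ]0, T[ is 0 and the integrand nonnegative. Integrability rules out that
    the real value 0 stands for an infinite integral. *)
Let Kcheck_ae0 : {ae (@lebesgue_measure R), forall s, s \in `]0, T[ ->
  Kcheck Om T eps tEt Y K s = 0 %[ae vol in Om]}.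
Proof.
have [_ i0 _] := majorant_eq0_terms memT.
have K_ge0 (s : R) : `]0, T[%classic s -> 0 <= Kcheck_integrand Om T eps tEt Y K gam s.
  move=> s0T; apply: mulr_ge0 (sqr_ge0 _).
  by rewrite invr_ge0 ltW//; exact: hgam (sub0T s0T).
have mI : measurable (`]0, T[%classic : set (measurableTypeR R)) by exact: measurable_itv.
apply: leb_aeS (ge0_Rintegral_eq0_ae mI iK K_ge0 i0) => s h s0T.
have /eqP := h s0T; rewrite /Kcheck_integrand mulf_eq0 invr_eq0.
rewrite gt_eqF/=; last exact: hgam (sub0T s0T).
by move=> /eqP; exact: (wnorm_eq0 mOm heps.2 (LKcheck (sub0T s0T))).
Qed.

(** [E1] replaces [dt E], and below the difference of the curls replaces the curl of the difference:
    versions equal almost everywhere, to which the lemmas on continuity and differentiation apply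
    directly. *)
Let et (s : R) : field3 R := E1 s - tEt s.
Let ce (s : R) : field3 R := curl Om (E s) - curl Om (tE s).
Let L2_et (s : R) : s \in `[0, T] -> L2 Om (et s).
Proof. by move=> s0T; exact: (L2B mOm (LE1 s0T) (LtEt s0T)). Qed.
Let L2_ce (s : R) : s \in `[0, T] -> L2 Om (ce s).
Proof. by move=> s0T; exact: (L2B mOm (L2_curl (HE s0T)) (L2_curl (HtE s0T))). Qed.

Let energy (s : R) : R := inner Om (mfapp eps (et s)) (et s) +
  inner Om (mfapp (mfinv mu) (ce s)) (ce s).

(** * Rates of change on an interval where the approximations are C^1 *)

Section Local.
Variables (a b : R) (p q : R -> field3 R).
Hypotheses (ab0T : `[a, b] `<=` `[0, T])
  (dp : forall s : R, s \in `[a, b] -> has_deriv (Hcurl Om) a b tE s (p s))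
  (cp : C0_on (Hcurl Om) a b p)
  (dq : forall s : R, s \in `[a, b] -> has_deriv (Hcurl Om) a b tEt s (q s))
  (cq : C0_on (Hcurl Om) a b q).

Let oo_cc (s : R) : s \in `]a, b[ -> s \in `[a, b] := @subset_itv_oo_cc _ _ _ _ s.
Let sab0T (s : R) : s \in `[a, b] -> s \in `[0, T]. Proof. exact: ab0T. Qed.
Let sub_oo (s : R) : s \in `]a, b[ -> s \in `]0, T[.
Proof.
move=> sab; have ab : a <= b.
  by move: sab; rewrite in_itv/= => /andP[as_ sb]; exact: ltW (lt_trans as_ sb).
have /ab0T : a \in `[a, b] by rewrite in_itv/= lexx.
have /ab0T : b \in `[a, b] by rewrite in_itv/= lexx andbT.
move: sab; rewrite /= !in_itv/= => /andP[as_ sb] /andP[_ bT] /andP[a0 _].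
by rewrite (le_lt_trans a0 as_) (lt_le_trans sb bT).
Qed.
Let Hp (s : R) : s \in `[a, b] -> in_Hcurl Om (p s). Proof. by move=> /cp[]. Qed.
Let Lp (s : R) : s \in `[a, b] -> L2 Om (p s). Proof. by move=> /Hp/Hcurl_L2. Qed.
Let Lq (s : R) : s \in `[a, b] -> L2 Om (q s). Proof. by move=> /cq[/Hcurl_L2]. Qed.

Let dt_tE (s : R) : s \in `]a, b[ -> dt Om T tE s = p s %[ae vol in Om].
Proof.
move=> sab; have d := has_deriv_local 0 T sab (has_deriv_Hcurl (dp (oo_cc sab))).
exact: (dt_ae oOm T0 (sab0T (oo_cc sab)) LtE d).
Qed.

Let dt_tEt (s : R) : s \in `]a, b[ -> dt Om T tEt s = q s %[ae vol in Om].
Proof.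
move=> sab; have d := has_deriv_local 0 T sab (has_deriv_Hcurl (dq (oo_cc sab))).
exact: (dt_ae oOm T0 (sab0T (oo_cc sab)) LtEt d).
Qed.

Let et' (s : R) : field3 R := E2 s - q s.
Let ce' (s : R) : field3 R := curl Om (E1 s) - curl Om (p s).
Let energy' (s : R) : R :=
  (inner Om (mfapp eps (et' s)) (et s) + inner Om (mfapp eps (et s)) (et' s)) +
  (inner Om (mfapp (mfinv mu) (ce' s)) (ce s) + inner Om (mfapp (mfinv mu) (ce s)) (ce' s)).

Let L2_et' (s : R) : s \in `[a, b] -> L2 Om (et' s).
Proof. by move=> sab; exact: (L2B mOm (LE2 (sab0T sab)) (Lq sab)). Qed.
Let L2_ce' (s : R) : s \in `[a, b] -> L2 Om (ce' s).
Proof. by move=> sab; exact: (L2B mOm (L2_curl (HE1 (sab0T sab))) (L2_curl (Hp sab))). Qed.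

(* The contributions of the two fields cancel by Green's formula. *)
Let energy'_eq0 (s : R) : s \in `]0, T[ -> s \in `]a, b[ ->
  Kcheck Om T eps tEt Y K s = 0 %[ae vol in Om] ->
  tEt s = dt Om T tE s %[ae vol in Om] -> energy' s = 0.
Proof.
move=> s0T sab Kc0 d0; have sab' := oo_cc sab; have s0T' := sab0T sab'.
have tEt_p : tEt s = p s %[ae vol in Om] by exact: (ae_trans d0 (dt_tE sab)).
(* Almost everywhere [Z] is mu^-1 curl e; in this form it visibly lies in H(curl), as Green's
   formula demands. *)
pose Z := mfapp (mfinv mu) (curl Om (E s)) - Y s.
have HZ : in_Hcurl Om Z := HcurlB oOm (hmE s0T') (HY s0T').
have ZE : Z = mfapp (mfinv mu) (ce s) %[ae vol in Om].
  apply: vol_aeS (Y_tE s0T') => x h Ox.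
  by rewrite /Z /ce mfappB !fctE h.
(* The wave equation minus the vanishing residual. *)
have F2 : mfapp eps (et' s) = - curl Om Z %[ae vol in Om].
  have cZ := curlB oOm (hmE s0T') (HY s0T').
  have W := vol_aeS2 (fun x h1 h2 => conj h1 h2) (hwave s0T) cZ.
  have V := vol_aeS2 (fun x h1 h2 => conj h1 h2) Kc0 (dt_tEt sab).
  apply: vol_aeS2 _ W V => x [h1 h2] [h3 h4] Ox.
  have := h3 Ox; rewrite /Kcheck !fctE (h1 Ox) /et' mfappB !fctE (h2 Ox) !fctE.
  rewrite {1}/mfapp (h4 Ox) -/(mfapp eps (q s) x).
  exact: residual_eq0_sub.
(* The vanishing trace is known for [dt E - tEt], so Green's formula is applied to this version of
   [et]. *)
pose v := dt Om T E s - tEt s.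
have Lv : L2 Om v := L2B mOm (L2_dt oOm T _ _) (LtEt s0T').
(* With [tEt] equal to the derivative [p] of [tE], the curl of the velocity error is the derivative
   of the curl error. *)
have et_v : et s = v %[ae vol in Om].
  by apply: vol_aeS (dtE s0T') => x h Ox; rewrite /et /v !fctE h.
have curl_v : curl Om v = ce' s %[ae vol in Om].
  have cB := curlB oOm (HE1 s0T') (HtEt s0T').
  rewrite (curl_ae oOm (LtEt s0T') (Lp sab') tEt_p) in cB.
  rewrite -/(et s) (curl_ae oOm (L2_et s0T') Lv et_v) in cB.
  exact: cB.
have LcZ := L2_curl HZ; have Lmc := L2_mfapp mOm hmu.2 (L2_ce s0T').
have X : inner Om (mfapp eps (et' s)) (et s) = - inner Om (mfapp (mfinv mu) (ce s)) (ce' s).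
  rewrite (inner_ael mOm (L2_mfapp mOm heps.1 (L2_et' sab')) (L2N mOm LcZ) (L2_et s0T') F2).
  rewrite (inner_aer mOm (L2_et s0T') Lv (L2N mOm LcZ) et_v) (innerNl mOm LcZ Lv).
  rewrite -(Green oOm HZ (het s0T)).
  rewrite (inner_ael mOm (Hcurl_L2 HZ) Lmc (L2_curl_any oOm _) ZE).
  by rewrite (inner_aer mOm (L2_curl_any oOm _) (L2_ce' sab') Lmc curl_v).
rewrite /energy' (inner_mfapp_sym heps.1 (et s)) (innerC _ (et s)) X.
rewrite (inner_mfapp_sym hmu.2 (ce' s)) (innerC _ (ce' s)); ring.
Qed.

Lemma energy_derive0 (t : R) : t \in `]a, b[ -> is_derive t 1 energy 0.
Proof.
move=> tab; have tab' := oo_cc tab.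
have LetE (s : R) : s \in `[a, b] -> L2 Om (et s) by move=> /sab0T/L2_et.
have LceE (s : R) : s \in `[a, b] -> L2 Om (ce s) by move=> /sab0T/L2_ce.
have LE1' (s : R) : s \in `[a, b] -> L2 Om (E1 s) by move=> /sab0T/LE1.
have LtEt' (s : R) : s \in `[a, b] -> L2 Om (tEt s) by move=> /sab0T/LtEt.
have HE' (s : R) : s \in `[a, b] -> in_Hcurl Om (E s) by move=> /sab0T/HE.
have HtE' (s : R) : s \in `[a, b] -> in_Hcurl Om (tE s) by move=> /sab0T/HtE.
have LcE (s : R) : s \in `[a, b] -> L2 Om (curl Om (E s)) by move=> /HE'/L2_curl.
have LctE (s : R) : s \in `[a, b] -> L2 Om (curl Om (tE s)) by move=> /HtE'/L2_curl.
have det : has_deriv (L2sp Om) a b et t (et' t).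
  exact: (has_deriv_sub oOm LE1' LtEt' tab' (has_derivS ab0T (dE1 (sab0T tab')))
    (has_deriv_Hcurl (dq tab'))).
have dce : has_deriv (L2sp Om) a b ce t (ce' t).
  exact: (has_deriv_sub oOm LcE LctE tab'
    (has_deriv_curl oOm HE' tab' (has_derivS ab0T (dE (sab0T tab'))))
    (has_deriv_curl oOm HtE' tab' (dp tab'))).
have Leet (s : R) : s \in `[a, b] -> L2 Om (mfapp eps (et s)).
  by move=> sab; exact: (L2_mfapp mOm heps.1 (LetE s sab)).
have Lmce (s : R) : s \in `[a, b] -> L2 Om (mfapp (mfinv mu) (ce s)).
  by move=> sab; exact: (L2_mfapp mOm hmu.2 (LceE s sab)).
have q1 := has_deriv_inner oOm Leet LetE tab' (has_deriv_mfapp oOm heps.1 LetE tab' det) det.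
have q2 := has_deriv_inner oOm Lmce LceE tab' (has_deriv_mfapp oOm hmu.2 LceE tab' dce) dce.
have quot : (s - t)^-1 * (energy s - energy t) - energy' t
    @[s --> within (`[a, b] `\ t) (nbhs t)] --> (0 : R).
  apply: cvg_trans (tends0D q1 q2); apply: near_eq_cvg; apply: nearW => s.
  exact: sum_quotientE.
have cet : C0_on (L2sp Om) a b et.
  exact: (C0_sub oOm (C0_onS ab0T (C0_Hcurl cE1)) (C0_onS ab0T (C0_Hcurl ctEt))).
have cce : C0_on (L2sp Om) a b ce.
  exact: (C0_sub oOm (C0_onS ab0T (C0_curl oOm cE)) (C0_onS ab0T (C0_curl oOm ctE))).
have cet' : C0_on (L2sp Om) a b et'.
  exact: (C0_sub oOm (C0_onS ab0T cE2) (C0_Hcurl cq)).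
have cce' : C0_on (L2sp Om) a b ce'.
  exact: (C0_sub oOm (C0_onS ab0T (C0_curl oOm cE1)) (C0_curl oOm cp)).
have cont : energy' s - energy' t @[s --> within `[a, b] (nbhs t)] --> (0 : R).
  have c1 := C0_inner oOm (C0_mfapp oOm heps.1 cet') cet tab'.
  have c2 := C0_inner oOm (C0_mfapp oOm heps.1 cet) cet' tab'.
  have c3 := C0_inner oOm (C0_mfapp oOm hmu.2 cce') cce tab'.
  have c4 := C0_inner oOm (C0_mfapp oOm hmu.2 cce) cce' tab'.
  apply: cvg_trans (tends0D (tends0D c1 c2) (tends0D c3 c4)).
  by apply: near_eq_cvg; apply: nearW => s; exact: sum_incrementE.
have e'0 : energy' t = 0.
  apply: ae0_continuous tab cont _.
  apply: leb_aeS2 _ Kcheck_ae0 tEt_dt => s h1 h2 sab.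
  have s0T := sub_oo sab.
  exact: energy'_eq0 s0T sab (h1 s0T) (h2 s0T).
by apply: is_derive_within tab _; rewrite e'0 in quot.
Qed.

(** For almost every time [p] equals [tEt], hence [E1], so the derivative of the error is 0;
    continuity extends the vanishing of [D] to [t]. *)
Lemma error_derive0 (t : R) : (forall s : R, s \in `[0, T] -> et s = 0 %[ae vol in Om]) ->
  t \in `]a, b[ -> is_derive t 1 (fun s => inner Om (E s - tE s) (E s - tE s)) 0.
Proof.
move=> et0 tab; have tab' := oo_cc tab.
pose e' (s : R) : field3 R := E1 s - p s.
have LE' (s : R) : s \in `[a, b] -> L2 Om (E s) by move=> /sab0T/LE.
have LtE' (s : R) : s \in `[a, b] -> L2 Om (tE s) by move=> /sab0T/LtE.
have Le (s : R) : s \in `[a, b] -> L2 Om (E s - tE s).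
  by move=> sab; exact: (L2B mOm (LE' s sab) (LtE' s sab)).
have de : has_deriv (L2sp Om) a b (fun s => E s - tE s) t (e' t).
  exact: (has_deriv_sub oOm LE' LtE' tab'
    (has_derivS ab0T (has_deriv_Hcurl (dE (sab0T tab')))) (has_deriv_Hcurl (dp tab'))).
have cont_e : C0_on (L2sp Om) a b (fun s => E s - tE s).
  exact: (C0_sub oOm (C0_onS ab0T (C0_Hcurl cE)) (C0_onS ab0T (C0_Hcurl ctE))).
have cont_e' : C0_on (L2sp Om) a b e'.
  exact: (C0_sub oOm (C0_onS ab0T (C0_Hcurl cE1)) (C0_Hcurl cp)).
pose D (s : R) := inner Om (e' s) (E s - tE s) + inner Om (E s - tE s) (e' s).
have quot := has_deriv_inner oOm Le Le tab' de de.
have cont : D s - D t @[s --> within `[a, b] (nbhs t)] --> (0 : R).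
  apply: cvg_trans (tends0D (C0_inner oOm cont_e' cont_e tab') (C0_inner oOm cont_e cont_e' tab')).
  by apply: near_eq_cvg; apply: nearW => s; rewrite /D opprD addrACA.
have D0 : D t = 0.
  apply: ae0_continuous tab cont _.
  apply: leb_aeS tEt_dt => s h sab; have sab' := oo_cc sab.
  have e'0 : e' s = 0 %[ae vol in Om].
    have tEt_p := ae_trans (h (sub_oo sab)) (dt_tE sab).
    apply: vol_aeS2 _ tEt_p (et0 s (sab0T sab')) => x h1 h2 Ox.
    by have := h2 Ox; rewrite /et /e' !fctE h1.
  have Le' : L2 Om (e' s) := C0_L2 cont_e' sab'.
  by rewrite /D (innerC _ (E s - tE s)) (inner_ae0l mOm Le' (Le s sab') e'0) addr0.
by apply: is_derive_within tab _; rewrite -/(D t) D0 in quot.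
Qed.

End Local.

Let C1_local : exists S : seq R, forall t : R, t \in `]0, T[ -> t \notin S ->
  exists a b (p q : R -> field3 R), [/\ t \in `]a, b[, `[a, b] `<=` `[0, T],
   (forall s : R, s \in `[a, b] -> has_deriv (Hcurl Om) a b tE s (p s)) /\
    C0_on (Hcurl Om) a b p &
   (forall s : R, s \in `[a, b] -> has_deriv (Hcurl Om) a b tEt s (q s)) /\
    C0_on (Hcurl Om) a b q].
Proof.
have [S hS] := pwC1_local2 pwE pwEt; exists S => t t0T tS.
have [a [b [tab ab0T [_ [p [dp [cp _]]]] [_ [q [dq [cq _]]]]]]] := hS t t0T tS.
by exists a, b, p, q; split; [exact: tab|exact: ab0T|exact: (conj dp cp)|exact: (conj dq cq)].
Qed.

Let energy_eq0 (t : R) : t \in `[0, T] -> energy t = 0.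
Proof.
have [S hS] := C1_local.
have cet : C0_on (L2sp Om) 0 T et := C0_sub oOm (C0_Hcurl cE1) (C0_Hcurl ctEt).
have cce : C0_on (L2sp Om) 0 T ce := C0_sub oOm (C0_curl oOm cE) (C0_curl oOm ctE).
have cont (s : R) : s \in `[0, T] ->
    energy r - energy s @[r --> within `[0, T] (nbhs s)] --> (0 : R).
  move=> s0T; have c1 := C0_inner oOm (C0_mfapp oOm heps.1 cet) cet s0T.
  have c2 := C0_inner oOm (C0_mfapp oOm hmu.2 cce) cce s0T.
  apply: cvg_trans (tends0D c1 c2).
  by apply: near_eq_cvg; apply: nearW => r; rewrite /energy opprD addrACA.
have deriv (s : R) : s \in `]0, T[ -> s \notin S -> is_derive s 1 energy 0.
  move=> s0T sS; have [a [b [p [q [sab ab0T [dp cp] [dq cq]]]]]] := hS s s0T sS.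
  exact: (energy_derive0 ab0T dp cp dq cq sab).
move=> t0T; rewrite (const_of_derive0_finite cont deriv t0T) /energy.
(* The initial energy: the velocity part vanishes by the majorant, the curl part by the initial
   condition. *)
have [_ _ w0] := majorant_eq0_terms mem0.
have et0 : et 0 = 0 %[ae vol in Om].
  have := wnorm_eq0 mOm heps.1 (L2B mOm (L2_dt oOm T E 0) (LtEt mem0)) w0.
  apply: vol_aeS2 _ (dtE mem0) => x h1 h2 Ox.
  by have := h2 Ox; rewrite /et !fctE h1.
have ce0 : ce 0 = 0 %[ae vol in Om].
  by rewrite /ce (curl_ae oOm (LtE mem0) (LE mem0) tE0) subrr; exact: aeW.
rewrite !(innerC _ (mfapp _ _)) (inner_ae0l mOm (L2_et mem0) (L2_mfapp mOm heps.1 (L2_et mem0)) et0).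
by rewrite (inner_ae0l mOm (L2_ce mem0) (L2_mfapp mOm hmu.2 (L2_ce mem0)) ce0) addr0.
Qed.

Let et_eq0 (t : R) : t \in `[0, T] -> et t = 0 %[ae vol in Om].
Proof.
move=> t0T; apply: (inner_mfapp_eq0 mOm heps.1 (L2_et t0T)).
have := energy_eq0 t0T; rewrite /energy => /eqP.
rewrite paddr_eq0; [|exact: (inner_mfapp_ge0 heps.1)|exact: (inner_mfapp_ge0 hmu.2)].
by move=> /andP[/eqP].
Qed.

Let ce_eq0 (t : R) : t \in `[0, T] -> ce t = 0 %[ae vol in Om].
Proof.
move=> t0T; apply: (inner_mfapp_eq0 mOm hmu.2 (L2_ce t0T)).
have := energy_eq0 t0T; rewrite /energy => /eqP.
rewrite paddr_eq0; [|exact: (inner_mfapp_ge0 heps.1)|exact: (inner_mfapp_ge0 hmu.2)].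
by move=> /andP[_ /eqP].
Qed.

Let error_eq0 (t : R) : t \in `[0, T] -> tE t = E t %[ae vol in Om].
Proof.
have [S hS] := C1_local.
have cont_e : C0_on (L2sp Om) 0 T (fun s => E s - tE s).
  exact: (C0_sub oOm (C0_Hcurl cE) (C0_Hcurl ctE)).
have cont (s : R) : s \in `[0, T] -> inner Om (E r - tE r) (E r - tE r) -
    inner Om (E s - tE s) (E s - tE s) @[r --> within `[0, T] (nbhs s)] --> (0 : R).
  by move=> s0T; exact: (C0_inner oOm cont_e cont_e s0T).
have deriv (s : R) : s \in `]0, T[ -> s \notin S ->
    is_derive s 1 (fun s => inner Om (E s - tE s) (E s - tE s)) 0.
  move=> s0T sS; have [a [b [p [q [sab ab0T [dp cp] [dq cq]]]]]] := hS s s0T sS.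
  exact: (error_derive0 ab0T dp cp et_eq0 sab).
move=> t0T; have := const_of_derive0_finite cont deriv t0T.
rewrite (ae0_inner mOm (L2B mOm (LE mem0) (LtE mem0)) (ae_subr0 (ae_sym tE0))).
move=> /(inner_eq0 mOm (L2B mOm (LE t0T) (LtE t0T))).
by apply: vol_aeS => x h Ox; have /eqP := h Ox; rewrite !fctE subr_eq0 => /eqP.
Qed.

Lemma vanishing_majorant_exact :
  [/\ forall t : R, t \in `[0, T] -> tE t = E t %[ae vol in Om],
      forall t : R, t \in `[0, T] -> tEt t = dt Om T E t %[ae vol in Om] &
      forall t : R, t \in `[0, T] -> mfapp mu (Y t) = curl Om (E t) %[ae vol in Om]].
Proof.
split=> t t0T; first exact: error_eq0.
  apply: vol_aeS2 _ (et_eq0 t0T) (dtE t0T) => x h1 h2 Ox.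
  by have /eqP := h1 Ox; rewrite (h2 Ox) /et !fctE subr_eq0 => /eqP.
(* mu Y is curl tE because [Ktilde] vanishes, and curl tE is curl E because the energy does. *)
apply: vol_aeS2 _ (Y_tE t0T) (ce_eq0 t0T) => x h1 h2 Ox.
have /eqP := h2 Ox; rewrite /ce !fctE subr_eq0 => /eqP ->.
by rewrite -(mfappVK hmu.1 (curl Om (tE t)) Ox) {1}/mfapp h1.
Qed.

End VanishingMajorant.

End Equivalence.

Theorem theorem18 (R : realType) (Om : set (space3 R)) (T : R)
    (eps mu : mfield3 R)
    (F G E H : R -> field3 R) (E0 H0 : field3 R)
    (rho gam : R -> R) (tE tEt Y : R -> field3 R)
    (hOm : lipschitz_domain Om) (hT : 0 < T)
    (heps : admissible Om eps) (hmu : admissible Om mu)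
    (hFG_L1 : L1_on (D2sp Om eps mu) T (fun t => (F t, G t)))
    (hFG_C0 : Ck_on (Dsp Om) 0 0 T (fun t => (F t, G t)))
    (hFG_C1 : Ck_on (Hsp Om) 1 0 T (fun t => (F t, G t)))
    (hEH0 : carrier (D2sp Om eps mu) (E0, H0))
    (hEH_C0 : Ck_on (D2sp Om eps mu) 0 0 T (fun t => (E t, H t)))
    (hEH_C1 : Ck_on (Dsp Om) 1 0 T (fun t => (E t, H t)))
    (hEH_C2 : Ck_on (Hsp Om) 2 0 T (fun t => (E t, H t)))
    (hEH : maxwell_solution Om T eps mu F G E0 H0 E H)
    (hrho : forall t, t \in `[0, T] -> 0 < rho t < 1)
    (hgam : forall t, t \in `[0, T] -> 0 < gam t)
    (htE : Ckp_on (Hcurl Om) 1 0 T tE)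
    (htEt : Ckp_on (Hcurl Om) 1 0 T tEt)
    (het : forall t, t \in `]0, T[ ->
       carrier (Hcurl0 Om) (dt Om T E t - tEt t))
    (hY : Ckp_on (Hcurl Om) 1 0 T Y)
    (hint : integrals_defined Om T eps mu E tE tEt Y
              (source Om T eps F G) rho gam) :
  [/\ tE 0 = E0 %[ae vol in Om],
      {ae leb, forall t, t \in `]0, T[ ->
         tEt t = dt Om T tE t %[ae vol in Om]} &
      forall t, t \in `[0, T] ->
        bfun Om T eps mu E tE tEt Y (source Om T eps F G) rho gam t = 0]
  <->
  [/\ forall t, t \in `[0, T] -> tE t = E t %[ae vol in Om],
      forall t, t \in `[0, T] -> tEt t = dt Om T E t %[ae vol in Om] &
      forall t, t \in `[0, T] ->
        mfapp mu (Y t) = curl Om (E t) %[ae vol in Om]].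
Proof.
have oOm : open Om by case: hOm.
have [E1 [E2 hwave]] := maxwell_wave oOm hT heps hFG_C0 hFG_C1 hEH_C0 hEH_C1 hEH_C2 hEH.
have ctE : C0_on (Hcurl Om) 0 T tE := htE.1.1.
have ctEt : C0_on (Hcurl Om) 0 T tEt := htEt.1.1.
have cY : C0_on (Hcurl Om) 0 T Y := hY.1.1.
have [_ _ E0E _] := hEH; have [_ _ iK _ _] := hint.
split=> [[tE0 tEt_dt b0]|[tE_E tEt_E muY]].
  exact: (vanishing_majorant_exact oOm hT heps hmu hwave ctE ctEt cY hrho hgam
    (ae_trans tE0 (ae_sym E0E)) tEt_dt iK b0 htE.2 htEt.2 het).
have mem0 : 0 \in `[0, T] by rewrite in_itv/= lexx ltW.
split.
- exact: (ae_trans (tE_E 0 mem0) E0E).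
- apply: aeW => t t0T.
  exact: (exact_time_derivative oOm hwave ctE tE_E tEt_E (subset_itv_oo_cc t0T)).
- exact: (exact_majorant_eq0 oOm hT heps hmu hwave rho gam ctE ctEt cY tE_E tEt_E muY).
Qed.
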